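(* Let $G$ be a finite group with trivial centre whose commuting graph has an isolated edge. Then one of the following holds: (i) $G\cong N\rtimes\mathbb{Z}_3$ or $G\cong N\rtimes S_3$, where $N$ is a nilpotent group of nilpotency class at most two with $|N|\equiv 1\pmod 3$, and each element of $G$ of order three acts (by conjugation) as a fixed-point-free automorphism of $N$. (ii) $G\cong N\rtimes A_5$, where $N$ is the direct product of (possibly zero) copies of $\mathbb{Z}_2^4$, each viewed as the natural module for $\mathrm{SL}(2,4)\cong A_5$. (iii) $G\cong\mathrm{PSL}(2,7)$.
   Context: For a group $G$ with centre $Z(G)$, the commuting graph $\Gamma(G)$ is the simple graph with vertex set $G\setminus Z(G)$ in which two distinct vertices $x,y$ are adjacent if and only if $xy=yx$. An edge $\{v,w\}$ is isolated if $\{v,w\}$ is the vertex set of a connected component. An automorphism $\phi$ is fixed-point-free if $x\phi=x$ implies $x=1$. As an additive group, $\mathbb{Z}_2^4$ is identified with $\mathrm{GF}(4)^2$, on which $\mathrm{SL}(2,4)$ acts naturally by matrices; this is the natural module, and $A_5\cong\mathrm{SL}(2,4)$ acts on each factor of $N$ in this way. *)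

(* Defs.v *)
From mathcomp Require Import all_boot all_order all_algebra.
From mathcomp Require Import all_fingroup all_solvable all_field.

Set Implicit Arguments.
Unset Strict Implicit.
Unset Printing Implicit Defensive.

Import GroupScope.

Section CommutingGraph.

Variables (gT : finGroupType) (G : {group gT}).

(* Non-vertices, i.e. elements of gT outside G :\: 'Z(G), have no neighbours,
   so they never lie in the connected component of a vertex. *)
Definition commuting_graph : rel gT :=
  [rel x y | [&& x \in G :\: 'Z(G), y \in G :\: 'Z(G), x != y
               & x * y == y * x]].

End CommutingGraph.

Definition isolated_edge (T : finType) (e : rel T) (v w : T) : Prop :=
  e v w /\ [set z | connect e v z] = [set v; w].

Definition fixed_point_free_aut (gT : finGroupType) (N : {group gT})
    (f : {perm gT}) : Prop :=
  f \in Aut N /\ (forall x, x \in N -> f x = x -> x = 1).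

Section SpecialLinearGroup.

Variables (n : nat) (R : finComUnitRingType).

Definition SLgroup : {set {'GL_n[R]}} :=
  [set A : {'GL_n[R]} | (\det (GLval A) == 1)%R].

Fact SLgroup_group_set : group_set SLgroup.
Proof.
apply/group_setP; split=> [|A B]; first by rewrite inE GL_1E det1.
by rewrite !inE GL_MxE det_mulmx => /eqP-> /eqP->; rewrite GRing.mulr1.
Qed.
Canonical SLgroup_group := Group SLgroup_group_set.

Definition PSLgroup := (SLgroup / 'Z(SLgroup)).

End SpecialLinearGroup.

Arguments SLgroup n%_N R%_type.
Arguments SLgroup_group n%_N R%_type.
Arguments PSLgroup n%_N R%_type.

Definition GF4 : finFieldType :=
  s2val (pPrimePowerField (isT : prime 2) (isT : 0 < 2)).

(* V, acted on by H via conjugation, is the natural module GF(4)^2 (row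
   vectors, right action) when H is identified with SL(2,4) through f. *)
Definition natural_SL24_module (gT : finGroupType) (H : {group gT})
    (f : {morphism H >-> {'GL_2[GF4]}}) (V : {group gT}) : Prop :=
  H \subset 'N(V) /\
  exists g : {morphism V >-> 'rV[GF4]_2},
    isom V [set: 'rV[GF4]_2] g /\
    (forall x h, x \in V -> h \in H -> g (x ^ h) = (g x *m GLval (f h))%R).

(* The identification of H with SL(2,4) is the same for all the factors. *)
Definition direct_product_of_natural_modules (gT : finGroupType)
    (N H : {group gT}) : Prop :=
  exists f : {morphism H >-> {'GL_2[GF4]}}, isom H (SLgroup 2 GF4) f /\
  exists (k : nat) (V : 'I_k -> {group gT}),
    \big[dprod/1]_(i < k) V i = N /\
    (forall i, natural_SL24_module f (V i)).

(* Main.v *)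
(** An isolated edge {v, w} forces C_G(v) = {1, v, w}, so v has order three and
    generates its own centralizer.  Let x = v.  A 3'-subgroup normalized by x
    carries a fixed-point-free automorphism of order three, hence has class at
    most two (B. H. Neumann); take N = O_3'(G).

    In G/N the union S of the x-invariant 3'-subgroups is controlled by
    characters: column orthogonality leaves exactly three irreducible characters
    not vanishing at x, of degrees 1, f and f + 1, and the class equation gives
    |S| = |G| / 9 * (1 + 1 / f - 1 / (f + 1)).  So either G/N has a proper normal
    subgroup containing x, and then order 3 or 6, or |G/N| / |S| lies in a short
    interval just below 9.  Counting S through the maximal x-invariant
    3'-subgroups, of which there are few, leaves only the orders 60 and 168.
    These two groups are recognized by their actions on five and eight points.

    When |G/N| is 60 or 168, a Klein four-subgroup of G/N lifts to an x-invariant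
    3'-group of class two; this forces N to be elementary abelian of exponent
    two.  In order 168 an element of order 7 lifts to one centralizing N, whence
    N = 1; in order 60 Gaschutz' theorem splits G over N, and N is decomposed
    into natural modules by hand. *)


Require Import Defs.
From mathcomp Require Import all_boot all_order all_algebra.
From mathcomp Require Import all_fingroup all_solvable all_field.
From mathcomp Require Import all_character zify ring lra.

Set Implicit Arguments.
Unset Strict Implicit.
Unset Printing Implicit Defensive.

(** * Numerical constraints on the group order *)

(** The short interval comes from [f %% 3 = 1] and [f > 1]: then [f >= 4], and the formula for |S|
    gives [n < 9 * S] and [60 * S <= 7 * n] with [n = |G|]. Order 60 (f = 4) attains the second
    bound; order 168 has f = 7 and |S| = 19. To exploit this, S is cut into its 2-elements and the
    sets [U :\: 'O_2(U)], for U a maximal invariant 3'-subgroup that is not a 2-group. For odd p the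
    nontrivial maximal invariant p-subgroups are Sylow subgroups, meet pairwise trivially, and at
    most two of them exist. Hence distinct odd parts have coprime orders: these multiply in |G| but
    only add in |S|, which is why so little survives. The prime 2 is the obstacle. The normalizer of
    a maximal invariant 2-subgroup P may have index 6 over its 3'-core, so P may have index 2 in a
    larger 2-group. If some Sylow 2-subgroup is invariant, the count ends at 60. If none is, at most
    two maximal invariant 2-subgroups have order 4, at most one is larger, and the count ends at
    168. *)

Lemma prod_coprime_dvdn (s : seq nat) n : uniq s ->
    {in s &, forall v w, v != w -> coprime v w} -> {in s, forall v, v %| n} ->
  \prod_(v <- s) v %| n.
Proof.
elim: s => [|a s IHs] /=; first by rewrite big_nil dvd1n.
case/andP=> nsa us co dv; rewrite big_cons Gauss_dvd.
  rewrite dv ?mem_head //= IHs // => [v w sv sw|v sv].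
    by apply: co; rewrite inE ?sv ?sw orbT.
  by apply: dv; rewrite inE sv orbT.
rewrite big_seq; elim/big_ind: _ => [|b c cb cc|v sv]; first exact: coprimen1.
  by rewrite coprimeMr cb.
apply: co; rewrite ?mem_head ?inE ?sv ?orbT //.
by apply: contraNneq nsa => ->.
Qed.

(** Equality holds for two sevens; every further factor, being at least 7, multiplies the product
    but only adds to the sum. *)
Lemma sum_prod_ge7 (s : seq nat) : {in s, forall v, 6 < v} -> 1 < size s ->
  48 < \prod_(v <- s) v /\ 7 * (\sum_(v <- s) v) <= 2 * \prod_(v <- s) v.
Proof.
elim: s => [|a s IHs] // gt7 sz; have a7 := gt7 a (mem_head _ _).
case: s IHs gt7 sz => [|b [|d s]] // IHs gt7 _.
  have b7 : 6 < b by apply: gt7; rewrite !inE eqxx orbT.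
  by rewrite !big_cons !big_nil; nia.
have sz' : 1 < size [:: b, d & s] by [].
move: [:: b, d & s] sz' IHs gt7 => l sz' IHs gt7.
have [|//|p1 p2] := IHs; first by move=> v sv; apply: gt7; rewrite inE sv orbT.
rewrite !big_cons; move: (\prod_(v <- l) v) (\sum_(v <- l) v) p1 p2 => p q p1 p2.
by split; nia.
Qed.

(** In the uses, [s] lists the orders of the odd parts of maximal invariant subgroups, and [c v]
    adds up the orders of the 2-parts that occur with [v]. With two or more values the product
    outgrows the sum, and a crude estimate settles the window. *)
Lemma h_values_cases (s : seq nat) (c : nat -> nat) m :
    {in s, forall v, 6 < v} -> {in s, forall v, c v <= m} ->
  [\/ s = [::], exists2 v, 6 < v & s = [:: v] |
     48 < \prod_(v <- s) v /\
     7 * (\sum_(v <- s) c v * (v - 1)) <= 2 * m * \prod_(v <- s) v].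
Proof.
move=> gt7 lem; case: s gt7 lem => [|a [|b s]] gt7 lem; first exact: Or31.
  by apply: Or32; exists a => //; apply: gt7 (mem_head _ _).
apply: Or33; have [//|p1 p2] := sum_prod_ge7 gt7; split=> //.
have le : \sum_(v <- [:: a, b & s]) c v * (v - 1) <=
          m * (\sum_(v <- [:: a, b & s]) v).
  rewrite big_distrr /= big_seq [X in _ <= X]big_seq; apply: leq_sum => v sv.
  by rewrite leq_mul ?lem // leq_subr.
move: (\sum_(v <- _) c v * _) (\sum_(v <- _) v) (\prod_(v <- _) v) p1 p2 le => A B C p1 p2 le.
have : m * (7 * B) <= m * (2 * C) by rewrite leq_mul2l p2 orbT.
by lia.
Qed.

(** The case without nontrivial invariant 2-subgroup: the 2-elements contribute only the identity.
    The factor 6 comes from [x] and an involution. *)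
Lemma window_no2 (s : seq nat) (c : nat -> nat) r n S :
    {in s, forall v, 6 < v} -> {in s, forall v, c v = 1 \/ c v = 2} ->
    S = 1 + \sum_(v <- s) c v * (v - 1) -> n = 6 * \prod_(v <- s) v * r ->
  n < 9 * S -> 60 * S <= 7 * n -> False.
Proof.
move=> gt7 c12 -> -> w1 w2.
have le2 : {in s, forall v, c v <= 2} by move=> v /c12[]->.
case: (h_values_cases gt7 le2) => [s0|[v v7 s1]|[H49]].
- by move: w1 w2; rewrite s0 !big_nil; lia.
- have := c12 v; rewrite s1 mem_head => /(_ isT) cv.
  move: w1 w2; rewrite s1 !big_seq1 => w1 w2.
  case: r w1 w2 => [|[|[|r]]] w1 w2; case: cv w1 w2 => -> w1 w2; nia.
move: (\sum_(v <- s) _) (\prod_(v <- s) _) H49 w1 w2 => A H H49 w1 w2 le.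
by case: r w1 w2 => [|r] w1 w2; nia.
Qed.

(** The case of an invariant Sylow 2-subgroup fixed by the inverting involution; the number [x] is
    the order of the maximal invariant 3'-subgroup above it. *)
Lemma window_Sylow1 (s : seq nat) (c : nat -> nat) x r n S :
    {in s, forall v, 6 < v} -> {in s, forall v, v %% 6 = 1} ->
    {in s, forall v, c v = 1 \/ c v = 2} -> x = 4 \/ 16 <= x ->
    S = x + \sum_(v <- s) c v * (v - 1) -> n = 3 * x * \prod_(v <- s) v * r ->
    odd r ->
  n < 9 * S -> 60 * S <= 7 * n -> False.
Proof.
move=> gt7 mod6 c12 x4 -> -> odr w1 w2.
have le2 : {in s, forall v, c v <= 2} by move=> v /c12[]->.
case: (h_values_cases gt7 le2) => [s0|[v v7 s1]|[H49]].
- by move: w1 w2; rewrite s0 !big_nil; case: r odr => [|[|[|r]]] //; nia.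
- have := c12 v; have := mod6 v; rewrite s1 mem_head => /(_ isT) v6 /(_ isT) cv.
  move: w1 w2; rewrite s1 !big_seq1; case: r odr => [|[|[|r]]] // _ w1 w2.
    by case: cv w1 w2 => -> w1 w2; case: x4 w1 w2 => [->|x16] w1 w2; nia.
  by case: cv w1 w2 => -> w1 w2; case: x4 w1 w2 => [->|x16] w1 w2; nia.
move: (\sum_(v <- s) _) (\prod_(v <- s) _) H49 w1 w2 => A H H49 w1 w2 le.
by case: r odr w1 w2 => [|r] // _ w1 w2; case: x4 w1 w2 => [->|x16] w1 w2; nia.
Qed.

(** The case of an invariant Sylow 2-subgroup [T] moved by [t]: [q] is its order, [d] that of
    [T :&: T :^ t], and [h] the odd part of the core of its normalizer. Two conjugate subgroups of
    order [q * h] then share exactly [d] elements. *)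
Lemma window_Sylow2 (s : seq nat) (c : nat -> nat) q i d h r n S :
    {in s, forall v, 6 < v} -> {in s, forall v, v %% 6 = 1} ->
    {in s, forall v, c v = 1 \/ c v = 2} ->
    h %% 6 = 1 -> q = d * i -> i = 4 \/ 16 <= i -> q = 4 \/ q = 16 \/ 64 <= q ->
    {in s, forall v, coprime v h} ->
    S = 2 * (q * h) - d + \sum_(v <- s) c v * (v - 1) ->
    n = 3 * (q * h) * \prod_(v <- s) v * r -> odd r -> r %% 3 <> 0 ->
  n < 9 * S -> 60 * S <= 7 * n -> n = 15 * q /\ i = 4.
Proof.
move=> gt7 mod6 c12 h6 qE i4 q4 co -> -> odr r3 w1 w2.
have d0 : 0 < d by case: d qE {w1 w2} => // qE; lia.
have dq : 4 * d <= q by rewrite qE; case: i4 => [->|i16]; nia.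
have h0 : 0 < h by lia.
have r5 : r = 1 \/ 5 <= r by case: r odr r3 {w1 w2} => [|[|[|[|[|r]]]]] //; lia.
have le2 : {in s, forall v, c v <= 2} by move=> v /c12[]->.
have Xge : q <= q * h by rewrite -{1}[q]muln1 leq_mul2l h0 orbT.
case: (h_values_cases gt7 le2) => [s0|[v v7 s1]|[H49]].
- move: w1 w2; rewrite s0 !big_nil muln1 addn0; move: (q * h) Xge => X Xge w1 w2.
  have rlt : r < 6 by nia.
  have rE : r = 5 by case: r5 => [rE|]; [move: w2; rewrite rE; lia | lia].
  rewrite rE in w1 w2 *; have XE : X = q by lia.
  by split; [lia | case: i4 => // i16; nia].
- have := c12 v; have := mod6 v; have := co v.
  rewrite s1 mem_head => /(_ isT) cov /(_ isT) v6 /(_ isT) cv.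
  have cle : c v <= 2 by case: cv => ->.
  (* Even for [r = 1] and [d = 1] the first window inequality reads [(X - 6) * (v - 6) < 27] with
     [X = q * h], which fails from [X = 33] on. Below 33 only 4, 16 and 28 occur. *)
  have Xs : q * h = 4 /\ q = 4 \/ q * h = 16 /\ q = 16 \/ h = 7 /\ q = 4 \/ 33 <= q * h.
    case: q4 => [->|[->|q64]]; last by do 3!right; lia.
      have : h = 1 \/ h = 7 \/ 13 <= h by lia.
      by case=> [->|[->|h13]]; [left | right; right; left | do 3!right; lia].
    have : h = 1 \/ 7 <= h by lia.
    by case=> [->|h7]; [right; left | do 3!right; lia].
  move: w1 w2; rewrite s1 !big_seq1 => w1 w2.
  case: Xs => [[XE qE4]|[[XE qE16]|[[hE qE4]|X33]]].
  + rewrite XE in w1 w2; have dE : d = 1 by lia.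
    rewrite dE in w1 w2; case: r5 w1 w2 => [->|r5] w1 w2; last by case: cv w1 w2 => -> w1 w2; nia.
    by case: cv w1 w2 => -> w1 w2; lia.
  + rewrite XE in w1 w2; have dE : d = 1 \/ d = 4.
      by move: qE; rewrite qE16; case: i4 => [->|i16] qE; [right; lia | left; nia].
    case: r5 w1 w2 => [->|r5] w1 w2; last by case: cv w1 w2 => -> w1 w2; nia.
    by case: cv w1 w2 => -> w1 w2; case: dE w1 w2 => -> w1 w2; lia.
  + rewrite hE qE4 in w1 w2; have vE : v = 7.
      by case: cv w1 w2 => -> w1 w2; nia.
    by move: cov; rewrite vE hE.
  move: (q * h) X33 w1 w2 dq => X X33 w1 w2 dq.
  have le : 3 * X * v <= 3 * X * v * r by rewrite leq_pmulr //; lia.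
  have {w1} : 3 * X * v < 9 * (2 * X - d + 2 * (v - 1)).
    by apply: leq_ltn_trans le (leq_trans w1 _); rewrite leq_mul2l leq_add2l leq_mul2r cle orbT.
  by clear -X33 d0 v7; nia.
move: (\sum_(v <- s) _) (\prod_(v <- s) _) H49 w1 w2 => A H H49 w1 w2 le.
have X4 : 4 <= q * h by lia.
move: (q * h) X4 w1 w2 => X X4 w1 w2.
have le3 : 3 * X * H <= 3 * X * H * r by rewrite leq_pmulr //; lia.
have {w1} : 3 * X * H < 9 * (2 * X - d + A) by apply: leq_ltn_trans le3 w1.
by clear -X4 H49 le; nia.
Qed.

(** Here one maximal invariant 2-subgroup has order [p] and index 2 in a Sylow subgroup; the others
    have order 4, there are at most two, and they add at most 6 elements to [s2]. *)
Lemma window_big (s : seq nat) (c : nat -> nat) p r n S s2 :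
    {in s, forall v, 6 < v} ->
    {in s, forall v, c v <= 4 \/ c v = p} -> 16 <= p -> p <= s2 <= p + 6 ->
    S = s2 + \sum_(v <- s) c v * (v - 1) ->
    n = 3 * (2 * p) * \prod_(v <- s) v * r -> odd r -> r %% 3 <> 0 ->
  n < 9 * S -> 60 * S <= 7 * n -> False.
Proof.
move=> gt7 cv4 p16 s2p -> -> odr r3 w1 w2.
have r5 : r = 1 \/ 3 <= r by case: r odr r3 {w1 w2} => [|[|[|[|[|r]]]]] //; lia.
have lep : {in s, forall v, c v <= p} by move=> v /cv4; lia.
case: (h_values_cases gt7 lep) => [s0|[v v7 s1]|[H49]].
- move: w1 w2; rewrite s0 !big_nil => w1 w2.
  by case: r5 w1 w2 => [->|r5] w1 w2; nia.
- have := cv4 v; rewrite s1 mem_head => /(_ isT) cv.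
  move: w1 w2; rewrite s1 !big_seq1 => w1 w2.
  case: cv w1 w2 => [c4|->] w1 w2.
    have le : 3 * (2 * p) * v <= 3 * (2 * p) * v * r by rewrite leq_pmulr //; lia.
    have {w1} : 3 * (2 * p) * v < 9 * (p + 6 + 4 * (v - 1)).
      apply: leq_ltn_trans le (leq_trans w1 _); rewrite leq_mul2l /=.
      by apply: leq_add; [lia | rewrite leq_mul2r c4 orbT].
    by clear -p16 v7; nia.
  have e1 : p * v <= s2 + p * (v - 1) by nia.
  have e2 : s2 + p * (v - 1) <= p * v + 6 by nia.
  have pv : 112 <= p * v by nia.
  have en : 3 * (2 * p) * v * r = 6 * (p * v) * r by lia.
  rewrite en in w1 w2; move: (p * v) (s2 + p * (v - 1)) e1 e2 pv w1 w2 => X Y e1 e2 pv w1 w2.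
  by clear -e1 e2 pv w1 w2 r5; case: r5 w1 w2 => [->|r5] w1 w2; nia.
move: (\sum_(v <- s) _) (\prod_(v <- s) _) H49 w1 w2 => A H H49 w1 w2 le.
have le3 : 3 * (2 * p) * H <= 3 * (2 * p) * H * r by rewrite leq_pmulr //; lia.
have {w1} : 3 * (2 * p) * H < 9 * (p + 6 + A).
  by apply: leq_ltn_trans le3 (leq_trans w1 _); lia.
by clear -p16 H49 le; nia.
Qed.

(** Here all maximal invariant 2-subgroups have order 4, and one or two of them give [s2] = 4 or 7.
    The factor 24 is 3 times 8, since a Sylow 2-subgroup is strictly larger than 4. The surviving
    count is 19 = 7 + 2 * 6. *)
Lemma window_small (s : seq nat) (c : nat -> nat) r n S s2 :
    {in s, forall v, 6 < v} ->
    {in s, forall v, [\/ c v = 1, c v = 2 | c v = 4]} -> s2 = 4 \/ s2 = 7 ->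
    S = s2 + \sum_(v <- s) c v * (v - 1) ->
    n = 24 * \prod_(v <- s) v * r ->
  n < 9 * S -> 60 * S <= 7 * n -> [/\ n = 168, s2 = 7, s = [:: 7] & c 7 = 2].
Proof.
move=> gt7 cv4 s2E -> -> w1 w2.
have le4 : {in s, forall v, c v <= 4} by move=> v /cv4[]->.
case: (h_values_cases gt7 le4) => [s0|[v v7 s1]|[H49]].
- exfalso; move: w1 w2; rewrite s0 !big_nil; case: s2E => ->; lia.
- have := cv4 v; rewrite s1 mem_head => /(_ isT) cv.
  move: w1 w2; rewrite s1 !big_seq1 => w1 w2.
  have r0 : 0 < r by case: r w1 w2 => //; lia.
  have r1 : r = 1 \/ 2 <= r by lia.
  case: cv w1 w2 => cE; rewrite cE => w1 w2.
  + by exfalso; case: s2E w1 w2 => -> w1 w2; nia.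
  + case: r1 w1 w2 => [->|r2] w1 w2; last by exfalso; case: s2E w1 w2 => -> w1 w2; nia.
    case: s2E w1 w2 => -> w1 w2; first by lia.
    have vE : v = 7 by lia.
    by rewrite vE in cE *; split.
  exfalso; case: r1 w1 w2 => [->|r2] w1 w2; first by lia.
  by case: s2E w1 w2 => -> w1 w2; nia.
move=> le; exfalso; move: (\sum_(v <- s) _) (\prod_(v <- s) _) H49 w1 w2 le => A H H49 w1 w2 le.
have r0 : 0 < r by case: r w1 w2 => //; lia.
have le3 : 24 * H <= 24 * H * r by rewrite leq_pmulr //; lia.
have {w1} : 24 * H < 9 * (s2 + A) by apply: leq_ltn_trans le3 w1.
by clear -s2E H49 le; lia.
Qed.

Import GroupScope.

(** * Fixed-point-free automorphisms of order three *)

Definition fpf3 (gT : finGroupType) (W : {group gT}) (x : gT) :=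
  [&& x \in 'N(W), x ^+ 3 == 1 & 'C_W[x] == 1].

Section FixedPointFreeOrder3.

Variables (gT : finGroupType) (W : {group gT}).
Implicit Types (x a b g h : gT).

Lemma fpf3V x : fpf3 W x -> fpf3 W x^-1.
Proof.
case/and3P=> nWx x3 rx; rewrite /fpf3 groupV nWx expgVn (eqP x3) invg1 eqxx.
by rewrite -cent_cycle cycleV cent_cycle.
Qed.

Lemma fpf3J x g : g \in W -> fpf3 W x -> fpf3 W (x ^ g).
Proof.
move=> Wg /and3P[nWx x3 rx]; have Ng := subsetP (normG W) g Wg.
rewrite /fpf3 groupJ // -conjXg (eqP x3) conj1g eqxx /=.
have -> : 'C_W[x ^ g] = 'C_W[x] :^ g by rewrite conjIg -normJ conjg_set1 conjGid.
by rewrite (eqP rx) conjs1g.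
Qed.

Lemma fpf3_expV x : fpf3 W x -> x ^+ 2 = x^-1.
Proof.
case/and3P=> _ /eqP x3 _; apply/eqP.
by rewrite eq_mulgV1 invgK -expgSr x3.
Qed.

Lemma fpf3_surj x a : fpf3 W x -> a \in W -> exists2 b, b \in W & a = b^-1 * b ^ x.
Proof.
case/and3P=> nWx x3 /eqP regx; pose f b := b^-1 * b ^ x.
have injf : {in W &, injective f}.
  move=> b c Wb Wc eqf; apply/eqP; rewrite eq_sym eq_mulgV1; apply/eqP/set1gP.
  rewrite -regx inE groupM ?groupV //= cent1C.
  apply/cent1P/commute_sym/commgP/conjg_fixP.
  rewrite conjMg conjVg -(mulKVg c (c ^ x)) -[c^-1 * _]eqf /f.
  by rewrite -mulgA mulgK.
have: f @: W = W.
  apply/eqP; rewrite eqEcard card_in_imset // leqnn andbT.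
  by apply/subsetP=> _ /imsetP[b Wb ->]; rewrite groupM ?groupV ?memJ_norm.
by move=> fW; rewrite -{1}fW => /imsetP[b Wb ->]; exists b.
Qed.

(* b |-> b^-1 * b ^ x is injective, hence onto: all of the coset x * W is
   conjugate to x, so every statement about x may be applied to x * g. *)
Lemma fpf3_coset x g :
  fpf3 W x -> g \in W -> exists2 b, b \in W & x * g = x ^ b.
Proof.
move=> fx Wg; have [b Wb defg] := fpf3_surj fx (groupVr Wg).
exists b => //.
by rewrite -[g]invgK defg invMg invgK -conjVg mulgA -conjgC conjgE mulgA.
Qed.

Lemma fpf3_mulr x g : fpf3 W x -> g \in W -> fpf3 W (x * g).
Proof. by move=> fx Wg; have [b Wb ->] := fpf3_coset fx Wg; apply: fpf3J. Qed.

(** Writing [a = b^-1 * b ^ x] makes the product telescope. *)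
Lemma fpf3_prod x a : fpf3 W x -> a \in W -> a * a ^ x * a ^ (x ^+ 2) = 1.
Proof.
move=> fx Wa; have [b Wb ->] := fpf3_surj fx Wa.
have /and3P[_ /eqP x3 _] := fx.
rewrite !(conjMg b^-1) -!conjgM !conjVg -[x * x]/(x ^+ 2) -expgS x3 conjg1.
by move: (b ^ x) (b ^ (x ^+ 2)) => c d; rewrite !mulgA mulgK mulgK mulVg.
Qed.

(** The element [y = x * g] is again fixed-point-free. By [fpf3_prod] for [y] and for [y^-1], the
    products of [a ^ y] and [a ^ y^-1] in either order equal [a^-1]; this commuting pair is the
    [y]-conjugate of [a] and [a ^ y]. *)
Lemma fpf3_commJ x a g : fpf3 W x -> a \in W -> g \in W -> commute a ((a ^ x) ^ g).
Proof.
move=> fx Wa Wg; rewrite -conjgM.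
have fy := fpf3_mulr fx Wg; move: (x * g) fy => {fx} y fy.
have p1 := fpf3_prod fy Wa; have := fpf3_prod (fpf3V fy) Wa.
rewrite expgVn (fpf3_expV fy) invgK => p2.
have [_ /eqP y3 _] := and3P fy.
have e1 : a ^ y * a ^ y^-1 = a^-1.
  by rewrite -(fpf3_expV fy); apply: (mulgI a); rewrite mulgA p1 mulgV.
have e2 : a ^ y^-1 * a ^ y = a^-1 by apply: (mulgI a); rewrite mulgA p2 mulgV.
have : commute (a ^ y) (a ^ (y ^+ 2)).
  by rewrite (fpf3_expV fy); rewrite /commute e1 e2.
rewrite expgS conjgM /commute -!conjMg => /conjg_inj; exact.
Qed.

(** [a] is the inverse of [a ^ x * a ^ x^-1], and it commutes with every [W]-conjugate of either
    factor. This is the 2-Engel property. *)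
Lemma fpf3_Engel x a g : fpf3 W x -> a \in W -> g \in W -> commute a (a ^ g).
Proof.
move=> fx Wa Wg; have fxV := fpf3V fx.
have aE : a = (a ^ x * a ^ x^-1)^-1.
  apply: (canRL invgK); rewrite -(fpf3_expV fx); apply: (mulgI a).
  by rewrite mulgA fpf3_prod ?mulgV.
rewrite [X in commute _ (X ^ g)]aE conjVg (conjMg (a ^ x)).
by apply: commuteV; apply: commuteM; apply: fpf3_commJ.
Qed.

Lemma fpf3_commg_r x a b : fpf3 W x -> a \in W -> b \in W -> commute b [~ a, b].
Proof.
move=> fx Wa Wb; rewrite commgEr conjVg; apply: commuteM => //.
by apply: commuteV; apply: fpf3_Engel fx _ _.
Qed.

Lemma fpf3_commgV x a b :
  fpf3 W x -> a \in W -> b \in W -> [~ a, b^-1] = [~ a, b]^-1.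
Proof.
move=> fx Wa Wb; have /commgP/conjg_fixP : commute [~ a, b] b^-1.
  by apply: commuteV; apply: commute_sym; apply: fpf3_commg_r fx _ _.
move=> {1}<-.
by rewrite !commgEl !conjgE !invMg !invgK !mulgA mulgV mul1g.
Qed.

(** That [a * b] commutes with its [x]-conjugate, expanded with the same fact for [b] and with
    [fpf3_commJ] for [a], lets [x] pass from one argument of the commutator to the other. *)
Lemma fpf3_commg_mid x a b :
  fpf3 W x -> a \in W -> b \in W -> [~ a ^ x, b] = [~ a, b ^ x].
Proof.
move=> fx Wa Wb; have [nWx x3 _] := and3P fx.
have Wc : a ^ x \in W by rewrite memJ_norm.
have Wd : b ^ x \in W by rewrite memJ_norm.
suff key : [~ a ^ x, b^-1] = [~ (b ^ x)^-1, a^-1].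
  apply: invg_inj; rewrite -(fpf3_commgV fx Wc Wb) key.
  by rewrite (fpf3_commgV fx) ?groupV // invg_comm (fpf3_commgV fx).
have cab : commute (a * b) ((a * b) ^ x).
  by have := fpf3_commJ fx (groupM Wa Wb) (group1 W); rewrite conjg1.
have ac : commute a ((a ^ x) ^ b^-1) by apply: fpf3_commJ; rewrite ?groupV.
have bd : commute b (b ^ x).
  by have := fpf3_commJ fx Wb (group1 W); rewrite conjg1.
move: (a ^ x) (b ^ x) cab ac bd {Wc Wd} (conjMg a b x) => c d + + + E.
rewrite E => cab ac bd.
have ub : c ^ b^-1 * b = b * c by rewrite -conjgCV.
have e : c ^ b^-1 * a * d = c * d * a.
  apply: (mulIg b); rewrite -(mulgA (_ * a)) -bd mulgA -ac -(mulgA a) ub.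
  by rewrite -[RHS]mulgA -cab !mulgA.
rewrite commgEl commgEr invgK (conjgE a) invgK.
move: (c ^ b^-1) e => u /(congr1 (fun z => c^-1 * z * d^-1 * a^-1)) /=.
by rewrite !mulgA mulVg mul1g !mulgK.
Qed.

Lemma fpf3_commgJ x a b :
  fpf3 W x -> a \in W -> b \in W -> [~ a, b] ^ x = [~ a, b ^ x^-1].
Proof.
move=> fx Wa Wb; have [nWx x3 _] := and3P fx.
rewrite conjRg (fpf3_commg_mid fx) ?memJ_norm //.
by rewrite -conjgM -[x * x]/(x ^+ 2) (fpf3_expV fx).
Qed.

(* Compare fpf3_commgJ for x and for x * h ^ x. *)
Lemma fpf3_commgJ_in x a b h : fpf3 W x -> a \in W -> b \in W -> h \in W ->
  [~ a, b] ^ h = [~ a, b ^ (h^-1) ^ x].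
Proof.
move=> fx Wa Wb Wh; have [nWx x3 _] := and3P fx.
have Whx : h ^ x \in W by rewrite memJ_norm.
apply: (@conjg_inj _ x); rewrite (fpf3_commgJ fx) //; last first.
  by rewrite groupJ // memJ_norm ?groupV.
have := fpf3_commgJ (fpf3_mulr fx Whx) Wa Wb.
by rewrite invMg !conjgM -!conjVg -!conjgM -conjgC.
Qed.

(* With g = h^-1 * h ^ x, conjugation by g moves [~ a, b] by h^-1 and then by
   h ^ x; by fpf3_commgJ_in applied to x and to x^-1 the two effects cancel. *)
Lemma fpf3_der1_center x : fpf3 W x -> W^`(1) \subset 'Z(W).
Proof.
move=> fx; have [nWx x3 _] := and3P fx.
rewrite gen_subG; apply/subsetP=> _ /imset2P[a b Wa Wb ->].
apply/centerP; split=> [|g Wg]; first by rewrite groupR.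
apply/commgP/conjg_fixP.
have [h Wh defg] := fpf3_surj fx (groupVr Wg).
rewrite -[g]invgK defg invMg invgK; set k := h^-1; have Wk : k \in W by rewrite groupV.
have -> : (h ^ x)^-1 * h = k ^ x * k^-1 by rewrite conjVg invgK.
rewrite conjgM; apply: (canLR (conjgKV _)).
rewrite [k^-1^-1]invgK (fpf3_commgJ_in fx) ?memJ_norm //.
rewrite (fpf3_commgJ_in (fpf3V fx)) //.
by rewrite -conjVg -conjgM -[x * x]/(x ^+ 2) -(fpf3_expV fx).
Qed.

Lemma fpf3_class2 x : fpf3 W x -> nilpotent W /\ nil_class W <= 2.
Proof.
move=> fx; have le2 : nil_class W <= 2 by rewrite nil_class2 (fpf3_der1_center fx).
by split=> //; apply: small_nil_class; apply: leq_trans le2 _.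
Qed.

(** By [fpf3_commgJ] for [x^-1], [[~ a, b ^ x]] is a conjugate of [[~ a, b]] and vanishes with
    it. *)
Lemma fpf3_cent1_norm x a : fpf3 W x -> a \in W -> x \in 'N('C_W[a]).
Proof.
move=> fx Wa; have [nWx x3 _] := and3P fx.
rewrite inE; apply/subsetP=> _ /imsetP[b /setIP[Wb /cent1P/commute_sym cab] ->].
rewrite inE memJ_norm // Wb; apply/cent1P/commute_sym/commgP.
rewrite -[x]invgK -(fpf3_commgJ (fpf3V fx)) //.
by move/commgP/eqP: cab => ->; rewrite conj1g.
Qed.

End FixedPointFreeOrder3.

Lemma fpf3_card (gT : finGroupType) (W : {group gT}) x : fpf3 W x -> #|W| %% 3 = 1%N.
Proof.
case/and3P=> nWx /eqP x3 /eqP rW.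
have p3X : 3.-group <[x]>.
  by apply: (@pnat_dvd _ 3) => //; rewrite -orderE order_dvdn x3.
have nWX : <[x]> \subset 'N(W) by rewrite cycle_subG.
have := pgroup_fix_mod (to := 'J) p3X _.
move/(_ W); rewrite astabsJ => /(_ nWX) ->.
by rewrite afixJ cent_cycle rW cards1.
Qed.

Lemma fpf3S (gT : finGroupType) (W B : {group gT}) x :
  fpf3 W x -> B \subset W -> x \in 'N(B) -> fpf3 B x.
Proof.
case/and3P=> _ x3 /eqP rW sBW nBx; rewrite /fpf3 nBx x3 /=.
by rewrite -subG1 -rW setSI.
Qed.

(** * Elements of order three that generate their centralizer *)

Definition selfcent3 (gT : finGroupType) (G : {group gT}) (x : gT) :=
  [&& x \in G, #[x] == 3 & 'C_G[x] == <[x]>].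

Definition inv3' (gT : finGroupType) (G : {group gT}) (x : gT) (W : {group gT}) :=
  [&& W \subset G, x \in 'N(W) & 3^'.-group W].

Section SelfCentralizing3.

Variables (gT : finGroupType) (x : gT).
Implicit Types (G M K W B P : {group gT}) (a g t y : gT).

Lemma selfcent3S G M : selfcent3 G x -> x \in M -> M \subset G -> selfcent3 M x.
Proof.
case/and3P=> Gx ox /eqP Cx Mx sMG; apply/and3P; split=> //.
rewrite eqEsubset -{1}Cx setSI //= subsetI cycle_subG Mx.
by rewrite -{1}Cx subsetIr.
Qed.

(** The centre of a Sylow 3-subgroup [P] above [x] centralizes [x], so it is a nontrivial subgroup
    of [<[x]>], hence all of it; then [P] centralizes [x]. *)
Lemma selfcent3_Sylow G : selfcent3 G x -> 3.-Sylow(G) <[x]>.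
Proof.
case/and3P=> Gx /eqP ox /eqP Cx.
have p3X : 3.-group <[x]> by rewrite /pgroup -orderE ox.
have sXG : <[x]> \subset G by rewrite cycle_subG.
have [P sylP sXP] := Sylow_superset sXG p3X; have [sPG pP _] := and3P sylP.
have sZX : 'Z(P) \subset <[x]>.
  rewrite -Cx subsetI (subset_trans (center_sub P)) //=.
  by rewrite -cent_cycle (subset_trans (subsetIr P _)) ?centS.
have ntP : P :!=: 1.
  by apply: contraTneq sXP => ->; rewrite subG1 cycle_eq1 -order_gt1 ox.
have defZ : 'Z(P) = <[x]>.
  apply/eqP; rewrite eqEcard sZX -orderE ox.
  have ntZ : 'Z(P) != 1.
    by apply: contra ntP => /eqP Z1; rewrite (trivg_center_pgroup pP Z1).
  have [_ d3 _] := pgroup_pdiv (pgroupS (center_sub P) pP) ntZ.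
  exact: dvdn_leq.
suff -> : <[x]> = P by [].
apply/eqP; rewrite eqEsubset sXP -Cx subsetI sPG -cent_cycle -defZ.
by rewrite centsC subsetIr.
Qed.

Lemma selfcent3_conj G y : selfcent3 G x -> y \in G -> #[y] = 3 ->
  exists2 g, g \in G & <[y]> = <[x ^ g]>.
Proof.
move=> sc Gy oy; have syl := selfcent3_Sylow sc.
have p3y : 3.-group <[y]> by rewrite /pgroup -orderE oy.
have [|g Gg sy] := Sylow_subJ syl _ p3y; first by rewrite cycle_subG.
exists g => //; apply/eqP; rewrite cycleJ eqEcard sy cardJg -!orderE oy.
by case/and3P: sc => _ /eqP->.
Qed.

Lemma inv3_fpf G W : selfcent3 G x -> inv3' G x W -> fpf3 W x.
Proof.
case/and3P=> Gx /eqP ox /eqP Cx /and3P[sWG nWx W3].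
rewrite /fpf3 nWx -{1}ox expg_order eqxx /=.
have co : coprime #|W| #|<[x]>| by rewrite (p'nat_coprime W3) // -orderE ox.
by rewrite -subG1 -(coprime_TIg co) subsetI subsetIl /= -Cx setSI.
Qed.

Lemma inv3_card G W : selfcent3 G x -> inv3' G x W -> #|W| %% 3 = 1%N.
Proof. by move=> sc iW; apply: fpf3_card (inv3_fpf sc iW). Qed.

Lemma inv3_sub G M W : inv3' M x W -> M \subset G -> inv3' G x W.
Proof. by case/and3P=> sWM nW W3 sMG; rewrite /inv3' (subset_trans sWM) ?nW. Qed.

Lemma inv3S G W B :
  inv3' G x W -> B \subset W -> x \in 'N(B) -> inv3' G x B.
Proof.
by case/and3P=> sWG nW W3 sBW nB; rewrite /inv3' nB (subset_trans sBW) ?(pgroupS sBW).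
Qed.

Lemma inv3_char G W B : inv3' G x W -> B \char W -> inv3' G x B.
Proof.
move=> iW chB; apply: inv3S (iW) (char_sub chB) _.
have /and3P[_ nW _] := iW.
by have := char_norm_trans chB (A := <[x]>); rewrite !cycle_subG; apply.
Qed.

(** If 3 divided the order of [B], an element of order three in [B] would generate a conjugate of
    [<[x]>] inside [B <*> <[x]>], where [B] is normal; so [B] would contain [x]. *)
Lemma selfcent3_notin G B : selfcent3 G x -> B \subset G -> x \in 'N(B) ->
  x \notin B -> 3^'.-group B.
Proof.
move=> sc sBG nBx; apply: contraR => n3B.
have [Gx /eqP ox _] := and3P sc.
have d3 : 3 %| #|B|.
  apply: contraR n3B => nd; rewrite /pgroup p'natE //.
have [y By oy] := Cauchy (isT : prime 3) d3.
pose M := (B <*> <[x]>)%G.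
have nBM : M \subset 'N(B) by rewrite join_subG normG cycle_subG.
have sMG : M \subset G by rewrite join_subG sBG cycle_subG.
have Mx : x \in M by rewrite -cycle_subG joing_subr.
have [g Mg defy] := selfcent3_conj (selfcent3S sc Mx sMG)
  (subsetP (joing_subl B _) y By) oy.
have : x ^ g \in B :^ g; last by rewrite memJ_conjg.
rewrite (normsP nBM) //.
by rewrite -cycle_subG -defy cycle_subG.
Qed.

Lemma selfcent3_normal_sub G B : selfcent3 G x -> B <| G -> x \notin B ->
  B \subset 'O_3^'(G).
Proof.
move=> sc nsBG nBx; apply: pcore_max => //.
have [sBG nBG] := andP nsBG; apply: (selfcent3_notin sc) => //.
by apply: (subsetP nBG); case/and3P: sc.
Qed.

Lemma inv3_notin_cent G W : selfcent3 G x -> inv3' G x W -> W :!=: 1 -> x \notin 'C(W).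
Proof.
move=> sc iW; apply: contra => cWx; have /and3P[_ _ /eqP rW] := inv3_fpf sc iW.
by rewrite -subG1 -rW subsetI subxx sub_cent1.
Qed.

Lemma inv3_core G : selfcent3 G x -> inv3' G x 'O_3^'(G).
Proof.
case/and3P=> Gx _ _; rewrite /inv3' pcore_sub pcore_pgroup andbT /=.
exact: subsetP (gFnorm _ _) x Gx.
Qed.

(** The centralizer is normal and misses [x], which fixes no nontrivial element of [B]. This is the
    main device for forcing subgroups into the 3'-core. *)
Lemma cent_sub_core G B : selfcent3 G x -> B <| G -> B :!=: 1 -> 3^'.-group B ->
  'C_G(B) \subset 'O_3^'(G).
Proof.
move=> sc nsBG ntB B3; have [sBG nBG] := andP nsBG.
apply: (selfcent3_normal_sub sc) => /=.
  by rewrite /normal subsetIl normsI ?normG ?norms_cent.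
rewrite inE negb_and; apply/orP; right.
apply: (inv3_notin_cent sc _ ntB); rewrite /inv3' sBG B3 andbT.
by apply: (subsetP nBG); case/and3P: sc.
Qed.

Lemma inv3_join G K W : K <| G -> 3^'.-group K -> inv3' G x W -> x \in G ->
  inv3' G x (K <*> W).
Proof.
move=> /andP[sKG nKG] K3 /and3P[sWG nWx W3] Gx.
rewrite /inv3' join_subG sKG sWG /= norm_joinEr ?(subset_trans sWG) //.
rewrite pgroupM K3 W3 andbT.
rewrite andbT -cycle_subG normsM ?cycle_subG //.
exact: subsetP nKG x Gx.
Qed.

(** In a coprime action, fixed points of the quotient lift; the solvability this needs comes from
    the nilpotency of [K]. *)
Lemma selfcent3_quotient G K : selfcent3 G x -> K <| G -> 3^'.-group K ->
  selfcent3 (G / K) (coset K x).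
Proof.
move=> sc nsKG K3; have [sKG nKG] := andP nsKG.
have [Gx /eqP ox /eqP Cx] := and3P sc; have Nx := subsetP nKG x Gx.
have iK : inv3' G x K by rewrite /inv3' sKG Nx.
have [nilK _] := fpf3_class2 (inv3_fpf sc iK).
have co : coprime #|K| #|<[x]>|.
  by rewrite (p'nat_coprime K3) // -orderE ox.
have eC : 'C_(G / K)(<[x]> / K) = <[x]> / K.
  rewrite -coprime_norm_quotient_cent ?cycle_subG ?(nilpotent_sol nilK) //.
    by rewrite cent_cycle Cx.
  exact: subsetP (normG G) x Gx.
apply/and3P; split; first exact: mem_quotient.
  apply/eqP; rewrite orderE -quotient_cycle // -(card_isog (quotient_isog _ _)).
  - by rewrite -orderE.
  - by rewrite cycle_subG.
  by rewrite coprime_TIg.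
by rewrite -cent_cycle -quotient_cycle // eC.
Qed.

Lemma inv3_lift G K (V : {group coset_of K}) : K <| G -> x \in G -> 3^'.-group K ->
    inv3' (G / K) (coset K x) V ->
  exists W, [/\ inv3' G x W, K \subset W, V :=: W / K & #|W| = (#|K| * #|V|)%N].
Proof.
move=> nsKG Gx K3 /and3P[sVG nVx V3].
have [W defV sKW sWG] := inv_quotientS nsKG sVG.
have [sKG nKG] := andP nsKG; have nKW := subset_trans sWG nKG.
have oW : #|W| = (#|K| * #|V|)%N.
  by rewrite defV -(Lagrange sKW) card_quotient.
exists W; split=> //; rewrite /inv3' sWG /=; apply/andP; split; last first.
  by rewrite /pgroup oW pnatM; apply/andP.
have Nx := subsetP nKG x Gx.
rewrite defV in nVx; rewrite -cycle_subG.
have : <[x]> / K \subset 'N(W / K) by rewrite quotient_cycle ?cycle_subG.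
rewrite -quotient_normG ?quotientSGK ?cycle_subG //; last first.
  by rewrite /normal sKW.
by rewrite (subset_trans sKW) ?normG.
Qed.

Lemma selfcent3_norm G : selfcent3 G x ->
  'N_G(<[x]>) = <[x]> \/
  (exists t, [/\ t \in G, #[t] = 2, x ^ t = x^-1 & #|'N_G(<[x]>)| = 6]).
Proof.
move=> sc; have [Gx /eqP ox /eqP Cx] := and3P sc.
have x2 : x ^+ 2 = x^-1.
  by apply/eqP; rewrite eq_mulgV1 invgK -expgSr -ox expg_order.
have mX y : y \in <[x]> -> #[y] = 3 -> y = x \/ y = x^-1.
  case/cyclePmin=> i; rewrite ox; case: i => [|[|[|//]]] _ ->.
  - by rewrite expg0 order1.
  - by left.
  by right.
have NP g : g \in 'N_G(<[x]>) -> g \in <[x]> \/ x ^ g = x^-1.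
  case/setIP=> Gg Ng; have [] := mX (x ^ g); rewrite ?memJ_norm ?cycle_id ?orderJ //.
    move=> xg; left; rewrite -Cx inE Gg.
    by apply/cent1P/commute_sym/commgP/conjg_fixP.
  by right.
have [/eqP|] := boolP ('N_G(<[x]>) == <[x]>); first by left.
have sXN : <[x]> \subset 'N_G(<[x]>) by rewrite subsetI normG cycle_subG Gx.
rewrite eqEsubset sXN andbT => /subsetPn[s Ns nXs]; right.
have xs : x ^ s = x^-1 by case: (NP s Ns) => // Xs; rewrite Xs in nXs.
have oN : #|'N_G(<[x]>)| = 6.
  have -> : 'N_G(<[x]>) = <[x]> :|: <[x]> :* s.
    apply/setP=> g; rewrite in_setU mem_rcoset; apply/idP/orP=> [Ng|].
      case: (NP g Ng) => [|xg]; [by left | right].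
      have Ngs : g * s^-1 \in 'N_G(<[x]>) by rewrite groupM ?groupV.
      case: (NP _ Ngs) => //; rewrite conjgM xg => E.
      have E2 : x ^ s^-1 = x^-1 by apply: (canLR (conjgK _)); rewrite conjVg xs invgK.
      rewrite conjVg E2 invgK in E.
      have : x ^+ 2 = 1 by rewrite expgS expg1 {2}E mulgV.
      by move/eqP; rewrite -order_dvdn ox.
    case=> [/(subsetP sXN) // | /(subsetP sXN) Ngs].
    by rewrite -(groupMr g (groupVr Ns)).
  rewrite cardsU card_rcoset -orderE ox.
  rewrite [_ :&: _](_ : _ = set0) ?cards0 //; apply/setP=> g; rewrite !inE mem_rcoset.
  apply/negP=> /andP[Xg]; rewrite groupMl // groupV => Xs; by rewrite Xs in nXs.
have [|t Nt ot] := @Cauchy _ 2 'N_G(<[x]>)%G isT; first by rewrite oN.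
exists t; split=> //; first by case/setIP: Nt.
case: (NP t Nt) => // Xt; have := order_dvdG Xt.
by rewrite -orderE ot ox.
Qed.

(** Both [x] and [x ^ g^-1] lie in ['N_G(P)], where some [m] conjugates the subgroups they generate;
    the witness is [m * g]. *)
Lemma norm_conj_inv G P g : selfcent3 G x -> P \subset G -> g \in G ->
    x \in 'N(P) -> x \in 'N(P :^ g) ->
  exists2 h, h \in 'N_G(<[x]>) & P :^ g = P :^ h.
Proof.
move=> sc sPG Gg nPx nPgx; have [Gx /eqP ox _] := and3P sc.
have Mx : x \in 'N_G(P) by rewrite inE Gx.
have scM := selfcent3S sc Mx (subsetIl G _).
have Ny : x ^ g^-1 \in 'N_G(P).
  rewrite inE groupJ ?groupV //= .
  have : (x ^ g^-1) ^ g \in 'N(P) :^ g by rewrite conjgKV -normJ.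
  by rewrite memJ_conjg.
have [|m Nm] := selfcent3_conj scM Ny; first by rewrite orderJ.
rewrite !cycleJ => E; have [Gm nPm] := setIP Nm.
exists (m * g); last by rewrite conjsgM (normP nPm).
rewrite inE groupM //=; apply/normP; rewrite conjsgM -E -conjsgM.
by rewrite mulVg conjsg1.
Qed.

End SelfCentralizing3.

(** * The union of the invariant 3'-subgroups *)

Definition inv3set (gT : finGroupType) (G : {group gT}) (x : gT) :=
  [set a | [exists W : {group gT}, inv3' G x W && (a \in W)]].

Section InvariantSet.

Variables (gT : finGroupType) (G : {group gT}) (x : gT).
Hypothesis sc : selfcent3 G x.
Implicit Types (W : {group gT}) (a : gT).

Lemma inv3setP a :
  reflect (exists2 W : {group gT}, inv3' G x W & a \in W) (a \in inv3set G x).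
Proof.
rewrite inE; apply: (iffP existsP) => [[W /andP[]] | [W iW Wa]]; exists W => //.
by rewrite iW.
Qed.

(* x^-1 * a and x * a of order three make <<[set x; a]>> a quotient of the
   (3, 3, 3) triangle group, in which the conjugates of a generate an abelian
   normal subgroup. *)
Lemma triangle333 a : #[x^-1 * a] = 3 -> #[x * a] = 3 ->
  a ^ (x ^+ 2) = (a * a ^ x)^-1 /\ commute a (a ^ x).
Proof.
have x3 : x ^+ 3 = 1 by have /and3P[_ /eqP <- _] := sc; rewrite expg_order.
move=> o1 o2; set c := a ^ x; set d := a ^ (x ^+ 2).
have xx : x * x = x^-1.
  by apply: (mulgI x); rewrite mulgV -x3 !expgS expg0 mulg1.
have xV : x^-1 * x^-1 = x by rewrite -invMg xx invgK.
have e1 : c * d * a = 1.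
  have := expg_order (x^-1 * a); rewrite o1 !expgS expg0 mulg1 => <-.
  rewrite /c /d !conjgE expgS expg1 invMg !mulgA mulgK.
  by rewrite -(mulgA _ x x) xx.
have e2 : d * c * a = 1.
  have := expg_order (x * a); rewrite o2 !expgS expg0 mulg1 => <-.
  rewrite /c /d !conjgE expgS expg1 invMg !mulgA xV mulgK.
  by rewrite -!mulgA.
have dE : d = (a * c)^-1.
  by apply: (mulgI (a * c)); rewrite mulgV -(mulgA a) -[RHS](mulgV a); congr (_ * _);
     apply: (mulIg a); rewrite e1 mulVg.
split=> //; rewrite /commute -[a * c]invgK -dE; apply: (mulgI d).
by rewrite mulgV mulgA e2.
Qed.

(** In one direction, the cosets of [x] and [x^-1] modulo an invariant 3'-group consist of
    conjugates. In the other, [a] and [a ^ x] generate an invariant abelian group, which is a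
    3'-group unless it contains [x], and then [a = 1]. The criterion turns the union into a counting
    problem in the class of [x]. *)
Lemma inv3set_order a : a \in G ->
  (a \in inv3set G x) = (#[x^-1 * a] == 3) && (#[x * a] == 3).
Proof.
move=> Ga; have [Gx /eqP ox /eqP Cx] := and3P sc.
apply/inv3setP/andP=> [[W iW Wa] | [/eqP o1 /eqP o2]].
  have fx := inv3_fpf sc iW.
  have [b _ ->] := fpf3_coset fx Wa; have [c _ ->] := fpf3_coset (fpf3V fx) Wa.
  by rewrite !orderJ orderV ox.
have [dE cac] := triangle333 o1 o2.
pose A := (<[a]> <*> <[a ^ x]>)%G.
have Aa : a \in A by rewrite -cycle_subG joing_subl.
have Ac : a ^ x \in A by rewrite -cycle_subG joing_subr.
have nAx : x \in 'N(A).
  rewrite inE -[A :^ x]/((<[a]> <*> <[a ^ x]>) :^ x) conjYg -!cycleJ join_subG.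
  rewrite !cycle_subG Ac.
  by rewrite -conjgM -[x * x]/(x ^+ 2) dE groupV groupM.
have sAG : A \subset G by rewrite join_subG !cycle_subG Ga groupJ.
have abA : abelian A.
  rewrite abelianY !cycle_abelian cent_cycle cycle_subG.
  by apply/cent1P; apply: commute_sym.
have [Ax | nAx'] := boolP (x \in A); last first.
  by exists A => //; rewrite /inv3' sAG nAx (selfcent3_notin sc).
exists 1%G; first by rewrite /inv3' sub1G norm1 inE pgroup1.
have : a \in <[x]>.
  by rewrite -Cx inE Ga (subsetP _ _ Aa) // sub_cent1 (subsetP abA).
case/cyclePmin=> i; rewrite ox; case: i => [|[|[|//]]] _ aE; rewrite aE in o1 o2 *.
- by rewrite expg0.
- by move: o1; rewrite expg1 mulVg order1.
by move: o2; rewrite -expgS -{1}ox expg_order order1.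
Qed.

Variable t : gT.
Hypotheses (Gt : t \in G) (xt : x ^ t = x^-1).

Lemma order3_class y : y \in G -> (y \in x ^: G) = (#[y] == 3).
Proof.
move=> Gy; have [Gx /eqP ox _] := and3P sc.
apply/imsetP/eqP=> [[g _ ->]|oy]; first by rewrite orderJ.
have [g Gg E] := selfcent3_conj sc Gy oy.
have : y \in <[x ^ g]> by rewrite -E cycle_id.
case/cyclePmin=> i; rewrite orderJ ox; case: i => [|[|[|//]]] _ yE.
- by move: oy; rewrite yE expg0 order1.
- by exists g.
exists (t * g); first by rewrite groupM.
rewrite conjgM xt yE -conjXg; congr (_ ^ _).
by apply/eqP; rewrite eq_mulgV1 invgK -expgSr -ox expg_order.
Qed.

(** The bijection sends [a] to the pair of [x^-1 * a] and [(x * a)^-1], whose product is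
    [x ^- 2 = x]; the size is thus a structure constant of the class algebra. *)
Lemma card_inv3set : #|inv3set G x| = #|gring_classM_coef_set (x ^: G) (x ^: G) x|.
Proof.
have [Gx /eqP ox _] := and3P sc.
have sS a : a \in inv3set G x -> a \in G.
  by case/inv3setP=> W /and3P[/subsetP sWG _ _] /sWG.
have sC : x ^: G \subset G by rewrite class_subG.
have injf : {in gring_classM_coef_set (x ^: G) (x ^: G) x &,
   injective (fun yz : gT * gT => x * yz.1)}.
  move=> [y z] [y' z']; rewrite !inE /= => /andP[_ /eqP E] /andP[_ /eqP E'] /mulgI Ey.
  by rewrite -Ey in E' *; congr (_, _); apply: (mulgI y); rewrite E.
rewrite -(card_in_imset injf); apply: eq_card => a; apply/idP/imsetP.
  move=> Sa; have Ga := sS a Sa; have := Sa; rewrite inv3set_order // => /andP[o1 o2].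
  exists (x^-1 * a, (x * a)^-1); last by rewrite /= mulKVg.
  rewrite !inE /= !order3_class ?(groupM, groupV) // o1 orderV o2 /=.
  rewrite invMg mulgA mulgK -invMg; apply/eqP.
  by apply: (canLR invgK); rewrite -[RHS]mulg1 -(expg_order x) ox !expgS mulKg mulg1.
case=> [[y z]]; rewrite !inE /= => /andP[/andP[Cy Cz] /eqP E] ->.
have Gy := subsetP sC y Cy; have Gz := subsetP sC z Cz.
have -> : [exists W : {group gT}, inv3' G x W && (x * y \in W)] = (x * y \in inv3set G x).
  by rewrite inE.
rewrite inv3set_order ?groupM // mulKg -order3_class // Cy /=.
have -> : x * (x * y) = z^-1.
  apply: (mulIg z); rewrite mulVg -!mulgA E -[x * (x * x)]/(x ^+ 3).
  by rewrite -ox expg_order.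
by rewrite orderV -order3_class.
Qed.

End InvariantSet.

(** * Characters nonzero on an inverted element of order three *)

Section Characters.

Import GRing.Theory Num.Theory Order.TTheory.

Local Open Scope ring_scope.

Lemma sum_sqr_eq2 (I : finType) (P : pred I) (v : I -> int) :
    \sum_(i | P i) v i ^+ 2 = 2%:Z ->
  exists i, exists j, [/\ P i, P j, i != j, v i ^+ 2 = 1 & v j ^+ 2 = 1 /\
    forall k, P k -> k != i -> k != j -> v k = 0].
Proof.
move=> sum2.
have sq_le k : P k -> v k ^+ 2 <= 2%:Z.
  move=> Pk; rewrite -sum2 (bigD1 k) //= lerDl sumr_ge0 // => *; exact: sqr_ge0.
have v01 k : P k -> v k ^+ 2 = (v k != 0)%:Z.
  move/sq_le; rewrite !expr2; case: eqP => [->|nz] //= le2.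
  have : v k = 1 \/ v k = -1 \/ 2%:Z <= v k \/ v k <= - 2%:Z by lia.
  by case=> [->|[->|]] // [] ?; nia.
pose S := [set i | P i && (v i != 0)].
have cS : #|S| = 2%N.
  have : \sum_(i | P i) v i ^+ 2 = #|S|%:Z.
    rewrite (eq_bigr _ v01) -sum1_card (big_morph Posz PoszD (erefl _)).
    rewrite [in RHS](eq_bigl (fun i => P i && (v i != 0))); last by move=> i; rewrite inE.
    rewrite big_mkcondr; apply: eq_bigr => i _; by case: (v i != 0).
  by rewrite sum2 => - [].
have /cards2P[i [j [ne_ij defS]]] : #|S| == 2%N by rewrite cS.
have [] : i \in S /\ j \in S by rewrite defS !inE !eqxx orbT.
rewrite !inE => /andP[Pi vi] /andP[Pj vj].
exists i, j; rewrite !v01 // vi vj; split=> //; split=> // k Pk ki kj.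
apply/eqP; apply: contraT => vk; have : k \in S by rewrite inE Pk.
by rewrite defS !inE (negPf ki) (negPf kj).
Qed.

Section CharacterCount.

Variables (gT : finGroupType) (G : {group gT}) (x t : gT).
Hypotheses (sc : selfcent3 G x) (Gt : t \in G) (xt : (x ^ t = x^-1)%g).

Let Gx : x \in G. Proof. by case/and3P: sc. Qed.
Let ox : #[x]%g = 3%N. Proof. by case/and3P: sc => _ /eqP. Qed.

Lemma irr_order3_inv i : 'chi[G]_i x^-1%g = 'chi_i x.
Proof. by rewrite -xt cfunJ. Qed.

(** [m] is the multiplicity of the trivial character in the restriction to [<[x]>]. *)
Lemma irr_order3_mod i : exists m : nat, 'chi[G]_i 1%g + 'chi_i x *+ 2 = (3 * m)%:R.
Proof.
have sXG : <[x]> \subset G by rewrite cycle_subG.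
have /natrP[m mE] : '['Res[<[x]>] 'chi[G]_i, 1] \in Num.nat.
  by rewrite Cnat_cfdot_char ?cfRes_char ?irr_char ?cfun1_char.
have n1 : x != 1%g by rewrite -order_gt1 ox.
have n2 : (x == x^-1)%g = false.
  apply/eqP=> E; have : (x ^+ 2 = 1)%g by rewrite expgS expg1 {2}E mulgV.
  by move/eqP; rewrite -order_dvdn ox.
have defX : <[x]> = [set 1; x; x^-1]%g.
  apply/eqP; rewrite eq_sym eqEcard; apply/andP; split.
    by apply/subsetP=> y; rewrite !inE => /orP[/orP[]|] /eqP->;
       rewrite ?group1 ?groupV ?cycle_id.
  rewrite -orderE ox -setUA cardsU1 cards2 !inE eq_sym (negPf n1).
  by rewrite eq_sym eq_invg1 (negPf n1) n2.
exists m; rewrite natrM -mE cfdotE -orderE ox mulVKf ?pnatr_eq0 //.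
rewrite (eq_bigl (mem [set 1; x; x^-1]%g)) => [|y]; last by rewrite /= defX.
rewrite /= -setUA big_setU1 ?inE 1?eq_sym ?(negPf n1) 1?eq_sym ?eq_invg1 ?(negPf n1) //=.
rewrite big_setU1 ?inE ?n2 //= big_set1.
rewrite !cfResE ?group1 ?groupV ?cycle_id // !cfun1E !groupV !cycle_id group1.
by rewrite rmorph1 !mulr1 irr_order3_inv.
Qed.

Lemma irr_order3_int i : 'chi[G]_i x \in Num.int.
Proof.
have [m mE] := irr_order3_mod i.
apply: Cint_rat_Aint (Aint_irr i x).
have -> : 'chi_i x = ((3 * m)%:R - 'chi_i 1%g) / 2%:R.
  rewrite -mE addrAC subrr add0r -['chi_i x *+ 2]mulr_natr mulfK // pnatr_eq0 //.
rewrite irr1_degree; apply: rpred_div; last exact: rpred_nat.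
by apply: rpredB; apply: rpred_nat.
Qed.

(* Since |C_G(x)| = 3, the squares of the integers 'chi_k x sum to 3; the signs
   follow from orthogonality of the columns of x and 1, and f %% 3 from the
   restriction to <[x]>. *)
Lemma three_irr_order3 : exists f : nat, exists i j : Iirr G,
  [/\ 'chi_i 1%g = f%:R, 'chi_j 1%g = f.+1%:R, 'chi_i x = 1, 'chi_j x = -1 &
    [/\ (f %% 3 = 1)%N, i != 0, i != j, j != 0 &
     forall k, k != 0 -> k != i -> k != j -> 'chi_k x = 0]].
Proof.
have /fin_all_exists[v vE] i : exists n : int, 'chi[G]_i x = n%:~R.
  by have /intrP[n ->] := irr_order3_int i; exists n.
have /fin_all_exists[d dE] i : exists n : nat, 'chi[G]_i 1%g = n%:R.
  by exists (irr_degree (socle_of_Iirr i)); rewrite irr1_degree.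
have dgt i : (0 < d i)%N by rewrite -(ltr0n algC) -dE irr1_gt0.
have v0 : v 0 = 1 by apply: (intr_inj (R := algC)); rewrite -vE irr0 cfun1E Gx.
have d0 : d 0 = 1%N by apply/eqP; rewrite -(eqr_nat algC) -dE irr0 cfun1E group1.
have sumsq : \sum_i v i ^+ 2 = 3%:Z.
  apply: (intr_inj (R := algC)); rewrite rmorph_sum /=.
  have oC : #|'C_G[x]| = 3%N by have /and3P[_ _ /eqP->] := sc.
  have := second_orthogonality_relation x Gx; rewrite class_refl oC mulr1n => E.
  transitivity (3%:R : algC) => //; rewrite -E.
  apply: eq_bigr => i _; rewrite vE conj_intr ?intr_int // rmorphXn /= expr2 //.
have sumd : \sum_i v i * (d i)%:Z = 0.
  apply: (intr_inj (R := algC)); rewrite rmorph_sum /=.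
  have := second_orthogonality_relation x (group1 G).
  rewrite [_ \in _](_ : _ = false); last first.
    by apply/negP; rewrite class1G inE -order_eq1 ox.
  rewrite mulr0n => E; transitivity (0 : algC) => //; rewrite -[RHS]E.
  apply: eq_bigr => i _.
  by rewrite vE dE rmorph_nat intrM.
have modd i : exists m : nat, (d i)%:Z + v i * 2%:Z = 3%:Z * m%:Z.
  have [m mE] := irr_order3_mod i; exists m; apply: (intr_inj (R := algC)).
  by rewrite rmorphD !rmorphM /= -vE -[(d i)%:~R]/((d i)%:R) -dE -natrM -mE mulr_natr.
have sum2 : \sum_(i | i != 0) v i ^+ 2 = 2%:Z.
  by move: sumsq; rewrite (bigD1 0) //= v0 => /(canRL (addKr _)) ->.
have [i [j [i0 j0 ij vi [vj vk]]]] := sum_sqr_eq2 sum2.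
have eqd : 1 + v i * (d i)%:Z + v j * (d j)%:Z = 0.
  rewrite -[RHS]sumd (bigD1 0) //= v0 d0 mulr1 -addrA (bigD1 i) //= (bigD1 j) //=.
    by rewrite big1 ?addr0 // => k /andP[/andP[k0 ki] kj]; rewrite vk ?mul0r.
  by rewrite j0 eq_sym.
have {}vk k : k != 0 -> k != i -> k != j -> 'chi_k x = 0.
  by move=> k0 ki kj; rewrite vE vk.
have [mi miE] := modd i; have [mj mjE] := modd j.
have := dgt i; have := dgt j.
have vi1 : v i = 1 \/ v i = -1 by move: vi; rewrite expr2; nia.
have vj1 : v j = 1 \/ v j = -1 by move: vj; rewrite expr2; nia.
case: vi1 vj1 => vi1 [] vj1 di dj; rewrite vi1 vj1 in eqd miE mjE; first lia.
- exists (d i), i, j; rewrite !vE vi1 vj1 !dE; split=> //.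
    by congr _%:R; lia.
  by split=> //; lia.
- exists (d j), j, i; rewrite !vE vi1 vj1 !dE; split=> //.
    by congr _%:R; lia.
  by split=> //; [lia | rewrite eq_sym | move=> k k0 kj ki; exact: vk].
lia.
Qed.

(** If [f = 1], the kernel of the nonprincipal linear character [i] is a proper normal subgroup
    containing [x]. Otherwise [f >= 4], so [n = f * f.+1] is at least 20, and |S| is |G| / 9 times
    [1 + 1 / n]; at [n = 20] the factor 21 / 180 is 7 / 60. *)
Lemma inv3set_window :
  (exists K : {group gT}, [/\ K <| G, x \in K & K :!=: G]) \/
  (#|G| < 9 * #|inv3set G x| /\ 60 * #|inv3set G x| <= 7 * #|G|)%N.
Proof.
have [f [i [j [fi fj vi vj [f3 i0 ij j0 vk]]]]] := three_irr_order3.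
have [f1 | f_neq1] := eqVneq f 1%N.
  left; exists (cfker_group 'chi_i); split; first exact: cfker_normal.
    by rewrite /= cfkerEirr inE vi fi f1 eqxx.
  apply: contraNneq i0 => kG; rewrite -subGcfker kG //.
right.
have cl : #|x ^: G| = (#|G| %/ 3)%N.
  rewrite -index_cent1; have /and3P[_ _ /eqP->] := sc.
  by rewrite -divgS ?cycle_subG // -orderE ox.
have d3 : (3 %| #|G|)%N by rewrite -ox order_dvdG.
have oG : #|G| = (3 * #|x ^: G|)%N by rewrite cl mulnC divnK.
have Cc : x ^: G \in classes G by apply: imset_f.
have := gring_classM_coef_sum_eq (G := G)
  (j1 := enum_rank_in Cc (x ^: G)) (j2 := enum_rank_in Cc (x ^: G))
  (k := enum_rank_in Cc (x ^: G)) (g1 := x) (g2 := x) (g := x).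
rewrite !enum_rankK_in // class_refl => /(_ isT isT isT).
rewrite (set_gring_classM_coef _ _ (g := x)); last by rewrite enum_rankK_in ?class_refl.
rewrite enum_rankK_in // -(card_inv3set sc Gt xt).
set s := #|inv3set G x|; set c := #|x ^: G| in oG *.
rewrite (bigD1 0) //= (bigD1 i) //= (bigD1 j) /=; last by rewrite j0 eq_sym.
rewrite big1 ?addr0; last by move=> k /andP[/andP[k0 ki] kj]; rewrite vk ?mul0r.
have c1 : (1 : algC)^* = 1 by rewrite rmorph1.
have cN1 : (-1 : algC)^* = -1 by rewrite rmorphN1.
rewrite irr0 !cfun1E Gx group1 vi vj fi fj cN1 c1 oG (_ : true%:R = 1 :> algC) //.
have fgt : (3 < f)%N by lia.
move=> E.
have {}E : (3 * s * (f * f.+1))%N%:R = (c * (f * f.+1 + 1))%N%:R :> algC.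
  have f0 : f%:R != 0 :> algC by rewrite pnatr_eq0; lia.
  have f10 : f.+1%:R != 0 :> algC by rewrite pnatr_eq0.
  have c0 : c%:R != 0 :> algC by rewrite pnatr_eq0 -lt0n /c (cardD1 x) class_refl.
  rewrite !natrM E !natrM natrD natrM -natr1 in f10 *.
  field; do ?[apply/andP; split] => //.
move/eqP: E; rewrite eqr_nat => /eqP E.
have : (20 <= f * f.+1)%N by nia.
have cgt : (0 < c)%N by rewrite /c (cardD1 x) class_refl.
move: (f * f.+1)%N E => n E n20.
have lt_c : (c < 3 * s)%N.
  by rewrite ltnNge; apply/negP=> le; move: E; move: (3 * s)%N le => m le; nia.
have [k kE] : exists k, (3 * s = c + k)%N by exists (3 * s - c)%N; lia.
have kn : (k * n = c)%N by move: E; rewrite kE; nia.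
by have : (20 * k <= c)%N; [rewrite -kn; nia | lia].
Qed.

End CharacterCount.

End Characters.

(** * Maximal invariant subgroups *)

Definition max_inv3' (gT : finGroupType) (G : {group gT}) (x : gT) (p : nat)
    (P : {group gT}) :=
  [max P | inv3' G x P && p.-group P].

Section CoreFree.

Variables (gT : finGroupType) (x : gT).
Implicit Types (G M K L W B P : {group gT}) (a g t y : gT).

(** A self-normalizing proper [<[x]>] is a Frobenius complement, and Frobenius' theorem supplies a
    normal 3'-subgroup of index 3. *)
Lemma selfnorm3_card_le G : selfcent3 G x -> 'N_G(<[x]>) = <[x]> ->
  #|G| <= #|'O_3^'(G)| * 3.
Proof.
move=> sc NX; have [Gx /eqP ox _] := and3P sc.
have [GX|neGX] := eqVneq (G : {set gT}) <[x]>.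
  by rewrite {1}GX -orderE ox leq_pmull ?cardG_gt0.
have frobG : [Frobenius G with complement <[x]>].
  rewrite /Frobenius_group_with_complement eq_sym neGX.
  apply/normedTI_memJ_P; split.
  - by rewrite setD_eq0 subG1 cycle_eq1 -order_gt1 ox.
  - by rewrite cycle_subG.
  move=> a g /setD1P[nta Xa] Gg; apply/idP/idP=> [/setD1P[_ Xag]|Xg]; last first.
    by rewrite !inE conjg_eq1 nta groupJ.
  have pr : prime #|<[x]>| by rewrite -orderE ox.
  have gen b : b != 1 -> b \in <[x]> -> <[b]> = <[x]>.
    move=> ntb Xb; apply/eqP; rewrite eqEcard cycle_subG Xb /=.
    by rewrite -[#|<[b]>|]/#[b] (prime_nt_dvdP pr _ (order_dvdG Xb)) ?order_eq1.
  rewrite /= -NX inE Gg; apply/normP.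
  by rewrite -{1}(gen a nta Xa) -cycleJ gen ?conjg_eq1.
have [K frobK] := Frobenius_kernel_exists frobG.
have [defG ntK _ _ _] := Frobenius_context frobK.
have [nsKG _ _ _ _] := sdprod_context defG.
have K3 : 3^'.-group K.
  have := Frobenius_coprime frobK; rewrite -orderE ox coprime_sym prime_coprime //.
  by rewrite /pgroup p'natE.
have sKO : K \subset 'O_3^'(G) by apply: pcore_max.
by rewrite -(sdprod_card defG) -orderE ox leq_mul2r subset_leq_card.
Qed.

Lemma selfnorm3_core1 G : selfcent3 G x -> 'O_3^'(G) = 1 ->
  'N_G(<[x]>) = <[x]> -> #|G| = 3.
Proof.
move=> sc O1 NX; have [Gx /eqP ox _] := and3P sc.
have := selfnorm3_card_le sc NX; rewrite O1 cards1 => le3.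
by apply/eqP; rewrite eqn_leq le3 dvdn_leq ?cardG_gt0 // -ox order_dvdG.
Qed.

(** A normal [L] containing [x] has trivial 3'-core as well. Either [<[x]>] is self-normalizing in
    [L], so that [L] has order 3 and [G] order 6, or [L] contains ['N_G(<[x]>)] and equals [G] by
    the Frattini argument. This disposes of the first alternative of [inv3set_window]. *)
Lemma core1_cases G : selfcent3 G x -> 'O_3^'(G) = 1 ->
  #|G| \in [:: 3; 6] \/
  [/\ #|G| < 9 * #|inv3set G x|, 60 * #|inv3set G x| <= 7 * #|G|,
      (exists t, [/\ t \in G, #[t] = 2, x ^ t = x^-1 & #|'N_G(<[x]>)| = 6]) &
      forall L, L <| G -> x \in L -> L :=: G].
Proof.
move=> sc O1; have [NX|[t [Gt ot xt oN]]] := selfcent3_norm sc.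
  by left; rewrite (selfnorm3_core1 sc O1 NX) inE.
have [ -> | n6] := eqVneq #|G| 6; first by left; rewrite !inE.
have nL L : L <| G -> x \in L -> L :=: G.
  move=> nsLG Lx; have [sLG nLG] := andP nsLG; have scL := selfcent3S sc Lx sLG.
  have OL1 : 'O_3^'(L) = 1.
    apply/trivgP; rewrite -O1; apply: pcore_max; first exact: pcore_pgroup.
    exact: gFnormal_trans.
  have FA := Frattini_arg nsLG (selfcent3_Sylow scL).
  have [NXL|[s [Ls _ _ oNL]]] := selfcent3_norm scL.
    have oL := selfnorm3_core1 scL OL1 NXL.
    have LX : L :=: <[x]>.
      apply/eqP; rewrite eq_sym eqEcard cycle_subG Lx oL -orderE.
      by have /and3P[_ /eqP-> _] := sc.
    case/eqP: n6; rewrite -oN; congr #|pred_of_set _|; apply/eqP.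
    by rewrite eqEsubset subsetIl andbT subsetI subxx -LX.
  have eN : 'N_L(<[x]>) = 'N_G(<[x]>).
    by apply/eqP; rewrite eqEcard setSI // oNL oN.
  by rewrite -FA /= -eN mulGSid ?subsetIl.
have [[K [nsK Kx neK]]|[w1 w2]] := inv3set_window sc Gt xt.
  by case/eqP: neK; apply: nL.
by right; split=> //; exists t.
Qed.

(** The union being trivial, the window would require an integer that is at least 60 / 7 and less
    than 9. *)
Lemma core1_no_inv3 G : selfcent3 G x -> 'O_3^'(G) = 1 ->
  (forall W, inv3' G x W -> W :=: 1) -> #|G| \in [:: 3; 6].
Proof.
move=> sc O1 allW; have [//|[w1 w2 _ _]] := core1_cases sc O1.
have S1 : inv3set G x = 1%g.
  apply/setP=> a; apply/inv3setP/idP=> [[W /allW -> //] | /set1gP ->].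
  exists 1%G => //; rewrite /inv3' sub1G norm1 inE pgroup1 //.
by move: w1 w2; rewrite S1 cards1; lia.
Qed.


End CoreFree.

(** * Normalizers of maximal invariant p-subgroups *)

Section LocalStructure.

Variables (gT : finGroupType) (x : gT).
Implicit Types (G M K L W B P Q D : {group gT}) (a g t y : gT).

Lemma no_inv3_index M : selfcent3 M x ->
  (forall W, inv3' M x W -> W \subset 'O_3^'(M)) ->
  #|M : 'O_3^'(M)| \in [:: 3; 6].
Proof.
move=> sc allW; set K := 'O_3^'(M)%G; have nsKM : K <| M by apply: pcore_normal.
have Mx : x \in M by case/and3P: sc.
have K3 : 3^'.-group K by apply: pcore_pgroup.
have scq := selfcent3_quotient sc nsKM K3.
rewrite -card_quotient ?gFnorm //.
apply: (core1_no_inv3 scq); first exact: trivg_pcore_quotient.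
move=> V iV; have [W [iW sKW defV _]] := inv3_lift nsKM Mx K3 iV.
by rewrite defV quotientS1 // allW.
Qed.

(** The index of the core in an invariant 3'-subgroup above it is 1 modulo 3 and divides 3 or 6, so
    it is 1. *)
Lemma index_no_inv3 M W : selfcent3 M x -> #|M : 'O_3^'(M)| \in [:: 3; 6] ->
  inv3' M x W -> W \subset 'O_3^'(M).
Proof.
move=> sc iM iW; set K := 'O_3^'(M)%G; have nsKM : K <| M by apply: pcore_normal.
have Mx : x \in M by case/and3P: sc.
have iV := inv3_join nsKM (pcore_pgroup _ _) iW Mx.
set V := (_ <*> _)%G in iV; have [sVM _ V3] := and3P iV.
have sKV : K \subset V by apply: joing_subl.
have dvi : #|V : K| %| #|M : K| by apply: indexSg.
have V1 : #|V : K| %% 3 = 1%N.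
  have := inv3_card sc iV; rewrite -(Lagrange sKV) -modnMm.
  by rewrite (inv3_card sc (inv3_core sc)) mul1n modn_mod.
suff /eqP : #|V : K| = 1%N.
  by rewrite indexg_eq1; apply: subset_trans; apply: joing_subr.
move: dvi V1 iM; rewrite !inE -/K; move: #|V : K| #|M : K| => v m dv v1.
by case/orP=> /eqP mE; move: dv v1; rewrite mE; case: v => [|[|[|[|[|[|[|v]]]]]]] //;
   move/dvdn_leq => /(_ isT).
Qed.

(** The join of [W] with the core [K] is an invariant 3'-group, hence nilpotent; its p'-part
    centralizes the nontrivial normal subgroup ['O_p(K)], and [cent_sub_core] applies. *)
Lemma inv3_p'core_sub M W p : selfcent3 M x -> inv3' M x W ->
  'O_p('O_3^'(M)) != 1 -> 'O_p^'(W) \subset 'O_3^'(M).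
Proof.
move=> sc iW; set K := 'O_3^'(M)%G => ntB.
have nsKM : K <| M by apply: pcore_normal.
have Mx : x \in M by case/and3P: sc.
have iV := inv3_join nsKM (pcore_pgroup _ _) iW Mx.
set V := (_ <*> _)%G in iV; have [sVM _ V3] := and3P iV.
have [nilV _] := fpf3_class2 (inv3_fpf sc iV).
have sWV : W \subset V by apply: joing_subr.
have sKV : K \subset V by apply: joing_subl.
have nsB : 'O_p(K) <| M by apply: gFnormal_trans.
have B3 : 3^'.-group 'O_p(K).
  by apply: pgroupS (pcore_sub _ _) (pcore_pgroup _ _).
apply: subset_trans (cent_sub_core sc nsB ntB B3).
have sWV' : 'O_p^'(W) \subset 'O_p^'(V).
  rewrite (sub_Hall_pcore (nilpotent_pcore_Hall _ nilV)) ?pcore_pgroup //.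
  exact: subset_trans (pcore_sub _ _) sWV.
rewrite subsetI (subset_trans (subset_trans sWV' (pcore_sub _ _)) sVM) /=.
have sBV : 'O_p(K) \subset 'O_p(V).
  rewrite (sub_Hall_pcore (nilpotent_pcore_Hall _ nilV)) ?pcore_pgroup //.
  exact: subset_trans (pcore_sub _ _) sKV.
rewrite (subset_trans sWV') // (centsS sBV) //.
by have /dprodP[_ _ + _] := nilpotent_pcoreC p nilV; rewrite centsC.
Qed.

Lemma max_inv3P G p P : max_inv3' G x p P ->
  [/\ inv3' G x P, p.-group P &
     forall Q, inv3' G x Q -> p.-group Q -> P \subset Q -> Q :=: P].
Proof.
case/maxgroupP=> /andP[iP pP] maxP; split=> // Q iQ pQ sPQ.
by apply: maxP; rewrite ?iQ.
Qed.

Lemma max_inv3_exists G (p : nat) Q : inv3' G x Q -> p.-group Q ->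
  exists2 P : {group gT}, max_inv3' G x p P & Q \subset P.
Proof.
move=> iQ pQ; have [|P maxP sQP] := @maxgroup_exists _
  (fun P : {group gT} => inv3' G x P && p.-group P) Q; first by rewrite iQ.
by exists P.
Qed.

Section MaxInvariant.

Variables (G P : {group gT}) (p : nat).
Hypotheses (sc : selfcent3 G x) (maxP : max_inv3' G x p P) (ntP : P :!=: 1).

Lemma max_inv3_norm : selfcent3 'N_G(P) x.
Proof.
have [/and3P[sPG nPx _] _ _] := max_inv3P maxP; have [Gx _ _] := and3P sc.
by apply: (selfcent3S sc); rewrite ?subsetIl // inE Gx.
Qed.

Let scM := max_inv3_norm.
Let iP : inv3' G x P. Proof. by case: (max_inv3P maxP). Qed.
Let sPG : P \subset G. Proof. by case/and3P: iP. Qed.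

Lemma max_inv3_core_p : 'O_p('O_3^'('N_G(P))) = P.
Proof.
have [_ pP max] := max_inv3P maxP; have /and3P[_ nPx P3] := iP.
have iU := inv3_sub (inv3_core scM) (subsetIl _ _).
have sPU : P \subset 'O_3^'('N_G(P)) by apply: pcore_max; rewrite ?normalSG.
have [nilU _] := fpf3_class2 (inv3_fpf sc iU).
apply: max; rewrite ?pcore_pgroup //; first exact: inv3_char iU (pcore_char _ _).
by rewrite (sub_Hall_pcore (nilpotent_pcore_Hall _ nilU)).
Qed.

(** The join of [W] with the core of ['N_G(P)] is nilpotent: its p-part is [P] by maximality, and
    its p'-part is in the core by [inv3_p'core_sub]. *)
Lemma max_inv3_sub W : inv3' G x W -> W \subset 'N(P) ->
  W \subset 'O_3^'('N_G(P)).
Proof.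
move=> iW nPW; pose U := 'O_3^'('N_G(P))%G.
have [_ pP max] := max_inv3P maxP; have /and3P[_ nPx P3] := iP.
have iWM : inv3' 'N_G(P) x W.
  by have /and3P[sWG nWx W3] := iW; rewrite /inv3' subsetI sWG nPW nWx.
have Mx : x \in 'N_G(P) by case/and3P: scM.
have iV := inv3_join (pcore_normal _ _) (pcore_pgroup 3^' _) iWM Mx.
set V := (_ <*> _)%G in iV; have [sVM _ V3] := and3P iV.
have iVG := inv3_sub iV (subsetIl _ _).
have [nilV _] := fpf3_class2 (inv3_fpf sc iVG).
have sPV : P \subset V.
  by rewrite -max_inv3_core_p (subset_trans (pcore_sub _ _)) ?joing_subl.
have OV : 'O_p(V) = P.
  apply: max; rewrite ?pcore_pgroup //; first exact: inv3_char iVG (pcore_char _ _).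
  by rewrite (sub_Hall_pcore (nilpotent_pcore_Hall _ nilV)).
have sUV : U \subset V by apply: joing_subl.
have sO : 'O_p^'(V) \subset U.
  by apply: inv3_p'core_sub; rewrite ?max_inv3_core_p.
apply: (subset_trans (joing_subr U W)); rewrite -[_ <*> _]/(gval V).
rewrite -(dprodW (nilpotent_pcoreC p nilV)) mul_subG // OV.
by rewrite -{1}max_inv3_core_p pcore_sub.
Qed.

Lemma max_inv3_index : #|'N_G(P) : 'O_3^'('N_G(P))| \in [:: 3; 6].
Proof.
apply: no_inv3_index scM _ => W iW; apply: max_inv3_sub.
  exact: inv3_sub iW (subsetIl _ _).
by case/and3P: iW; rewrite subsetI => /andP[].
Qed.

(** ['O_p(W)] is [P] by maximality, so [W] normalizes [P]. Thus the 3'-core of ['N_G(P)] is the only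
    maximal invariant 3'-subgroup above [P]. *)
Lemma max_inv3_maximal W : inv3' G x W -> P \subset W -> W \subset 'O_3^'('N_G(P)).
Proof.
move=> iW sPW; apply: max_inv3_sub => //.
have [_ pP max] := max_inv3P maxP.
have [nilW _] := fpf3_class2 (inv3_fpf sc iW).
suff <- : 'O_p(W) = P by apply: gFnorm.
apply: max; rewrite ?pcore_pgroup //; first exact: inv3_char iW (pcore_char _ _).
by rewrite (sub_Hall_pcore (nilpotent_pcore_Hall _ nilW)).
Qed.

End MaxInvariant.

(** By [norm_conj_inv] the conjugating element may be taken in ['N_G(<[x]>)]. It then either
    centralizes [x], so lies in [<[x]>] and normalizes [P], or inverts [x] and differs from [t] by
    an element of [<[x]>]. *)
Lemma inv_conj2 G P g t : selfcent3 G x -> P \subset G -> g \in G -> t \in G ->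
    x ^ t = x^-1 -> x \in 'N(P) -> x \in 'N(P :^ g) ->
  P :^ g = P \/ P :^ g = P :^ t.
Proof.
move=> sc sPG Gg Gt xt nPx nPgx; have [Gx /eqP ox /eqP Cx] := and3P sc.
have [h Nh ->] := norm_conj_inv sc sPG Gg nPx nPgx.
have [Gh Nxh] := setIP Nh.
have nX y : y \in G -> x ^ y = x -> y \in 'N(P).
  move=> Gy xy; suff: y \in <[x]> by apply: subsetP; rewrite cycle_subG.
  by rewrite -Cx inE Gy; apply/cent1P/commute_sym/commgP/conjg_fixP.
have : x ^ h \in <[x]> by rewrite memJ_norm ?cycle_id.
case/cyclePmin=> i; rewrite ox; case: i => [|[|[|//]]] _ xh.
- by have := congr1 (fun y => #[y]) xh; rewrite orderJ ox expg0 order1.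
- by left; apply/normP; apply: nX.
right; have x2 : x ^+ 2 = x^-1.
  by apply/eqP; rewrite eq_mulgV1 invgK -expgSr -ox expg_order.
have /normP : h * t^-1 \in 'N(P).
  apply: nX; first by rewrite groupM ?groupV.
  by rewrite conjgM xh x2; apply: (canLR (conjgK _)).
by rewrite conjsgM => /(canRL (conjsgKV _)).
Qed.

(** Were [<[x]>] self-normalizing, the Frattini argument in [K <*> <[x]>], of index two, would make
    that subgroup all of [M]. *)
Lemma index6_norm M : selfcent3 M x -> #|M : 'O_3^'(M)| = 6 ->
  exists t, [/\ t \in M, #[t] = 2 & x ^ t = x^-1].
Proof.
move=> sc oM; have [Mx /eqP ox _] := and3P sc.
have [NX|[t [Mt ot xt _]]] := selfcent3_norm sc; last by exists t.
set K := 'O_3^'(M)%G; pose L := (K <*> <[x]>)%G.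
have nKM : M \subset 'N(K) by apply: gFnorm.
have sLM : L \subset M by rewrite join_subG pcore_sub cycle_subG.
have defL : K * <[x]> = L by rewrite /= norm_joinEr ?cycle_subG ?(subsetP nKM).
have oL : #|L| = (3 * #|K|)%N.
  rewrite -defL TI_cardMg; first by rewrite /= -orderE ox mulnC.
  apply: coprime_TIg.
  by rewrite (p'nat_coprime (pcore_pgroup _ _)) // -orderE ox.
have oM6 : #|M| = (6 * #|K|)%N by rewrite -(Lagrange (pcore_sub 3^' M)) oM mulnC.
have nsL : L <| M.
  apply: index2_normal => //; have := Lagrange sLM.
  by rewrite oM6 oL; have := cardG_gt0 K; nia.
have sylX : 3.-Sylow(L) <[x]>.
  by apply: (pHall_subl _ sLM (selfcent3_Sylow sc)); apply: joing_subr.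
have := Frattini_arg nsL sylX; rewrite /= NX mulGSid ?joing_subr // => LM.
by have := cardG_gt0 K; move: oM6; rewrite -LM oL; nia.
Qed.

End LocalStructure.

(** * Odd primes *)

(** When the union is a single subgroup of order [n], the integer [k * m] would have to be at least
    60 / 7 and less than 9. *)
Lemma single_subgroup_window (n k m : nat) : 0 < n -> k \in [:: 3; 6] ->
  (n * k * m < 9 * n)%N -> (60 * n <= 7 * (n * k * m))%N -> False.
Proof.
move=> n0; rewrite !inE => /orP[]/eqP-> w1 w2.
  have m3 : m < 3 by nia.
  by nia.
have m2 : m < 2 by nia.
by nia.
Qed.

(** For two conjugates of order [d * e] meeting in order [d], the first bound gives [m <= 5] and
    then the second [e <= 4]. An odd prime has [e >= 7]; for the prime 2, [e = 4] is what leads to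
    order 60. *)
Lemma two_subgroup_window (d e m : nat) : 0 < d -> 7 <= e ->
  (d * e * 3 * m < 9 * (2 * (d * e) - d))%N ->
  (60 * (2 * (d * e) - d) <= 7 * (d * e * 3 * m))%N -> False.
Proof.
move=> d0 e7.
have -> : (2 * (d * e) - d = d * (2 * e - 1))%N by rewrite mulnBr muln1 mulnCA.
move=> w1 w2.
have {}w1 : (e * 3 * m < 9 * (2 * e - 1))%N.
  by rewrite -(ltn_pmul2l d0); move: w1; move: (2 * e - 1)%N => u; nia.
have {}w2 : (60 * (2 * e - 1) <= 7 * (e * 3 * m))%N.
  by rewrite -(leq_pmul2l d0); move: w2; move: (2 * e - 1)%N => u; nia.
have m5 : m < 6 by nia.
by nia.
Qed.

Section OddPart.

Variables (gT : finGroupType) (x : gT).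
Implicit Types (G M K L W B P Q D U : {group gT}) (a g t y : gT).

Lemma inverter_norm G P s t : selfcent3 G x -> x \in 'N(P) -> s \in G -> t \in G ->
  x ^ s = x^-1 -> x ^ t = x^-1 -> s \in 'N(P) -> t \in 'N(P).
Proof.
move=> sc nPx Gs Gt xs xt nPs; have [Gx _ /eqP Cx] := and3P sc.
have : t * s^-1 \in <[x]>.
  rewrite -Cx inE groupM ?groupV //; apply/cent1P/commute_sym/commgP/conjg_fixP.
  by rewrite conjgM xt; apply: (canLR (conjgK _)).
by rewrite -cycle_subG in nPx; move/(subsetP nPx); rewrite groupMr ?groupV.
Qed.

Lemma max_inv3_index6 G P p t : selfcent3 G x -> max_inv3' G x p P ->
    t \in G -> x ^ t = x^-1 -> #|'N_G(P) : 'O_3^'('N_G(P))| = 6 -> t \in 'N(P).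
Proof.
move=> sc maxP Gt xt oM; have [/and3P[_ nPx _] _ _] := max_inv3P maxP.
have [s [/setIP[Gs Ns] _ xs]] := index6_norm (max_inv3_norm sc maxP) oM.
exact: inverter_norm sc nPx Gs Gt xs xt Ns.
Qed.

Lemma max_inv3_prime G P p : max_inv3' G x p P -> P :!=: 1 -> prime p /\ p != 3.
Proof.
move=> maxP ntP; have [/and3P[_ _ P3] pP _] := max_inv3P maxP.
have [pr dv _] := pgroup_pdiv pP ntP; split=> //.
apply: contraL dv => /eqP->; rewrite -p'natE //.
Qed.

(** A p-subgroup that is Sylow in its normalizer is Sylow. Here the core of the normalizer has
    p-part [P], and the index 3 or 6 above the core is prime to [p]; for [p = 2] the index 6 spoils
    this. *)
Lemma max_inv3_Sylow G P p : selfcent3 G x -> max_inv3' G x p P -> P :!=: 1 ->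
  odd p -> p.-Sylow(G) P.
Proof.
move=> sc maxP ntP oddp; have [pr n3] := max_inv3_prime maxP ntP.
have [/and3P[sPG _ _] pP _] := max_inv3P maxP.
rewrite -Sylow_subnorm; set M := 'N_G(P)%G; pose U := 'O_3^'(M)%G.
have OU : 'O_p(U) = P := max_inv3_core_p sc maxP.
have sPM : P \subset M by rewrite subsetI sPG normG.
have iU := inv3_core (max_inv3_norm sc maxP).
have [nilU _] := fpf3_class2 (inv3_fpf (max_inv3_norm sc maxP) iU).
have sPU : P \subset U by rewrite -OU pcore_sub.
have sUM : U \subset M by apply: pcore_sub.
rewrite pHallE sPM /= -/M -(Lagrange sUM) partnM //.
have -> : (#|M : U|`_p)%N = 1%N.
  apply: part_p'nat; have := max_inv3_index sc maxP ntP; rewrite -/M -/U !inE.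
  have np3 : 3 \in p^' by rewrite !inE eq_sym.
  have np2 : 2 \in p^' by rewrite !inE eq_sym; apply: contraTneq oddp => ->.
  case/orP=> /eqP->; first by rewrite pnatE.
  by rewrite (_ : 6 = 2 * 3)%N // pnatM !pnatE // np2.
by rewrite muln1 -(card_Hall (nilpotent_pcore_Hall p nilU)) /= OU.
Qed.

Lemma inv3_Sylow_pair G P Q p t : selfcent3 G x -> t \in G -> x ^ t = x^-1 ->
    p.-Sylow(G) P -> p.-Sylow(G) Q -> x \in 'N(P) -> x \in 'N(Q) ->
  Q :=: P \/ Q :=: P :^ t.
Proof.
move=> sc Gt xt sylP sylQ nPx nQx; have [g Gg defQ] := Sylow_trans sylP sylQ.
rewrite defQ in nQx *; apply: (inv_conj2 sc) => //.
exact: pHall_sub sylP.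
Qed.

(** The index is odd, 1 modulo 3, and not 1. *)
Lemma inv3_index_ge7 G P D (p : nat) : selfcent3 G x -> inv3' G x P -> inv3' G x D ->
    p.-group P -> odd p -> D \proper P ->
  exists2 e, 7 <= e & #|P| = (#|D| * e)%N.
Proof.
move=> sc iP iD pP oddp prDP; have sDP := proper_sub prDP.
exists #|P : D|; last by rewrite Lagrange.
have e1 : #|P : D| %% 3 = 1%N.
  by have := inv3_card sc iP; rewrite -(Lagrange sDP) -modnMm (inv3_card sc iD)
     mul1n modn_mod.
have gt1 : #|P : D| > 1 by rewrite indexg_gt1; case/andP: prDP.
have oddP : odd #|P|.
  by have := part_pnat_id pP => <-; rewrite p_part oddX oddp orbT.
have : odd #|P : D| by apply: dvdn_odd oddP; apply: dvdn_indexg.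
by move: e1 gt1; move: #|P : D| => e; lia.
Qed.

(** The maximal invariant p-subgroups are Sylow, so the union is [P] or [P :|: P :^ t]. In the
    second case [P] has index 3 in its normalizer, because index 6 would make [t] normalize [P]. *)
Lemma odd_p_inv3 G (p : nat) : selfcent3 G x -> 'O_3^'(G) = 1 -> odd p ->
  (forall W, inv3' G x W -> p.-group W) -> #|G| \in [:: 3; 6].
Proof.
move=> sc O1 oddp allp; have [//|[w1 w2 [t [Gt ot xt _]] _]] := core1_cases sc O1.
have [/forallP all1|] := boolP [forall W : {group gT}, inv3' G x W ==> (W :==: 1)].
  by apply: (core1_no_inv3 sc O1) => W iW; apply/eqP; apply: (implyP (all1 W)).
rewrite negb_forall => /existsP[W]; rewrite negb_imply => /andP[iW ntW].
have [P maxP sWP] := max_inv3_exists iW (allp W iW).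
have ntP : P :!=: 1 by apply: contraNneq ntW => P1; rewrite P1 subG1 in sWP.
have [iP pP _] := max_inv3P maxP; have [sPG nPx _] := and3P iP.
have sylP := max_inv3_Sylow sc maxP ntP oddp.
have mem Q : max_inv3' G x p Q -> Q :=: P \/ Q :=: P :^ t.
  move=> maxQ; have [/and3P[_ nQx _] _ _] := max_inv3P maxQ.
  have [_ _ maxQ'] := max_inv3P maxQ.
  have ntQ : Q :!=: 1.
    by apply: contraNneq ntP => Q1; apply/eqP; rewrite (maxQ' P) ?Q1 ?sub1G.
  exact: (inv3_Sylow_pair sc Gt xt sylP (max_inv3_Sylow sc maxQ ntQ oddp) nPx nQx).
have Smem a : a \in inv3set G x -> a \in P :|: P :^ t.
  case/inv3setP=> V iV Va; have [Q maxQ sVQ] := max_inv3_exists iV (allp V iV).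
  by rewrite inE; case: (mem Q maxQ) => E; rewrite -E (subsetP sVQ) ?orbT.
have Pmem a : a \in P -> a \in inv3set G x by move=> Pa; apply/inv3setP; exists P.
pose M := 'N_G(P)%G; pose U := 'O_3^'(M)%G.
have OU : 'O_p(U) = P := max_inv3_core_p sc maxP.
have iU : inv3' G x U.
  exact: inv3_sub (inv3_core (max_inv3_norm sc maxP)) (subsetIl _ _).
have defU : U :=: P by rewrite -[RHS]OU; apply/esym/pcore_pgroup_id/allp.
have oM : #|M : P| \in [:: 3; 6] by rewrite -defU; apply: max_inv3_index maxP ntP.
have sPM : P \subset M by rewrite subsetI sPG normG.
have oG : #|G| = (#|P| * #|M : P| * #|G : M|)%N.
  by rewrite Lagrange // Lagrange ?subsetIl.
have gt0 : 0 < #|P| by apply: cardG_gt0.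
have [Pt | nPt] := eqVneq (P :^ t) P.
  have SP : inv3set G x = P.
    apply/setP=> a; apply/idP/idP=> [/Smem | /Pmem//]; by rewrite Pt setUid.
  exfalso; apply: (single_subgroup_window gt0 oM (m := #|G : M|)); rewrite -oG.
    by rewrite -SP.
  by rewrite -SP.
have oM3 : #|M : P| = 3.
  move: oM; rewrite !inE => /orP[/eqP//|/eqP oM6]; case/eqP: nPt; apply/normP.
  by apply: (max_inv3_index6 sc maxP Gt xt); rewrite -/M -/U defU.
have iPt : inv3' G x (P :^ t).
  have /and3P[_ _ P3] := iP; rewrite /inv3' conj_subG // pgroupJ P3 andbT.
  rewrite normJ; have : x^-1 ^ t \in 'N(P) :^ t by rewrite memJ_conjg groupV.
  by rewrite conjVg xt invgK.
have SP : inv3set G x = P :|: P :^ t.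
  apply/setP=> a; apply/idP/idP=> [/Smem // | /setUP[/Pmem//|Pa]].
  by apply/inv3setP; exists (P :^ t)%G.
have iD : inv3' G x (P :&: P :^ t).
  apply: (inv3S iP); rewrite ?subsetIl // inE conjIg.
  by have /and3P[_ nPtx _] := iPt; rewrite (normP nPx) (normP nPtx).
have prD : (P :&: P :^ t)%G \proper P.
  rewrite properEneq subsetIl andbT; apply: contraNneq nPt => E.
  by rewrite eq_sym eqEcard cardJg leqnn andbT -{1}E /= subsetIr.
have [e e7 oP] := inv3_index_ge7 sc iP iD pP oddp prD.
have SPc : #|inv3set G x| = (2 * (#|(P :&: P :^ t)%G| * e) - #|(P :&: P :^ t)%G|)%N.
  by rewrite SP cardsU cardJg addnn -mul2n {1}oP.
exfalso; have := two_subgroup_window (cardG_gt0 (P :&: P :^ t)) e7 (m := #|G : M|).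
by rewrite -SPc -oP; move: oG; rewrite oM3 => <-; apply.
Qed.

End OddPart.

(** * Trivial intersections at odd primes *)

Section OddLocal.

Variables (gT : finGroupType) (x : gT).
Implicit Types (G M K L W B P Q D U : {group gT}) (a g t y : gT).

(** Modulo the core of ['N_G(D)] all invariant 3'-subgroups are p-groups by [inv3_p'core_sub]; so
    [odd_p_inv3] gives the quotient order 3 or 6, and [index_no_inv3] concludes. *)
Lemma odd_local G D (p : nat) W : selfcent3 G x -> inv3' G x D -> p.-group D ->
    D :!=: 1 -> odd p -> inv3' G x W -> W \subset 'N(D) ->
  W \subset 'O_3^'('N_G(D)).
Proof.
move=> sc iD pD ntD oddp iW nDW; have [sDG nDx D3] := and3P iD.
have [Gx _ _] := and3P sc.
set M := 'N_G(D)%G; set K := 'O_3^'(M)%G.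
have Mx : x \in M by rewrite inE Gx.
have sMG : M \subset G by apply: subsetIl.
have scM := selfcent3S sc Mx sMG.
have nsKM : K <| M by apply: pcore_normal.
have K3 : 3^'.-group K by apply: pcore_pgroup.
have sDK : D \subset K by apply: pcore_max; rewrite ?normalSG.
have [nilK _] := fpf3_class2 (inv3_fpf scM (inv3_core scM)).
have ntO : 'O_p(K) != 1.
  apply: contraNneq ntD => O1; rewrite -subG1 -O1.
  by rewrite (sub_Hall_pcore (nilpotent_pcore_Hall _ nilK)).
apply: (index_no_inv3 scM); last first.
  by have [sWG nWx W3] := and3P iW; rewrite /inv3' subsetI sWG nDW nWx.
rewrite -card_quotient ?gFnorm //.
apply: (odd_p_inv3 (selfcent3_quotient scM nsKM K3) _ oddp).
  exact: trivg_pcore_quotient.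
move=> V iV; have [Y [iY sKY defV _]] := inv3_lift nsKM Mx K3 iV.
have [nilY _] := fpf3_class2 (inv3_fpf scM iY).
rewrite /= defV -(dprodW (nilpotent_pcoreC p nilY)).
have sOK : 'O_p^'(Y) \subset K by apply: (inv3_p'core_sub scM iY ntO).
have sYM : Y \subset M by case/and3P: iY.
have nKY := subset_trans sYM (normal_norm nsKM).
rewrite quotientMl ?(subset_trans (pcore_sub _ _)) //.
by rewrite (quotientS1 sOK) mulg1 quotient_pgroup ?pcore_pgroup.
Qed.

Lemma proper_norm_in G W D : selfcent3 G x -> inv3' G x W -> D \proper W ->
  x \in 'N(D) -> inv3' G x 'N_W(D) /\ D \proper 'N_W(D).
Proof.
move=> sc iW prDW nDx; have [nilW _] := fpf3_class2 (inv3_fpf sc iW).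
split; last exact: nilpotent_proper_norm.
have [_ nWx _] := and3P iW; apply: (inv3S iW (subsetIl _ _)).
rewrite -cycle_subG normsI ?cycle_subG // -cycle_subG.
by rewrite (subset_trans _ (normG _)) // cycle_subG.
Qed.

(** If [D = P :&: Q] were nontrivial, ['N_P(D)] and ['N_Q(D)] would lie in the nilpotent core of
    ['N_G(D)], hence in one maximal invariant p-subgroup [R]. Only [P] and [Q] can be [R]; the
    normalizer of [D] in the other one then lies in both, although it is larger than [D]. *)
Lemma max_inv3_TI G P Q (p : nat) t : selfcent3 G x -> t \in G -> x ^ t = x^-1 ->
    odd p -> max_inv3' G x p P -> max_inv3' G x p Q -> P :!=: Q ->
  P :&: Q = 1.
Proof.
move=> sc Gt xt oddp maxP maxQ nePQ; apply/eqP; apply: contraT => ntD.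
have [iP pP mP] := max_inv3P maxP; have [iQ pQ mQ] := max_inv3P maxQ.
have ntP : P :!=: 1 by apply: contraNneq ntD => ->; rewrite setI1g.
have ntQ : Q :!=: 1 by apply: contraNneq ntD => ->; rewrite setIg1.
have sylP := max_inv3_Sylow sc maxP ntP oddp.
have sylQ := max_inv3_Sylow sc maxQ ntQ oddp.
have [_ nPx _] := and3P iP; have [_ nQx _] := and3P iQ.
have sX : <[x]> \subset 'N(P :&: Q) by rewrite normsI ?cycle_subG.
set D := (P :&: Q)%G; have nDx : x \in 'N(D) by rewrite -cycle_subG.
have iD : inv3' G x D by apply: (inv3S iP (subsetIl _ _)).
have pD : p.-group D by apply: pgroupS pP; apply: subsetIl.
have prDP : D \proper P.
  rewrite properEneq subsetIl andbT; apply: contraNneq nePQ => E.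
  by rewrite eq_sym -(mP Q) // -E subsetIr.
have prDQ : D \proper Q.
  rewrite properEneq subsetIr andbT; apply: contraNneq nePQ => E.
  by rewrite -(mQ P) // -E subsetIl.
have [iR1 pr1] := proper_norm_in sc iP prDP nDx.
have [iR2 pr2] := proper_norm_in sc iQ prDQ nDx.
have s1 := odd_local sc iD pD ntD oddp iR1 (subsetIr _ _).
have s2 := odd_local sc iD pD ntD oddp iR2 (subsetIr _ _).
set M := 'N_G(D)%G in s1 s2; set K := 'O_3^'(M)%G in s1 s2.
have [Gx _ _] := and3P sc.
have scM : selfcent3 M x by apply: (selfcent3S sc); rewrite ?subsetIl // inE Gx.
have iK : inv3' G x K := inv3_sub (inv3_core scM) (subsetIl _ _).
have [nilK _] := fpf3_class2 (inv3_fpf sc iK).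
have iO := inv3_char iK (pcore_char p K).
have [R maxR sOR] := max_inv3_exists iO (pcore_pgroup _ _).
have sR W : W \subset K -> p.-group W -> W \subset R.
  move=> sWK pW; apply: subset_trans sOR.
  by rewrite (sub_Hall_pcore (nilpotent_pcore_Hall _ nilK)).
have {}s1 := sR _ s1 (pgroupS (subsetIl _ _) pP).
have {}s2 := sR _ s2 (pgroupS (subsetIl _ _) pQ).
have [iR pR mR] := max_inv3P maxR; have [_ nRx _] := and3P iR.
have ntR : R :!=: 1.
  by apply: contraNneq ntD => R1; rewrite -subG1 -R1 (subset_trans (proper_sub pr1)).
have sylR := max_inv3_Sylow sc maxR ntR oddp.
have PQR : R :=: P \/ R :=: Q.
  have [-> | ->] := inv3_Sylow_pair sc Gt xt sylP sylR nPx nRx; first by left.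
  have [E | ->] := inv3_Sylow_pair sc Gt xt sylP sylQ nPx nQx; last by right.
  by rewrite E eqxx in nePQ.
case: PQR => E; rewrite E in s1 s2.
  by have := proper_subn pr2; rewrite subsetI s2 subsetIl.
by have := proper_subn pr1; rewrite subsetI s1 subsetIl.
Qed.

Definition maximal_inv3 G U := [max U | inv3' G x U].

Lemma maximal_inv3P G U : maximal_inv3 G U ->
  inv3' G x U /\ forall W, inv3' G x W -> U \subset W -> W :=: U.
Proof. by case/maxgroupP=> iU mU; split=> // W iW sUW; apply: mU. Qed.

Lemma maximal_inv3_exists G W : inv3' G x W ->
  exists2 U, maximal_inv3 G U & W \subset U.
Proof.
move=> iW; have [|U maxU sWU] := @maxgroup_exists _ (fun U => inv3' G x U) W.
  by [].
by exists U.
Qed.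

(** In a larger invariant p-group the normalizer of ['O_p(U)] would be properly larger, yet lie in
    [U] by hypothesis, hence in ['O_p(U)]. *)
Lemma max_pcore_of_norm G U (p : nat) : selfcent3 G x -> maximal_inv3 G U ->
  (forall W, inv3' G x W -> p.-group W -> W \subset 'N('O_p(U)) -> W \subset U) ->
  max_inv3' G x p 'O_p(U).
Proof.
move=> sc maxU sWU; have [iU mU] := maximal_inv3P maxU.
have iB := inv3_char iU (pcore_char p U); have [_ nBx _] := and3P iB.
have [nilU _] := fpf3_class2 (inv3_fpf sc iU).
have [P maxP sBP] := max_inv3_exists iB (pcore_pgroup _ _).
suff -> : 'O_p(U)%G = P by [].
have [iP pP _] := max_inv3P maxP.
apply/val_inj/eqP; rewrite eqEproper sBP /=; apply/negP=> prBP.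
have [iN prN] := proper_norm_in sc iP prBP nBx.
have pN : p.-group 'N_P('O_p(U)) by apply: pgroupS pP; apply: subsetIl.
have := proper_subn prN.
case/negP; rewrite (sub_Hall_pcore (nilpotent_pcore_Hall _ nilU)) //.
by apply: sWU; rewrite ?subsetIr.
Qed.

Lemma maximal_pcore_max G U (p : nat) : selfcent3 G x -> maximal_inv3 G U ->
  odd p -> 'O_p(U) != 1 -> max_inv3' G x p 'O_p(U).
Proof.
move=> sc maxU oddp ntB; have [iU mU] := maximal_inv3P maxU.
apply: (max_pcore_of_norm sc maxU) => W iW pW nBW.
have iB := inv3_char iU (pcore_char p U).
have s := odd_local sc iB (pcore_pgroup _ _) ntB oddp.
have [Gx _ _] := and3P sc; have [_ nBx _] := and3P iB.
set M := 'N_G('O_p(U))%G in s.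
have scM : selfcent3 M x by apply: (selfcent3S sc); rewrite ?subsetIl // inE Gx.
have iK : inv3' G x 'O_3^'(M) := inv3_sub (inv3_core scM) (subsetIl _ _).
by rewrite -(mU 'O_3^'(M)%G) ?s // gFnorm.
Qed.

(** The odd part does the work: ['O_2^'(U)] centralizes ['O_2(U)], so it lies in the core [K] of
    ['N_G('O_2(U))], whence [K = U]. As ['O_p(K)] is nontrivial, every invariant 2-subgroup of that
    normalizer lies in [K]. *)
Lemma maximal_2core_max G U (p : nat) : selfcent3 G x -> maximal_inv3 G U ->
  odd p -> 'O_p(U) != 1 -> 'O_2(U) != 1 -> max_inv3' G x 2 'O_2(U).
Proof.
move=> sc maxU oddp ntp nt2; have [iU mU] := maximal_inv3P maxU.
have [nilU _] := fpf3_class2 (inv3_fpf sc iU).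
apply: (max_pcore_of_norm sc maxU) => W iW pW nBW.
have iB := inv3_char iU (pcore_char 2 U).
have [Gx _ _] := and3P sc; have [sBG nBx B3] := and3P iB.
set M := 'N_G('O_2(U))%G; set K := 'O_3^'(M)%G.
have sMG : M \subset G by apply: subsetIl.
have scM : selfcent3 M x by apply: (selfcent3S sc); rewrite ?subsetIl // inE Gx.
have iK : inv3' G x K := inv3_sub (inv3_core scM) sMG.
have [nilK _] := fpf3_class2 (inv3_fpf sc iK).
have sBM : 'O_2(U) <| M by rewrite /= normalSG.
have sUM : U \subset M by have [sUG _ _] := and3P iU; rewrite subsetI sUG gFnorm.
have sBK : 'O_2(U) \subset K by apply: pcore_max.
have cUB : 'O_2^'(U) \subset 'C('O_2(U)).
  by have /dprodP[_ _] := nilpotent_pcoreC 2 nilU.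
have s2'K : 'O_2^'(U) \subset K.
  apply: subset_trans (cent_sub_core scM sBM nt2 B3).
  by rewrite subsetI cUB andbT (subset_trans (pcore_sub _ _)).
have inM Y : inv3' G x Y -> Y \subset 'N('O_2(U)) -> inv3' M x Y.
  by case/and3P=> sYG nYx Y3 nBY; rewrite /inv3' subsetI sYG nBY nYx.
have ntpK : 'O_p(K) != 1.
  apply: contraNneq ntp => O1; rewrite -subG1 -O1.
  rewrite (sub_Hall_pcore (nilpotent_pcore_Hall _ nilK)) ?pcore_pgroup //.
  apply: subset_trans s2'K.
  rewrite (sub_Hall_pcore (nilpotent_pcore_Hall _ nilU)) ?pcore_sub //.
  apply: pi_pgroup (pcore_pgroup p U) _; rewrite !inE.
  by apply: contraTneq oddp => ->.
have p'2 : 2 \in p^' by rewrite !inE; apply: contraTneq oddp => <-.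
have sWK Y : inv3' G x Y -> 2.-group Y -> Y \subset 'N('O_2(U)) -> Y \subset K.
  move=> iY pY nY; have <- : 'O_p^'(Y) = Y.
    by apply: pcore_pgroup_id; apply: pi_pgroup pY p'2.
  by apply: inv3_p'core_sub (inM _ iY nY) ntpK.
suff <- : K :=: U by apply: sWK.
apply: mU => //; rewrite -(dprodW (nilpotent_pcoreC 2 nilU)) mul_subG //.
Qed.

End OddLocal.

(** * The prime two *)

(* Each class is a whole coset of the derived group, which has index 4; three
   distinct cosets would make every element outside it an involution. *)
Lemma three_small_cent1_2group (gT : finGroupType) (T : {group gT}) (v1 v2 v3 : gT) :
    2.-group T -> 4 < #|T| ->
    [/\ v1 \in T, v2 \in T & v3 \in T] ->
    [/\ v1 ^+ 2 = 1, v2 ^+ 2 = 1 & v3 ^+ 2 = 1] ->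
    [/\ #|'C_T[v1]| = 4, #|'C_T[v2]| = 4 & #|'C_T[v3]| = 4] ->
  [|| v1 \in v2 ^: T, v1 \in v3 ^: T | v2 \in v3 ^: T].
Proof.
move=> pT gt4 [T1 T2 T3] [s1 s2 s3] [c1 c2 c3].
have nilT := pgroup_nil pT.
have nabT : ~~ abelian T.
  apply: contraL gt4 => abT; rewrite -leqNgt -c1 subset_leq_card //.
  by rewrite subsetI subxx sub_cent1 (subsetP abT).
(* A nilpotent group with cyclic abelianization is abelian. With index at least 4, a class of size
   |T| / 4 fills a whole coset of the derived group. *)
have i4 : 4 <= #|T : T^`(1)|.
  rewrite -card_quotient ?der_norm // ltnNge; apply: contra nabT => le3.
  apply: cyclic_abelian; apply: (cyclic_nilpotent_quo_der1_cyclic nilT).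
  have pq : 2.-group (T / T^`(1)) by apply: quotient_pgroup.
  have [-> | nt] := eqVneq (T / T^`(1)) 1; first exact: cyclic1.
  have [_ d2 _] := pgroup_pdiv pq nt.
  apply: prime_cyclic; have := cardG_gt0 (T / T^`(1)).
  by case: #|_| le3 d2 => [|[|[|[|k]]]].
have clV v : v \in T -> #|'C_T[v]| = 4 -> v ^: T = v *: T^`(1).
  move=> Tv cv; apply/eqP; rewrite eqEcard; apply/andP; split.
    apply/subsetP=> _ /imsetP[g Tg ->]; rewrite mem_lcoset -commgEl.
    exact: mem_commg.
  rewrite card_lcoset -index_cent1 -(leq_pmul2l (isT : 0 < 4)) -{2}cv.
  by rewrite Lagrange ?subsetIl // -(Lagrange (der_sub 1 T)) mulnC leq_mul2l i4 orbT.
have e4 : #|T : T^`(1)| = 4.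
  have := congr1 (fun A : {set gT} => #|A|) (clV v1 T1 c1).
  rewrite card_lcoset -index_cent1 => e.
  have := Lagrange (der_sub 1 T); have := Lagrange (subsetIl T 'C[v1]).
  rewrite /= c1 e => <- E; have := cardG_gt0 T^`(1).
  by move: E; move: #|T : _| #|T^`(1)| => a b /=; nia.
have notD v : v \in T -> #|'C_T[v]| = 4 -> v \notin T^`(1).
  move=> Tv cv; apply/negP=> Dv; have : 1 \in v ^: T.
    by rewrite (clV v Tv cv) mem_lcoset mulg1 groupV.
  case/imsetP=> g Tg /esym/eqP; rewrite conjg_eq1 => /eqP v1E.
  by move: cv gt4; rewrite v1E cent11T setIT => ->.
apply: contraT; rewrite !negb_or => /and3P[n12 n13 n23].
have inv g : g \in T -> g \notin T^`(1) -> g ^+ 2 = 1.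
  move=> Tg nDg.
  suff : [|| g \in v1 ^: T, g \in v2 ^: T | g \in v3 ^: T].
    by case/or3P=> /imsetP[h _ ->]; rewrite -conjXg ?s1 ?s2 ?s3 conj1g.
  apply: contraT; rewrite !negb_or => /and3P[m1 m2 m3].
  pose f := coset T^`(1).
  have Nn h : h \in T -> h \in 'N(T^`(1)) by apply: subsetP; apply: der_norm.
  have eqf h v : h \in T -> v \in T -> #|'C_T[v]| = 4 -> (f h == f v) = (h \in v ^: T).
    move=> Th Tv cv; rewrite clV // mem_lcoset eq_sym eq_mulVg1.
    rewrite /f -morphV ?Nn // -morphM ?groupV ?Nn //.
    apply/eqP/idP => [/coset_idr|/coset_id //]; apply.
    by rewrite groupM ?groupV ?Nn.
  have f1 v : v \in T -> #|'C_T[v]| = 4 -> f v != 1.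
    by move=> Tv cv; apply: contraNneq (notD v Tv cv) => /coset_idr; apply; apply: Nn.
  have fg1 : f g != 1.
    by apply: contraNneq nDg => /coset_idr; apply; apply: Nn.
  have sub : 1 |: [set f v1; f v2; f v3; f g] \subset T / T^`(1).
    by rewrite !subUset !sub1set group1 !mem_quotient.
  have := subset_leq_card sub; rewrite card_quotient ?der_norm // e4.
  have n1 : 1 \notin [set f v1; f v2; f v3; f g].
    by rewrite !inE !negb_or !(eq_sym 1) (f1 v1) ?(f1 v2) ?(f1 v3) // fg1.
  rewrite cardsU1 n1.
  rewrite -!setUA cardsU1 !inE (eqf v1 v2) // (eqf v1 v3) // (negPf n12) (negPf n13).
  rewrite [f v1 == f g]eq_sym (eqf g v1) // (negPf m1) /=.
  rewrite cardsU1 !inE (eqf v2 v3) // (negPf n23).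
  rewrite [f v2 == f g]eq_sym (eqf g v2) // (negPf m2) /= cards2.
  by rewrite [f v3 == f g]eq_sym (eqf g v3) // (negPf m3).
have invD s : s \in T^`(1) -> s ^+ 2 = 1.
  move=> Ds; have Ts := subsetP (der_sub 1 T) s Ds.
  have cj v : v \in T -> v \notin T^`(1) -> s ^ v = s^-1.
    move=> Tv nDv; have v2E := inv v Tv nDv.
    have vs2 : (v * s) ^+ 2 = 1 by apply: inv; [apply: groupM | rewrite groupMr].
    apply: (mulIg s); rewrite mulVg -vs2 expgS expg1 conjgE !mulgA.
    congr (_ * _ * _ * _); apply: (mulIg v); rewrite mulVg -v2E //.
  (* [v1], [v2] and [v1 * v2] all invert the derived group, while two inversions compose to the
     identity; so the derived group has exponent two. *)
  have n12' : v1 * v2 \notin T^`(1).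
    apply: contra n12 => D12; rewrite clV // mem_lcoset.
    have -> : v2^-1 = v2 by apply: (mulIg v2); rewrite mulVg -s2.
    have <- : (v1 * v2) ^ v1 = v2 * v1.
      by rewrite conjgE !mulgA mulVg mul1g.
    by rewrite memJ_norm // (subsetP (der_norm 1 T)).
  have := cj _ (groupM T1 T2) n12'; rewrite conjgM cj ?notD // conjVg cj ?notD // invgK.
  by move=> sE; rewrite expgS expg1 {2}sE mulgV.
suff abT : abelian T by rewrite abT in nabT.
have all2 g : g \in T -> g ^+ 2 = 1.
  by move=> Tg; have [/invD|] := boolP (g \in T^`(1)); last exact: inv.
apply/centsP=> g Tg h Th; rewrite /commute.
have iv k : k \in T -> k^-1 = k.
  by move=> Tk; apply: (mulIg k); rewrite mulVg -[RHS]/(k ^+ 2) all2.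
by rewrite -[g * h]iv ?groupM // invMg !iv.
Qed.

Lemma group6_inverts (gT : finGroupType) (G : {group gT}) (x s : gT) : selfcent3 G x -> #|G| = 6 -> s \in G -> s ^+ 2 = 1 ->
  s != 1 -> x ^ s = x^-1.
Proof.
move=> sc oG Gs s2 nts; have [Gx /eqP ox /eqP Cx] := and3P sc.
have sXG : <[x]> \subset G by rewrite cycle_subG.
have nsX : <[x]> <| G.
  apply: index2_normal => //; apply/eqP.
  by rewrite -(eqn_pmul2l (cardG_gt0 <[x]>)) Lagrange // oG /= -orderE ox.
have nXs : s \notin <[x]>.
  apply: contra nts => Xs; have := order_dvdG Xs; rewrite -orderE ox => d3.
  have d2 : #[s] %| 2 by rewrite order_dvdn s2.
  have : #[s] %| gcdn 3 2 by rewrite dvdn_gcd d3.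
  by rewrite dvdn1 order_eq1.
have : x ^ s \in <[x]>.
  by rewrite memJ_norm ?cycle_id //; apply: subsetP (normal_norm nsX) s Gs.
case/cyclePmin=> i; rewrite ox; case: i => [|[|[|//]]] _ xs.
- by have := congr1 (fun y => #[y]) xs; rewrite orderJ ox expg0 order1.
- case/negP: nXs; rewrite -Cx inE Gs.
  by apply/cent1P/commute_sym/commgP/conjg_fixP.
by rewrite xs; apply/eqP; rewrite eq_mulgV1 invgK -expgSr -ox expg_order.
Qed.

Section EvenPart.

Variables (gT : finGroupType) (x : gT).
Implicit Types (G M K L W B P Q D U T : {group gT}) (a g t y s z : gT).

(* s and s ^ x generate an element acting on W like a fixed-point-free one, so
   'C_P[s] meets its x-conjugate trivially. *)
Lemma inv_card_norm_conj W s P : fpf3 W x -> s * s ^ x \in x^-1 *: W -> P \subset W ->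
  x \in 'N(P) -> (#|'C_P[s]| * #|'C_P[s]| <= #|P|)%N.
Proof.
move=> fx Ws sPW nPx.
have fw : fpf3 W (s * s ^ x).
  by have [u Wu ->] := lcosetP Ws; apply: fpf3_mulr (fpf3V fx) Wu.
have eqJ : 'C_P[s] :^ x = 'C_P[s ^ x] by rewrite conjIg (normP nPx) -normJ conjg_set1.
have TI : 'C_P[s] :&: 'C_P[s] :^ x = 1.
  apply/trivgP; have /and3P[_ _ /eqP <-] := fw.
  rewrite /= eqJ; apply/subsetP=> a /setIP[/setIP[Pa /cent1P sa] /setIP[_ /cent1P sxa]].
  rewrite in_setI (subsetP sPW) //; apply/cent1P.
  exact: commuteM.
rewrite -{2}(cardJg 'C_P[s] x) -TI_cardMg // subset_leq_card // mul_subG ?subsetIl //.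
by rewrite /= eqJ subsetIl.
Qed.

Section NonSylow.

Variables (G P T : {group gT}).
Hypotheses (sc : selfcent3 G x) (maxP : max_inv3' G x 2 P) (ntP : P :!=: 1).
Hypotheses (sylT : 2.-Sylow(G) T) (sPT : P \subset T).

Let U := 'O_3^'('N_G(P))%G.

Let iP : inv3' G x P. Proof. by case: (max_inv3P maxP). Qed.
Let sPG : P \subset G. Proof. by case/and3P: iP. Qed.
Let nPx : x \in 'N(P). Proof. by case/and3P: iP. Qed.
Let pP : 2.-group P. Proof. by case: (max_inv3P maxP). Qed.
Let sTG : T \subset G. Proof. exact: pHall_sub sylT. Qed.
Let pT : 2.-group T. Proof. exact: pHall_pgroup sylT. Qed.
Let scM : selfcent3 'N_G(P) x. Proof. exact: max_inv3_norm sc maxP. Qed.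
Let OU : 'O_2(U) = P. Proof. exact: max_inv3_core_p sc maxP. Qed.
Let iU : inv3' 'N_G(P) x U. Proof. exact: inv3_core scM. Qed.
Let nilU : nilpotent U. Proof. by have [] := fpf3_class2 (inv3_fpf scM iU). Qed.
Let sPU : P \subset U. Proof. by rewrite -{1}OU pcore_sub. Qed.

Lemma max_inv3_2sub W : W \subset U -> 2.-group W -> W \subset P.
Proof.
by move=> sWU pW; rewrite -OU (sub_Hall_pcore (nilpotent_pcore_Hall _ nilU)).
Qed.

Lemma max_inv3_cent : 'C_T(P) \subset P.
Proof.
apply: max_inv3_2sub; last by apply: pgroupS pT; apply: subsetIl.
have /and3P[_ _ P3] := iP.
apply: subset_trans (cent_sub_core scM _ ntP P3); last by rewrite normalSG.
by rewrite subsetI subsetIr andbT setISS ?cent_sub.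
Qed.

Lemma max_inv3_center : 'Z(T) \subset P.
Proof. by apply: subset_trans max_inv3_cent; rewrite setIS // centS. Qed.

Lemma max_inv3_norm_Sylow :
  #|'N_T(P)| = #|P| \/ (#|'N_T(P)| = 2 * #|P|)%N /\ #|'N_G(P) : U| = 6.
Proof.
have sPN : P \subset 'N_T(P) by rewrite subsetI sPT normG.
have pN : 2.-group 'N_T(P) by apply: pgroupS pT; apply: subsetIl.
have dvN : #|'N_T(P)| %| (#|P| * #|'N_G(P) : U|`_2)%N.
  have -> : (#|P| * #|'N_G(P) : U|`_2 = #|'N_G(P)|`_2)%N.
    rewrite -(Lagrange (pcore_sub 3^' 'N_G(P))) partnM //; congr (_ * _)%N.
    by rewrite -(card_Hall (nilpotent_pcore_Hall 2 nilU)) /= OU.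
  rewrite -(part_pnat_id pN) partn_dvd //; apply: cardSg; exact: setSI.
have := Lagrange sPN; move: dvN; have := max_inv3_index sc maxP ntP.
have := cardG_gt0 P; rewrite -/U !inE; move: #|'N_T(P) : P| #|'N_T(P)| #|P| => i n m.
move=> m0 /orP[]/eqP-> + nE; rewrite -nE dvdn_pmul2l // p_part.
  rewrite (_ : logn 2 3 = 0%N) // dvdn1 => /eqP->; left; rewrite muln1 //.
rewrite (_ : logn 2 6 = 1%N) // => d2.
have : i <= 2 by apply: dvdn_leq.
by case: i d2 nE => [|[|[|i]]] // _ _ _; [left | right]; rewrite ?muln1 // mulnC.
Qed.

(** [S] has class at most two, so in its conjugate [T] the derived group is central and lies in [P].
    Thus [P] is normal in [T] of index 1 or 2, and index 2 is impossible as both orders are 1 modulo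
    3. *)
Lemma max_inv3_of_inv_Sylow (S : {group gT}) : 2.-Sylow(G) S -> x \in 'N(S) -> P :=: T.
Proof.
move=> sylS nSx; have [g Gg defT] := Sylow_trans sylS sylT.
have [sSG pS _] := and3P sylS.
have S3 : 3^'.-group S by apply: pi_pgroup pS _.
have iS : inv3' G x S by rewrite /inv3' sSG nSx.
have T'Z : T^`(1) \subset 'Z(T).
  rewrite defT derJ /center centJ -conjIg conjSg; exact: fpf3_der1_center (inv3_fpf sc iS).
have nsPT : P <| T by apply: sub_der1_normal => //; apply: subset_trans T'Z max_inv3_center.
have NT : 'N_T(P) = T by apply/setIidPl; apply: normal_norm.
have T1 : #|T| %% 3 = 1%N by rewrite defT cardJg (inv3_card sc iS).
have P1 := inv3_card sc iP.
apply/eqP; rewrite eqEcard sPT /=.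
case: max_inv3_norm_Sylow => [|[]]; rewrite NT => E; first by rewrite E.
by move: E T1 P1; move: #|T| #|P| => a b; clear; lia.
Qed.

(** The centralizer of [z] and [z ^ x] is invariant and misses [x], so it is a nilpotent 3'-group.
    It contains [P], so its 2-part is [P] by maximality, and it contains ['C_T[z ^ x]]. *)
Lemma cent1_conj_center z : z \in 'Z(T) -> z != 1 -> 'C_T[z ^ x] = P.
Proof.
move=> Zz ntz; have Pz := subsetP max_inv3_center z Zz.
have [Tz cTz] := setIP Zz; have fx := inv3_fpf sc iP.
have [Gx _ _] := and3P sc.
pose A := (<[z]> <*> <[z ^ x]>)%G; pose C := 'C_G(A)%G.
have nAx : x \in 'N(A).
  rewrite inE -[A :^ x]/((<[z]> <*> <[z ^ x]>) :^ x) conjYg -!cycleJ join_subG.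
  rewrite !cycle_subG -[_ \in A]cycle_subG joing_subr /=.
  have -> : (z ^ x) ^ x = (z * z ^ x)^-1.
    rewrite -conjgM -[x * x]/(x ^+ 2); apply: (mulgI (z * z ^ x)).
    by rewrite mulgV (fpf3_prod fx Pz).
  by rewrite groupV groupM // -cycle_subG ?joing_subr ?joing_subl.
have sCG : C \subset G by apply: subsetIl.
have nCx : x \in 'N(C).
  rewrite -cycle_subG normsI ?norms_cent ?cycle_subG //.
  exact: subsetP (normG G) x Gx.
have nxC : x \notin C.
  rewrite inE negb_and; apply/orP; right; apply: contra ntz => cAx.
  rewrite -in_set1 -[[set 1]]/(1 : {set gT}).
  have /and3P[_ _ /eqP <-] := fx; rewrite inE Pz; apply/cent1P/commute_sym.
  by apply: (centP cAx); rewrite -cycle_subG joing_subl.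
have iC : inv3' G x C by rewrite /inv3' sCG nCx (selfcent3_notin sc).
have [nilC _] := fpf3_class2 (inv3_fpf sc iC).
have zxP : z ^ x \in 'C(P) by rewrite -(normP nPx) centJ memJ_conjg (subsetP (centS sPT)).
have sPC : P \subset C.
  rewrite subsetI sPG centsC join_subG !cycle_subG zxP andbT.
  by rewrite (subsetP (centS sPT)).
have OC : 'O_2(C) = P.
  have [_ _ max] := max_inv3P maxP.
  apply: max; rewrite ?pcore_pgroup //; first exact: inv3_char iC (pcore_char _ _).
  by rewrite (sub_Hall_pcore (nilpotent_pcore_Hall _ nilC)).
apply/eqP; rewrite eqEsubset; apply/andP; split; last first.
  by rewrite subsetI sPT; apply/subsetP=> a Pa; apply/cent1P/commute_sym; apply: (centP zxP).
rewrite -OC (sub_Hall_pcore (nilpotent_pcore_Hall _ nilC)); last first.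
  rewrite subsetI subIset ?sTG //= centsC join_subG !cycle_subG.
  apply/andP; split; first by rewrite (subsetP _ _ cTz) // centS ?subsetIl.
  by apply/centP=> a /setIP[_ /cent1P].
by apply: pgroupS pT; apply: subsetIl.
Qed.

(** If [s] is in [P], its centralizer there is invariant and both orders would be 1 modulo 3.
    Otherwise [s] inverts [x] modulo the core, and [inv_card_norm_conj] bounds the square of |P| / 2
    by |P|. *)
Lemma half_cent_card s : s \in 'N_G(P) -> s ^+ 2 = 1 -> (2 * #|'C_P[s]| = #|P|)%N ->
  #|P| = 4.
Proof.
move=> Ms s2 oC; have P1 := inv3_card sc iP.
have [Ps | nPs] := boolP (s \in P).
  have nCx := fpf3_cent1_norm (inv3_fpf sc iP) Ps.
  have iC : inv3' G x 'C_P[s] by apply: (inv3S iP); rewrite ?subsetIl.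
  have := inv3_card sc iC; move: P1; rewrite -oC; move: #|'C_P[s]| => c.
  by clear; lia.
have nUs : s \notin U.
  apply: contra nPs => Us; rewrite -cycle_subG; apply: max_inv3_2sub.
    by rewrite cycle_subG.
  rewrite /pgroup -orderE; apply: (@pnat_dvd _ 2) => //.
  by rewrite order_dvdn s2.
have nsU : U <| 'N_G(P) by apply: pcore_normal.
have nUM := normal_norm nsU.
have [Mx _ _] := and3P scM.
have Nx := subsetP nUM x Mx; have Ns := subsetP nUM s Ms.
have scq := selfcent3_quotient scM nsU (pcore_pgroup _ _).
have nts : coset U s != 1 by apply: contraNneq nUs => /coset_idr; apply.
have s2q : coset U s ^+ 2 = 1 by rewrite -morphX // s2 morph1.
have oq : #|'N_G(P) / U| = 6.
  have := max_inv3_index sc maxP ntP; rewrite -card_quotient // !inE.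
  case/orP=> /eqP // oq3; have := order_dvdG (mem_quotient U Ms); rewrite oq3 => d3.
  have d2 : #[coset U s] %| 2 by rewrite order_dvdn s2q.
  have : #[coset U s] %| gcdn 3 2 by rewrite dvdn_gcd d3.
  by rewrite dvdn1 order_eq1 (negPf nts).
have xs := group6_inverts scq oq (mem_quotient U Ms) s2q nts.
have Ws : s * s ^ x \in x^-1 *: U.
  rewrite mem_lcoset invgK; apply: coset_idr.
    by rewrite groupM // groupM // groupJ.
  have hm a b : a \in 'N(U) -> b \in 'N(U) -> coset U (a * b) = coset U a * coset U b.
    by move=> Na Nb; rewrite morphM.
  have hj : coset U (s ^ x) = coset U s ^ coset U x by rewrite morphJ.
  rewrite (hm x) ?(groupM Ns) ?groupJ // (hm s) ?groupJ // hj.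
  have sV : (coset U s)^-1 = coset U s by apply: (mulIg (coset U s)); rewrite mulVg -s2q.
  have a3 : coset U x ^+ 3 = 1.
    by have /and3P[_ /eqP <- _] := scq; rewrite expg_order.
  move: xs a3; rewrite !conjgE sV; move: (coset U x) (coset U s) s2q => a b b2 E a3.
  have bb : b * b = 1 by rewrite -[b * b]/(b ^+ 2).
  have E' : b * (a^-1 * b) = a by rewrite -E !mulgA bb mul1g -(mulgA a) bb mulg1.
  by rewrite (mulgA a^-1) (mulgA b) E'.
have := inv_card_norm_conj (inv3_fpf scM iU) Ws sPU nPx; move: P1 ntP oC.
rewrite -cardG_gt1; move: #|'C_P[s]| #|P| => c d.
by clear; nia.
Qed.

Lemma center_involution : exists2 z, z \in 'Z(T) & #[z] = 2.
Proof.
have ntT : T :!=: 1 by apply: contraNneq ntP => T1E; rewrite -subG1 -T1E.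
have ntZ : 'Z(T) != 1.
  by apply: contra ntT => /eqP Z1; rewrite (trivg_center_pgroup pT Z1).
have [_ d2 _] := pgroup_pdiv (pgroupS (center_sub T) pT) ntZ.
by have [z Zz oz] := Cauchy (isT : prime 2) d2; exists z.
Qed.

(** An element [n] of [T] that normalizes ['N_T(P)] but not [P] gives two subgroups [P] and [P :^ n]
    of index two there. They meet in half of [P], which is the centralizer in [P] of an involution,
    so [half_cent_card] applies. *)
Lemma max_inv3_norm_proper : 'N_T(P) != T -> P :!=: T -> #|P| = 4.
Proof.
move=> neNT nePT; pose T1 := 'N_T(P)%G.
have nilT := pgroup_nil pT.
have prPT : P \proper T by rewrite properEneq nePT.
have prPN : P \proper T1 by apply: nilpotent_proper_norm.
have oT1 : #|T1| = (2 * #|P|)%N.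
  case: max_inv3_norm_Sylow => [E|[]//].
  by have := proper_card prPN; rewrite /= E ltnn.
have prNT : T1 \proper T by rewrite properEneq neNT subsetIl.
have [n] := subsetPn (proper_subn (nilpotent_proper_norm nilT prNT)).
case/setIP=> Tn NT1n nT1n.
have [z Zz oz] := center_involution.
have ntz : z != 1 by rewrite -order_gt1 oz.
have Cv := cent1_conj_center Zz ntz; set v := z ^ x in Cv.
have Cvn : 'C_T[v ^ n] = P :^ n by rewrite -Cv conjIg -normJ conjg_set1 conjGid.
have sP1 : P :^ n \subset T1.
  by rewrite -(normP NT1n) conjSg subsetI sPT normG.
have nePn : P :^ n != P.
  by apply: contra nT1n => /eqP E; rewrite inE Tn; apply/normP.
apply: (half_cent_card (s := v ^ n)).
- rewrite -cycle_subG (subset_trans _ (setSI _ sTG)) // cycle_subG.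
  apply: (subsetP sP1); rewrite memJ_conjg -Cv inE cent1id andbT.
  by rewrite (subsetP sPT) // memJ_norm // (subsetP max_inv3_center).
- by rewrite -!conjXg -oz expg_order !conj1g.
have -> : 'C_P[v ^ n] = P :&: P :^ n.
  by rewrite -Cvn setIA (setIidPl sPT).
have sPP1 : P * P :^ n \subset T1.
  by rewrite mul_subG // (proper_sub prPN).
have le1 := subset_leq_card sPP1; have := mul_cardG P (P :^ n).
rewrite cardJg => e.
have sIP : P :&: P :^ n \proper P.
  rewrite properEneq subsetIl andbT; apply: contraNneq nePn => E.
  by rewrite eq_sym eqEcard cardJg leqnn andbT -{1}E subsetIr.
have lt1 := proper_card sIP; have := Lagrange (proper_sub sIP : (P :&: P :^ n)%G \subset P).
move: e le1 lt1; rewrite oT1 /=; have := cardG_gt0 P; rewrite -/(gval P).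
move: #|P : _| #|P| #|P * _| #|P :&: _| => i a b c.
clear=> a0 e le1 lt1 ca.
have i2 : 2 <= i by move: ca lt1; case: i => [|[|i]]; lia.
have : i <= 2 by nia.
by move=> le2; rewrite -ca mulnC; congr (_ * _)%N; apply/eqP; rewrite eqn_leq i2.
Qed.

End NonSylow.

End EvenPart.

(** * Maximal invariant 2-subgroups when no Sylow 2-subgroup is invariant *)

Section TwoInvariant.

Variables (gT : finGroupType).
Implicit Types (G M K L W B P Q D U T : {group gT}) (a g t x y s z : gT).

Lemma max_inv3J G P x g p : g \in G -> max_inv3' G x p P ->
  max_inv3' G (x ^ g) p (P :^ g).
Proof.
move=> Gg; have aux y h W : h \in G -> inv3' G y W -> inv3' G (y ^ h) (W :^ h).
  move=> Gh /and3P[sWG nWy W3]; rewrite /inv3' conj_subG // pgroupJ W3 andbT.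
  by rewrite normJ memJ_conjg.
case/max_inv3P=> iP pP max; apply/maxgroupP; split; first by rewrite aux // pgroupJ.
move=> H /andP[iH pH] sPH; have {iH}iH := aux _ g^-1 _ (groupVr Gg) iH.
rewrite /= conjgK in iH *; have <- : H :^ g^-1 = P.
  by apply: (max _ iH); rewrite ?pgroupJ //= -sub_conjg.
by rewrite conjsgKV.
Qed.

Lemma selfcent3J G x g : selfcent3 G x -> g \in G -> selfcent3 G (x ^ g).
Proof.
case/and3P=> Gx ox /eqP Cx Gg; rewrite /selfcent3 groupJ // orderJ ox /=.
by rewrite -{1}(conjGid Gg) cycleJ -Cx conjIg -normJ conjg_set1.
Qed.

(** Two elements [x] and [y] appear because moving both subgroups into one [T] conjugates one of the
    elements. Both subgroups have index two in [T]; if distinct, they meet in half of [P], the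
    centralizer of the involution [z ^ y], against [half_cent_card]. *)
Lemma max_inv3_Sylow_unique G P Q T x y : selfcent3 G x -> selfcent3 G y ->
    max_inv3' G x 2 P -> max_inv3' G y 2 Q -> P :!=: 1 -> Q :!=: 1 ->
    2.-Sylow(G) T -> P \subset T -> Q \subset T -> P :!=: T -> Q :!=: T ->
    #|P| != 4 -> #|Q| != 4 -> P :=: Q.
Proof.
move=> scx scy maxP maxQ ntP ntQ sylT sPT sQT nPT nQT oP oQ.
have NTP : 'N_T(P) = T.
  apply/eqP; apply: contraT => ne; case/eqP: oP.
  exact: (max_inv3_norm_proper scx maxP ntP sylT).
have NTQ : 'N_T(Q) = T.
  apply/eqP; apply: contraT => ne; case/eqP: oQ.
  exact: (max_inv3_norm_proper scy maxQ ntQ sylT).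
have oT R z : selfcent3 G z -> max_inv3' G z 2 R -> R :!=: 1 -> R \subset T ->
    R :!=: T -> 'N_T(R) = T -> #|T| = (2 * #|R|)%N.
  move=> scz maxR ntR sRT nRT NTR.
  have := max_inv3_norm_Sylow scz maxR ntR sylT sRT; rewrite NTR.
  by case=> [E | [//]]; case/eqP: nRT; apply/eqP; rewrite eqEcard sRT E leqnn.
have oTP := oT _ _ scx maxP ntP sPT nPT NTP.
have oTQ := oT _ _ scy maxQ ntQ sQT nQT NTQ.
have [z Zz oz] := center_involution ntP sylT sPT.
have ntz : z != 1 by rewrite -order_gt1 oz.
have Cv := cent1_conj_center scy maxQ ntQ sylT sQT Zz ntz.
apply/eqP; apply: contraT => nePQ; case/eqP: oP.
have Qz := subsetP (max_inv3_center scy maxQ ntQ sylT sQT) z Zz.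
have [/and3P[_ nQy _] _ _] := max_inv3P maxQ.
have Tv : z ^ y \in T by rewrite (subsetP sQT) ?memJ_norm.
apply: (half_cent_card scx maxP ntP (s := z ^ y)).
- by apply: (subsetP (setSI _ (pHall_sub sylT))); rewrite NTP.
- by rewrite -conjXg -oz expg_order conj1g.
have -> : 'C_P[z ^ y] = P :&: Q by rewrite -Cv setIA (setIidPl sPT).
have oPQ : #|P| = #|Q| by apply/eqP; rewrite -(eqn_pmul2l (isT : 0 < 2)) -oTP oTQ.
have sIP : P :&: Q \proper P.
  rewrite properEneq subsetIl andbT; apply: contraNneq nePQ => E.
  by rewrite eqEcard oPQ leqnn andbT -{1}E subsetIr.
have sPQ : P * Q \subset T by rewrite mul_subG.
have le1 := subset_leq_card sPQ; have := mul_cardG P Q.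
have lt1 := proper_card sIP; have := Lagrange (proper_sub sIP : (P :&: Q)%G \subset P).
move: le1 lt1; rewrite oTP -oPQ /=; have := cardG_gt0 P.
move: #|P : _| #|P| #|P * _| #|P :&: _| => i a b c.
clear=> a0 le1 lt1 ca e.
have i2 : 2 <= i by move: ca lt1; case: i => [|[|i]]; lia.
have le2 : i <= 2 by nia.
by rewrite -ca mulnC; congr (_ * _)%N; apply/eqP; rewrite eqn_leq i2.
Qed.

Section Global.

Variables (G : {group gT}) (x t : gT).
Hypotheses (sc : selfcent3 G x) (Gt : t \in G) (xt : x ^ t = x^-1).
Hypothesis noSyl : forall S : {group gT}, 2.-Sylow(G) S -> x \notin 'N(S).

(** [P] is not Sylow, so it grows inside a Sylow 2-subgroup; this forces index 6 of the core in
    ['N_G(P)], and with it an element inverting [x]. *)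
Lemma nonSylow_norm_t P : max_inv3' G x 2 P -> P :!=: 1 -> t \in 'N(P).
Proof.
move=> maxP ntP; have [/and3P[sPG nPx _] pP _] := max_inv3P maxP.
have [T sylT sPT] := Sylow_superset sPG pP.
apply: (max_inv3_index6 sc maxP Gt xt).
case: (max_inv3_norm_Sylow sc maxP ntP sylT sPT) => [E | [//]].
have nilT := pgroup_nil (pHall_pgroup sylT).
have [prPT | nprPT] := boolP (P \proper T).
  by have := proper_card (nilpotent_proper_norm nilT prPT); rewrite E ltnn.
have defT : P :=: T by apply/eqP; move: nprPT; rewrite properEneq sPT andbT negbK.
by have := noSyl sylT; rewrite -defT nPx.
Qed.

Lemma nonSylow_neq P T g : max_inv3' G x 2 P -> 2.-Sylow(G) T -> g \in G ->
  P :^ g != T.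
Proof.
move=> maxP sylT Gg; have [/and3P[sPG nPx _] pP _] := max_inv3P maxP.
apply: contraL nPx => /eqP E; apply: noSyl.
by rewrite -(pHallJ _ _ Gg) E.
Qed.

Lemma nonSylow_conj P Q g : max_inv3' G x 2 P -> P :!=: 1 -> max_inv3' G x 2 Q ->
  g \in G -> Q :=: P :^ g -> Q :=: P.
Proof.
move=> maxP ntP maxQ Gg defQ; have [/and3P[sPG nPx _] pP _] := max_inv3P maxP.
have [/and3P[sQG nQx _] pQ _] := max_inv3P maxQ; rewrite defQ in nQx *.
have [//|->] := inv_conj2 sc sPG Gg Gt xt nPx nQx.
exact/normP/nonSylow_norm_t.
Qed.

Lemma nonSylow_big P Q : max_inv3' G x 2 P -> max_inv3' G x 2 Q -> P :!=: 1 ->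
  Q :!=: 1 -> #|P| != 4 -> #|Q| != 4 -> P :=: Q.
Proof.
move=> maxP maxQ ntP ntQ oP oQ; have [/and3P[sPG nPx _] pP _] := max_inv3P maxP.
have [/and3P[sQG nQx _] pQ _] := max_inv3P maxQ.
have [T sylT sPT] := Sylow_superset sPG pP.
have [g Gg sQT] := Sylow_Jsub sylT sQG pQ.
apply: (nonSylow_conj maxQ ntQ maxP Gg).
apply: (max_inv3_Sylow_unique sc (selfcent3J sc Gg) maxP (max_inv3J Gg maxQ) ntP _ sylT).
- by rewrite -cardG_gt1 cardJg cardG_gt1.
- by [].
- by [].
- by have := nonSylow_neq maxP sylT (group1 G); rewrite conjsg1.
- exact: nonSylow_neq.
- by [].
- by rewrite cardJg.
Qed.

Lemma nonSylow_big_card P T : max_inv3' G x 2 P -> P :!=: 1 -> #|P| != 4 ->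
  2.-Sylow(G) T -> #|T| = (2 * #|P|)%N.
Proof.
move=> maxP ntP oP sylT; have [/and3P[sPG nPx _] pP _] := max_inv3P maxP.
have [S sylS sPS] := Sylow_superset sPG pP.
have nPS : P :!=: S by have := nonSylow_neq maxP sylS (group1 G); rewrite conjsg1.
rewrite (card_Hall sylT) -(card_Hall sylS).
have := max_inv3_norm_Sylow sc maxP ntP sylS sPS.
have -> : 'N_S(P) = S.
  apply/eqP; apply: contraT => ne; case/eqP: oP.
  exact: (max_inv3_norm_proper sc maxP ntP sylS).
by case=> [E | [//]]; case/eqP: nPS; apply/eqP; rewrite eqEcard sPS E leqnn.
Qed.

(** Moved into [T], each group is the centralizer in [T] of an involution. By
    [three_small_cent1_2group] two of these involutions are conjugate in [T]; the corresponding
    groups are conjugate in [G], hence equal by [nonSylow_conj]. *)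
Lemma nonSylow_small P1 P2 P3 :
    [/\ max_inv3' G x 2 P1, max_inv3' G x 2 P2 & max_inv3' G x 2 P3] ->
    [/\ #|P1| = 4, #|P2| = 4 & #|P3| = 4] ->
  [|| P1 :==: P2, P1 :==: P3 | P2 :==: P3].
Proof.
case=> max1 max2 max3 [o1 o2 o3].
have nt P : #|P| = 4 -> P :!=: 1 by move=> o; rewrite -cardG_gt1 o.
have [/and3P[sP1 n1 _] p1 _] := max_inv3P max1.
have [T sylT sT1] := Sylow_superset sP1 p1.
have pT := pHall_pgroup sylT; have sTG := pHall_sub sylT.
have T4 : 4 < #|T|.
  rewrite -o1; apply: proper_card; rewrite properEneq sT1 andbT.
  by have := nonSylow_neq max1 sylT (group1 G); rewrite conjsg1.
have [z Zz oz] := center_involution (nt _ o1) sylT sT1.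
have ntz : z != 1 by rewrite -order_gt1 oz.
have ex P : max_inv3' G x 2 P -> #|P| = 4 -> exists v, exists2 g, g \in G &
    [/\ v \in T, v ^+ 2 = 1 & 'C_T[v] = P :^ g].
  move=> maxP oP; have [/and3P[sPG nPx _] pP _] := max_inv3P maxP.
  have [g Gg sPT] := Sylow_Jsub sylT sPG pP.
  have ntPg : P :^ g != 1 by rewrite -cardG_gt1 cardJg oP.
  have Cv := cent1_conj_center (selfcent3J sc Gg) (max_inv3J Gg maxP) ntPg sylT sPT Zz ntz.
  exists (z ^ (x ^ g)), g => //; split=> //; last by rewrite -conjXg -oz expg_order conj1g.
  have zP := subsetP (max_inv3_center (selfcent3J sc Gg) (max_inv3J Gg maxP) ntPg sylT sPT) z Zz.
  by apply: (subsetP sPT); rewrite memJ_norm // normJ memJ_conjg.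
have [v1 [g1 G1 [T1 s1 C1]]] := ex _ max1 o1.
have [v2 [g2 G2 [T2 s2 C2]]] := ex _ max2 o2.
have [v3 [g3 G3 [T3 s3 C3]]] := ex _ max3 o3.
have cj P Q v w g h : max_inv3' G x 2 P -> #|P| = 4 -> max_inv3' G x 2 Q ->
    g \in G -> h \in G -> 'C_T[v] = P :^ g -> 'C_T[w] = Q :^ h -> w \in v ^: T ->
    Q :=: P.
  move=> maxP oP maxQ Gg Gh Cv Cw /imsetP[k Tk wE].
  apply: (nonSylow_conj maxP (nt _ oP) maxQ (g := g * k * h^-1)).
    by rewrite !groupM ?groupV // (subsetP sTG).
  rewrite 2!conjsgM; apply: (canRL (conjsgK h)); rewrite -Cw -Cv wE.
  by rewrite conjIg -normJ conjg_set1 conjGid.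
have := three_small_cent1_2group pT T4 (And3 T1 T2 T3) (And3 s1 s2 s3).
rewrite C1 C2 C3 !cardJg => /(_ (And3 o1 o2 o3)).
case/or3P=> V; [rewrite (cj P2 P1 v2 v1 g2 g1) | rewrite (cj P3 P1 v3 v1 g3 g1) |
  rewrite (cj P3 P2 v3 v2 g3 g2)]; by rewrite // eqxx ?orbT.
Qed.

End Global.

End TwoInvariant.

(** * Counting the invariant union *)

Section CountMaximal.

Variables (gT : finGroupType) (G : {group gT}) (x t : gT).
Hypotheses (sc : selfcent3 G x) (Gt : t \in G) (xt : x ^ t = x^-1).
Implicit Types (P Q U V W : {group gT}) (a y : gT).

Definition max_non2 := [set U : {group gT} | maximal_inv3 x G U && ~~ 2.-group U].
Definition inv3set2 := [set a in inv3set G x | 2.-elt a].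

Local Notation k U := #|'O_2(U)|.
Local Notation h U := #|'O_2^'(U)|.

Lemma max_non2P U : U \in max_non2 ->
  [/\ maximal_inv3 x G U, inv3' G x U, nilpotent U & #|U| = (k U * h U)%N].
Proof.
rewrite inE => /andP[maxU _]; have [iU _] := maximal_inv3P maxU.
have [nilU _] := fpf3_class2 (inv3_fpf sc iU); split=> //.
by rewrite (dprod_card (nilpotent_pcoreC 2 nilU)).
Qed.

Lemma inv3_norm_t W : inv3' G x W -> inv3' G x (W :^ t).
Proof.
case/and3P=> sWG nWx W3; rewrite /inv3' conj_subG // pgroupJ W3 andbT.
have : x^-1 ^ t \in 'N(W) :^ t by rewrite memJ_conjg groupV.
by rewrite normJ conjVg xt invgK.
Qed.

Lemma odd_core_h U : U \in max_non2 -> [/\ odd (h U), h U %% 3 = 1%N & 6 < h U].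
Proof.
move=> MU; have [maxU iU nilU _] := max_non2P MU.
have iO := inv3_char iU (pcore_char 2^' U).
have h3 := inv3_card sc iO.
have oddh : odd (h U) by rewrite odd_2'nat; apply: pcore_pgroup.
have h1 : 1 < h U.
  rewrite cardG_gt1; apply: contraTneq MU => O1; rewrite inE negb_and negbK.
  apply/orP; right; rewrite -(dprodW (nilpotent_pcoreC 2 nilU)) O1 mulg1.
  exact: pcore_pgroup.
split=> //; move: h3 oddh h1; move: (h U) => n.
by clear; case: n => [|[|[|[|[|[|[|n]]]]]]].
Qed.

Lemma dvd_h_prime U p : U \in max_non2 -> prime p -> p %| h U ->
  odd p /\ 'O_p(U) != 1.
Proof.
move=> MU pr dv; have [_ _ nilU _] := max_non2P MU; have [oddh _ _] := odd_core_h MU.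
split; first exact: dvdn_odd dv oddh.
have [y Oy oy] := Cauchy pr dv.
apply/eqP=> O1; have : y \in 'O_p(U).
  rewrite -cycle_subG (sub_Hall_pcore (nilpotent_pcore_Hall _ nilU)).
    by rewrite /pgroup -orderE oy pnat_id.
  by rewrite cycle_subG (subsetP (pcore_sub 2^' U)).
rewrite O1 => /set1P y1; have := prime_gt1 pr.
by rewrite -oy y1 order1.
Qed.

Lemma max_non2_core U p : U \in max_non2 -> odd p -> 'O_p(U) != 1 ->
  U :=: 'O_3^'('N_G('O_p(U))).
Proof.
move=> MU oddp ntO; have [maxU iU nilU _] := max_non2P MU.
have maxp := maximal_pcore_max sc maxU oddp ntO.
have sU := max_inv3_maximal sc maxp ntO iU (pcore_sub _ _).
have [_ mU] := maximal_inv3P maxU; apply/esym/mU => //.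
exact: inv3_sub (inv3_core (max_inv3_norm sc maxp)) (subsetIl _ _).
Qed.

Lemma max_non2J U : U \in max_non2 -> (U :^ t)%G \in max_non2.
Proof.
rewrite !inE pgroupJ => /andP[maxU -> //]; rewrite andbT.
have [iU mU] := maximal_inv3P maxU.
apply/maxgroupP; split=> [|H iH sUH]; first exact: inv3_norm_t.
have xtV : x ^ t^-1 = x^-1 by apply: (canLR (conjgK _)); rewrite conjVg xt invgK.
have iH' : inv3' G x (H :^ t^-1).
  have /and3P[sHG nHx H3] := iH.
  rewrite /inv3' conj_subG ?groupV // pgroupJ H3 andbT.
  have : x^-1 ^ t^-1 \in 'N(H) :^ t^-1 by rewrite memJ_conjg groupV.
  by rewrite normJ conjVg xtV invgK.
rewrite /=; have <- : H :^ t^-1 = U by apply: mU iH' _; rewrite /= -sub_conjg.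
by rewrite conjsgKV.
Qed.

(** For a common prime [p], ['O_p(U)] and ['O_p(V)] are invariant Sylow subgroups, so they are equal
    or related by [t]; and each of [U], [V] is the 3'-core of the normalizer of its p-part. *)
Lemma max_non2_pair U V : U \in max_non2 -> V \in max_non2 ->
  ~~ coprime (h U) (h V) -> V :=: U \/ V :=: U :^ t.
Proof.
move=> MU MV; rewrite /coprime => nco.
have [oddh _ h7] := odd_core_h MU.
have gt1 : 1 < gcdn (h U) (h V).
  by rewrite ltn_neqAle eq_sym nco gcdn_gt0 (leq_trans _ h7).
have [p pr dv] := pdivP gt1.
have [oddp ntU] := dvd_h_prime MU pr (dvdn_trans dv (dvdn_gcdl _ _)).
have [_ ntV] := dvd_h_prime MV pr (dvdn_trans dv (dvdn_gcdr _ _)).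
have [maxU _ _ _] := max_non2P MU; have [maxV _ _ _] := max_non2P MV.
have mU := maximal_pcore_max sc maxU oddp ntU.
have mV := maximal_pcore_max sc maxV oddp ntV.
have [/and3P[_ nU _] _ _] := max_inv3P mU; have [/and3P[_ nV _] _ _] := max_inv3P mV.
have := inv3_Sylow_pair sc Gt xt (max_inv3_Sylow sc mU ntU oddp)
  (max_inv3_Sylow sc mV ntV oddp) nU nV.
have dU := max_non2_core MU oddp ntU; have dV := max_non2_core MV oddp ntV.
case=> /= E; rewrite E in dV; [left | right]; first by rewrite dV -dU.
have NJ : 'N_G('O_p(U) :^ t) = 'N_G('O_p(U)) :^ t by rewrite conjIg (conjGid Gt) normJ.
by rewrite dV NJ pcoreJ -dU.
Qed.

(** A common element has a power of odd prime order [p], which lies in both ['O_p(U)] and ['O_p(V)].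
    By [max_inv3_TI] these coincide, and they determine [U] and [V]. *)
Lemma max_non2_disjoint U V : U \in max_non2 -> V \in max_non2 -> U != V ->
  [disjoint U :\: 'O_2(U) & V :\: 'O_2(V)].
Proof.
move=> MU MV neUV; rewrite -setI_eq0; apply/eqP/setP=> a; rewrite in_set0.
apply/negP=> /setIP[/setDP[Ua nOa] /setDP[Va _]]; case/eqP: neUV.
have [maxU _ nilU _] := max_non2P MU; have [maxV _ nilV _] := max_non2P MV.
have na2 : ~~ 2.-elt a.
  apply: contra nOa => a2; rewrite -cycle_subG.
  by rewrite (sub_Hall_pcore (nilpotent_pcore_Hall _ nilU)) ?cycle_subG.
have [p pr /andP[dv n2]] : exists2 p, prime p & (p %| #[a]) && (p != 2).
  move: na2; rewrite /p_elt /pnat order_gt0 /= => /allPn[p]; rewrite mem_primes.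
  by case/and3P=> pr _ dv; rewrite !inE => n2; exists p; rewrite ?dv.
have oddp : odd p by have := even_prime pr; case=> // E; rewrite E in n2.
have [y ay oy] := Cauchy pr dv.
have py : p.-group <[y]> by rewrite /pgroup -orderE oy pnat_id.
have mem W : nilpotent W -> a \in W -> y \in 'O_p(W).
  move=> nilW Wa; rewrite -cycle_subG (sub_Hall_pcore (nilpotent_pcore_Hall _ nilW)) //.
  by rewrite cycle_subG; apply: subsetP ay; rewrite cycle_subG.
have nty : y != 1 by rewrite -order_gt1 oy prime_gt1.
have nt W : nilpotent W -> a \in W -> 'O_p(W) != 1.
  by move=> nilW Wa; apply: contraNneq nty => O1; have := mem W nilW Wa; rewrite O1 => /set1P->.
have ntU := nt U nilU Ua; have ntV := nt V nilV Va.
have mU := maximal_pcore_max sc maxU oddp ntU.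
have mV := maximal_pcore_max sc maxV oddp ntV.
have eqO : 'O_p(U) = 'O_p(V).
  apply/eqP; apply: contraT => ne; have TI := max_inv3_TI sc Gt xt oddp mU mV ne.
  have : y \in 'O_p(U) :&: 'O_p(V) by rewrite inE !mem.
  by rewrite TI => /set1P E; rewrite E eqxx in nty.
apply/val_inj; rewrite /= (max_non2_core MU oddp ntU) eqO.
by rewrite -(max_non2_core MV oddp ntV).
Qed.

Lemma card_inv3set_sum :
  (#|inv3set G x| = #|inv3set2| + \sum_(U in max_non2) k U * (h U - 1))%N.
Proof.
have sS2 : inv3set2 \subset inv3set G x by apply/subsetP=> a; rewrite inE => /andP[].
rewrite -(cardsID inv3set2 (inv3set G x)) (setIidPr sS2); congr (_ + _)%N.
pose F U := if U \in max_non2 then U :\: 'O_2(U) else set0.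
have -> : inv3set G x :\: inv3set2 = \bigcup_U F U.
  apply/setP=> a; apply/setDP/bigcupP=> [[Sa nS2a]|[U _]].
    have [W iW Wa] := inv3setP _ _ _ Sa.
    have [U maxU sWU] := maximal_inv3_exists iW.
    have na2 : ~~ 2.-elt a by apply: contra nS2a => a2; rewrite inE Sa.
    have Ua := subsetP sWU a Wa; exists U => //; rewrite /F inE maxU.
    have -> /= : ~~ 2.-group U by apply: contra na2 => U2; apply: mem_p_elt U2 Ua.
    by rewrite inE Ua andbT; apply: contra na2 => /mem_p_elt; apply; apply: pcore_pgroup.
  rewrite /F; case: ifP => [MU /setDP[Ua nOa]|_]; last by rewrite in_set0.
  have [maxU iU nilU _] := max_non2P MU.
  have Sa : a \in inv3set G x by apply/inv3setP; exists U.
  split=> //; rewrite inE Sa; apply: contra nOa => a2.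
  by rewrite -cycle_subG (sub_Hall_pcore (nilpotent_pcore_Hall _ nilU)) ?cycle_subG.
rewrite -sum1_card partition_disjoint_bigcup => [|U V neUV]; last first.
  rewrite /F; case: ifP => MU; last by rewrite -setI_eq0 set0I.
  case: ifP => MV; last by rewrite -setI_eq0 setI0.
  exact: max_non2_disjoint.
rewrite [RHS]big_mkcond /=; apply: eq_bigr => U _; rewrite /F; case: ifP => MU.
  have [_ _ _ oU] := max_non2P MU; rewrite sum1_card.
  have := cardsID 'O_2(U) U; rewrite (setIidPr (pcore_sub _ _)) oU => E.
  by rewrite mulnBr muln1 -E addKn.
by rewrite big_set0.
Qed.

Definition h_values := undup [seq h U | U <- enum max_non2].
(** Grouping by the order of the odd part treats [U] and [U :^ t] together; distinct values are then
    coprime. *)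
Definition c_value v := (\sum_(U in max_non2 | h U == v) k U)%N.

Lemma sum_h_values :
  (\sum_(U in max_non2) k U * (h U - 1) = \sum_(v <- h_values) c_value v * (v - 1))%N.
Proof.
under [RHS]eq_bigr do rewrite /c_value big_distrl /=.
rewrite (exchange_big_dep (fun U => U \in max_non2)) /=; last by move=> v U _ /andP[].
apply: eq_bigr => U MU; rewrite MU /=.
rewrite -big_filter (@eq_filter _ _ (pred1 (h U))); last by move=> v /=; rewrite eq_sym.
rewrite filter_pred1_uniq ?undup_uniq ?big_seq1 //.
by rewrite mem_undup map_f // mem_enum.
Qed.

Lemma h_valuesP v : v \in h_values -> exists2 U, U \in max_non2 & h U = v.
Proof. by rewrite mem_undup => /mapP[U]; rewrite mem_enum => MU ->; exists U. Qed.

Lemma h_values_coprime : {in h_values &, forall v1 v2, v1 != v2 -> coprime v1 v2}.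
Proof.
move=> _ _ /h_valuesP[U MU <-] /h_valuesP[V MV <-]; apply: contraR => nco.
by have [->|->] := max_non2_pair MU MV nco; rewrite // pcoreJ cardJg.
Qed.

Lemma c_valueE U : U \in max_non2 ->
  c_value (h U) = (k U * (if U :^ t == U then 1 else 2))%N.
Proof.
move=> MU; have [_ _ h7] := odd_core_h MU.
have -> : c_value (h U) = (\sum_(V in [set U; (U :^ t)%G]) k V)%N.
  apply: eq_bigl => V; rewrite !in_set2; apply/andP/orP => [[MV /eqP hV]|].
    have nco : ~~ coprime (h U) (h V).
      by rewrite hV /coprime gcdnn neq_ltn (leq_trans _ h7) ?orbT.
    have [E|E] := max_non2_pair MU MV nco; [left | right]; exact/eqP/val_inj.
  case=> /eqP->; first by rewrite MU.
  by rewrite max_non2J // pcoreJ cardJg.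
case: ifP => [/eqP E|/negbT ne].
  have -> : (U :^ t)%G = U by apply: val_inj.
  by rewrite setUid big_set1 muln1.
rewrite big_setU1 /= ?big_set1 ?pcoreJ ?cardJg ?muln2 ?addnn // inE.
by apply: contra ne => /eqP E; rewrite {2}E.
Qed.

End CountMaximal.

(** * Classification when the 3'-core is trivial *)

Lemma pow2_mod3 n q : q = (2 ^ n)%N -> q %% 3 = 1%N ->
  [\/ q = 1, q = 4, q = 16 | 64 <= q]%N.
Proof.
case: n => [|[|[|[|[|[|n]]]]]] -> //= m3;
  [exact: Or41|exact: Or42|exact: Or43|apply: Or44].
by rewrite !expnS; have := expn_gt0 2 n => /=; lia.
Qed.

Lemma dvdn4_mod3 n d : d %% 3 = 1%N -> n %% 3 = 1%N -> d < n ->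
  n %| 4 * d -> d %| n -> 4 * d <= n.
Proof.
move=> d3 n3 ltdn /dvdnP[k kE] /dvdnP[j jE]; rewrite jE in n3 kE ltdn *.
have d0 : 0 < d by case: d ltdn {d3 n3 kE jE} => //; rewrite muln0.
have k4 : (k * j = 4)%N by apply/eqP; rewrite -(eqn_pmul2r d0) -mulnA kE.
have j3 : (j %% 3 = 1)%N by move: n3; rewrite -modnMmr d3 muln1.
rewrite leq_pmul2r //; rewrite -[X in X < _]mul1n ltn_pmul2r // in ltdn.
by case: j k4 j3 ltdn {jE n3 kE} => [|[|[|[|j]]]].
Qed.

Lemma double_pair_card q d h A : d <= q -> 0 < h ->
  (q + q - d + (q * 2 * (h - 1) + A) = 2 * (q * h) - d + A)%N.
Proof. by move=> dq; case: h => // h _; rewrite subSS subn0; nia. Qed.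

Lemma mod3_4_ge16 q h : [\/ q = 4, q = 16 | 64 <= q] -> h = 1%N \/ 7 <= h ->
  (q * h = 4)%N \/ 16 <= q * h.
Proof. by case=> ?; case=> ?; nia. Qed.

Lemma inv3_2group_card (gT : finGroupType) (G W : {group gT}) x :
    selfcent3 G x -> inv3' G x W -> 2.-group W ->
  [\/ #|W| = 1, #|W| = 4, #|W| = 16 | 64 <= #|W|]%N.
Proof.
move=> sc iW W2; have [n e] := p_natP W2.
exact: pow2_mod3 e (inv3_card sc iW).
Qed.

(** The cofactor [r] is the unknown rest of the order, prime to 6 because full Sylow 2- and 3-parts
    are split off. *)
Lemma selfcent3_card_factor (gT : finGroupType) (G T : {group gT}) x (s : seq nat) :
    selfcent3 G x -> 2.-Sylow(G) T -> uniq s ->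
    {in s &, forall v w, v != w -> coprime v w} -> {in s, forall v, v %| #|G|} ->
    {in s, forall v, v %% 6 = 1%N} ->
  exists2 r, #|G| = (3 * #|T| * \prod_(v <- s) v * r)%N & odd r /\ r %% 3 <> 0%N.
Proof.
move=> sc sylT us co dv m6; have dvP := prod_coprime_dvdn us co dv.
have oT : #|T| = (#|G|`_2)%N := card_Hall sylT.
have o3 : (#|G|`_3)%N = 3.
  rewrite -(card_Hall (selfcent3_Sylow sc)) -orderE.
  by case/and3P: sc => _ /eqP.
have co6 : coprime 6 (\prod_(v <- s) v).
  rewrite big_seq; elim/big_ind: _ => [|b c cb cc|v sv]; first exact: coprimen1.
    by rewrite coprimeMr cb.
  by rewrite -coprime_modr m6.
have co2P : coprime 2 (\prod_(v <- s) v) by move: co6; rewrite -[6]/(2 * 3)%N coprimeMl => /andP[].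
have co3P : coprime 3 (\prod_(v <- s) v) by move: co6; rewrite -[6]/(2 * 3)%N coprimeMl => /andP[].
have cT3 : coprime 3 #|T|.
  by rewrite oT p_part coprimeXr.
have dT : #|T| %| #|G| by rewrite oT dvdn_part.
have d3 : 3 %| #|G| by rewrite -{1}o3 dvdn_part.
have d : 3 * #|T| * \prod_(v <- s) v %| #|G|.
  rewrite !Gauss_dvd ?d3 ?dT //; rewrite coprimeMl co3P.
  by rewrite oT p_part coprimeXl.
have [r nE] := dvdnP d; exists r; first by rewrite mulnC.
split.
  apply: contraT; rewrite -dvdn2 => /dvdnP[r' rE].
  have : 2 * #|T| %| #|G| by rewrite nE rE; apply/dvdnP; exists (r' * 3 * \prod_(v <- s) v)%N; lia.
  by rewrite oT p_part -expnS pfactor_dvdn ?cardG_gt0 // ltnn.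
move=> r3; have /dvdnP[r' rE] : 3 %| r by rewrite /dvdn r3.
have : 3 ^ 2 %| #|G| by rewrite nE rE; apply/dvdnP; exists (r' * #|T| * \prod_(v <- s) v)%N; lia.
rewrite pfactor_dvdn ?cardG_gt0 // => l2; have := o3.
rewrite p_part; case: (logn 3 _) l2 => [|[|e]] // _.
by rewrite !expnS; have := expn_gt0 3 e; lia.
Qed.

Section FinalCount.

Variables (gT : finGroupType) (G : {group gT}) (x t : gT).
Hypotheses (sc : selfcent3 G x) (Gt : t \in G) (t2 : #[t] = 2) (xt : x ^ t = x^-1).
Hypothesis (core1 : 'O_3^'(G) = 1).
Hypotheses (w1 : #|G| < 9 * #|inv3set G x|) (w2 : 60 * #|inv3set G x| <= 7 * #|G|).
Implicit Types (P Q U V W S T : {group gT}).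

Lemma inv3set2P a : a \in inv3set2 G x -> a != 1 ->
  exists P, [/\ max_inv3' G x 2 P, P != 1%G & a \in P].
Proof.
rewrite inE => /andP[/inv3setP[W iW Wa] a2] nta.
have [nilW _] := fpf3_class2 (inv3_fpf sc iW).
have Oa : a \in 'O_2(W).
  by rewrite -cycle_subG (sub_Hall_pcore (nilpotent_pcore_Hall _ nilW)) ?cycle_subG.
have [P maxP sOP] := max_inv3_exists (inv3_char iW (pcore_char 2 W)) (pcore_pgroup _ _).
have Pa := subsetP sOP a Oa; exists P; split=> //.
by apply: contraNneq nta => P1; rewrite P1 in Pa; case/set1P: Pa => ->.
Qed.

Lemma max_sub_inv3set2 P : max_inv3' G x 2 P -> P \subset inv3set2 G x.
Proof.
case/max_inv3P=> iP P2 _; apply/subsetP=> a Pa; rewrite inE (mem_p_elt P2 Pa) andbT.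
by apply/inv3setP; exists P.
Qed.

Lemma inv3set2_1 : 1 \in inv3set2 G x.
Proof.
have i1 : inv3' G x 1 by apply: inv3S (inv3_core sc) (sub1G _) _; rewrite norm1 inE.
have [P maxP _] := max_inv3_exists i1 (pgroup1 _ 2).
exact: subsetP (max_sub_inv3set2 maxP) _ (group1 P).
Qed.

Lemma max_non2_pcore2 U : U \in max_non2 G x ->
  'O_2(U) = 1 \/ max_inv3' G x 2 'O_2(U) /\ 'O_2(U) != 1.
Proof.
move=> MU; have [maxU _ _ _] := max_non2P sc MU; have [_ _ h7] := odd_core_h sc MU.
have [->|ntO] := eqVneq 'O_2(U) 1; [by left | right; split=> //].
have h1 : 1 < #|'O_2^'(U)| by apply: leq_trans h7.
have [oddp ntp] := dvd_h_prime sc MU (pdiv_prime h1) (pdiv_dvd _).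
exact: maximal_2core_max sc maxU oddp ntp ntO.
Qed.

Lemma h_values_gt6 : {in h_values G x, forall v, 6 < v}.
Proof. by move=> v /h_valuesP[U MU <-]; have [] := odd_core_h sc MU. Qed.

Lemma h_values_mod6 : {in h_values G x, forall v, v %% 6 = 1%N}.
Proof.
move=> v /h_valuesP[U MU <-]; have [] := odd_core_h sc MU.
by move: (#|_|) => h; lia.
Qed.

Lemma h_values_dvd : {in h_values G x, forall v, v %| #|G|}.
Proof.
move=> v /h_valuesP[U MU <-]; have [_ /and3P[sUG _ _] _ _] := max_non2P sc MU.
by rewrite cardSg // (subset_trans (pcore_sub _ _)).
Qed.

Lemma h_values_uniq : uniq (h_values G x).
Proof. exact: undup_uniq. Qed.

Lemma even_Sylow T : 2.-Sylow(G) T -> ~~ odd #|T|.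
Proof.
move=> sylT; rewrite -dvdn2 (card_Hall sylT).
have : 2 %| #|G| by rewrite -t2 order_dvdG.
rewrite -{1}[2]expn1 (pfactor_dvdn _ (isT : prime 2)) ?cardG_gt0 //.
by rewrite p_part; case: (logn 2 _) => // e _; rewrite expnS dvdn_mulr.
Qed.

Lemma c_value12 U : U \in max_non2 G x -> 'O_2(U) = 1 ->
  c_value G x #|'O_2^'(U)| = 1%N \/ c_value G x #|'O_2^'(U)| = 2.
Proof.
move=> MU O1; rewrite (c_valueE sc Gt xt MU) O1 cards1.
by case: ifP; [left|right].
Qed.

Lemma exists_inv3_2group : exists2 W, inv3' G x W & 2.-group W /\ W != 1%G.
Proof.
have [/existsP[W /and3P[iW W2 nt]]|] := boolP [exists W : {group gT}, [&& inv3' G x W, 2.-group W & W != 1%G]].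
  by exists W.
move/existsPn=> no2; exfalso.
have no W : inv3' G x W -> 2.-group W -> W :=: 1.
  move=> iW W2; have := no2 W; rewrite iW W2 /= negbK => /eqP->; by [].
have s2 : inv3set2 G x = [set 1].
  apply/setP=> a; apply/idP/set1P=> [Sa|->]; last exact: inv3set2_1.
  apply/eqP; apply: contraT => nta; have [P [maxP ntP _]] := inv3set2P Sa nta.
  by have [iP P2 _] := max_inv3P maxP; case/eqP: ntP; apply/val_inj/no.
have c12 : {in h_values G x, forall v, c_value G x v = 1%N \/ c_value G x v = 2}.
  move=> v /h_valuesP[U MU <-]; apply: c_value12 => //.
  have [//|[maxO ntO]] := max_non2_pcore2 MU.
  by have [iO O2 _] := max_inv3P maxO; case/eqP: ntO; apply: no iO O2.
have [T sylT] := Sylow_exists 2 G.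
have [r nE _] := selfcent3_card_factor sc sylT h_values_uniq
  (h_values_coprime sc Gt xt) h_values_dvd h_values_mod6.
have := even_Sylow sylT; rewrite -dvdn2 => /dvdnP[m mE].
apply: (window_no2 (r := (m * r)%N) h_values_gt6 c12 _ _ w1 w2).
  by rewrite (card_inv3set_sum sc Gt xt) sum_h_values s2 cards1.
by rewrite nE mE; lia.
Qed.

Lemma h_value_dvd U : inv3' G x U -> #|'O_2^'(U)| %| #|G|.
Proof. by case/and3P=> sUG _ _; rewrite cardSg // (subset_trans (pcore_sub _ _)). Qed.

Lemma inv_Sylow_max T : 2.-Sylow(G) T -> x \in 'N(T) ->
  [/\ inv3' G x T, T != 1%G & max_inv3' G x 2 T].
Proof.
move=> sylT nTx; have sTG := pHall_sub sylT; have T2 := pHall_pgroup sylT.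
have iT : inv3' G x T by rewrite /inv3' sTG nTx /=; apply: pi_pnat T2 _.
split=> //; first by apply: contraNneq (even_Sylow sylT) => ->; rewrite cards1.
apply/maxgroupP; split=> [|H /andP[/and3P[sHG _ _] H2] sTH]; first by rewrite iT.
exact: sub_pHall sylT H2 sTH sHG.
Qed.

Lemma inv_Sylow_maxE T P : 2.-Sylow(G) T -> x \in 'N(T) ->
  max_inv3' G x 2 P -> P != 1%G -> P :=: T \/ P :=: T :^ t.
Proof.
move=> sylT nTx maxP ntP; have [/and3P[sPG nPx _] P2 _] := max_inv3P maxP.
have [S sylS sPS] := Sylow_superset sPG P2.
have PS := max_inv3_of_inv_Sylow sc maxP ntP sylS sPS sylT nTx.
rewrite PS in nPx *; exact: inv3_Sylow_pair sc Gt xt sylT sylS nTx nPx.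
Qed.

Lemma inv_Sylow_inv3set2 T : 2.-Sylow(G) T -> x \in 'N(T) ->
  inv3set2 G x = T :|: T :^ t.
Proof.
move=> sylT nTx; have [iT ntT maxT] := inv_Sylow_max sylT nTx.
apply/setP=> a; apply/idP/setUP=> [Sa|[Ta|Ta]].
- have [->|nta] := eqVneq a 1; first by left; apply: group1.
  have [P [maxP ntP Pa]] := inv3set2P Sa nta.
  by have [E|E] := inv_Sylow_maxE sylT nTx maxP ntP; [left|right]; rewrite -E.
- exact: subsetP (max_sub_inv3set2 maxT) _ Ta.
have Tt2 : 2.-group (T :^ t) by rewrite pgroupJ (pHall_pgroup sylT).
rewrite inE (mem_p_elt Tt2 Ta) andbT.
by apply/inv3setP; exists (T :^ t)%G => //; apply: inv3_norm_t.
Qed.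

(** For the last clause: a nontrivial ['O_2(U)] is [T] or [T :^ t], so [U] or [U :^ t] is [U0]. *)
Lemma inv_Sylow_core T (U0 := 'O_3^'('N_G(T))%G) :
    2.-Sylow(G) T -> x \in 'N(T) ->
  [/\ maximal_inv3 x G U0, 'O_2(U0) = T, (U0 :^ t == U0) = (T :^ t == T),
      U0 \in max_non2 G x \/ #|'O_2^'(U0)| = 1%N
    & forall U, U \in max_non2 G x -> 'O_2(U) != 1 -> #|'O_2^'(U)| = #|'O_2^'(U0)|].
Proof.
move=> sylT nTx; have [iT ntT maxT] := inv_Sylow_max sylT nTx.
have sT := max_inv3_maximal sc maxT ntT.
have iU0 : inv3' G x U0 := inv3_sub (inv3_core (max_inv3_norm sc maxT)) (subsetIl _ _).
have sTU0 : T \subset U0 by apply: sT.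
have maxU0 : maximal_inv3 x G U0.
  apply/maxgroupP; split=> // H iH sUH; apply/eqP; rewrite eqEsubset sUH andbT.
  by apply: sT iH (subset_trans sTU0 sUH).
have sU0G : U0 \subset G by case/and3P: iU0.
have O2 : 'O_2(U0) = T.
  apply: (sub_pHall sylT (pcore_pgroup _ _)); last exact: subset_trans (pcore_sub _ _) sU0G.
  apply: pcore_max; first exact: pHall_pgroup sylT.
  by rewrite /normal sTU0 (subset_trans (pcore_sub _ _)) ?subsetIr.
have nonU0 : U0 \in max_non2 G x \/ #|'O_2^'(U0)| = 1%N.
  rewrite inE maxU0 /=; have [U2|] := boolP (2.-group U0); [right | by left].
  exact: pnat_1 (pgroupS (pcore_sub _ _) U2) (pcore_pgroup _ _).
split=> //.
  apply/eqP/eqP=> E; first by rewrite -O2 -pcoreJ E.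
  have NJ : 'N_G(T) :^ t = 'N_G(T :^ t) by rewrite conjIg (conjGid Gt) normJ.
  by rewrite /= -pcoreJ NJ E.
move=> U MU ntO; have [O1|[maxO _]] := max_non2_pcore2 MU; first by rewrite O1 eqxx in ntO.
have key V : V \in max_non2 G x -> 'O_2(V) = T -> V :=: U0.
  move=> MV OV; have [maxV iV _ _] := max_non2P sc MV; have [_ mV] := maximal_inv3P maxV.
  have sVU0 : V \subset U0 by apply: sT iV _; rewrite -OV pcore_sub.
  by rewrite -(mV U0 iU0 sVU0).
have ntO' : 'O_2(U)%G != 1%G by apply: contraNneq ntO => /(congr1 val) /= ->.
have [/= OT|/= OT] := inv_Sylow_maxE sylT nTx maxO ntO'; first by rewrite (key U MU OT).
have MUt := max_non2J Gt xt MU.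
have tt : t * t = 1 by rewrite -[t * t]/(t ^+ 2) -t2 expg_order.
rewrite -(key _ MUt) /= ?pcoreJ ?cardJg // OT -conjsgM tt conjsg1.
by [].
Qed.

(** ['N_W(D)] is invariant and larger than [D]; its index over [D] divides 4 and is 1 modulo 3,
    hence is 4. *)
Lemma inv3_index4_norm W D : inv3' G x W -> inv3' G x D -> D \subset W ->
  #|W| = (4 * #|D|)%N -> W \subset 'N(D).
Proof.
move=> iW iD sDW oW; have nDx : x \in 'N(D) by case/and3P: iD.
have pD : D \proper W.
  by rewrite properEcard sDW oW; have := cardG_gt0 D; lia.
have [iN pN] := proper_norm_in sc iW pD nDx.
suff <- : 'N_W(D) = W by apply: subsetIr.
apply/eqP; rewrite eqEcard subsetIl /=.
have := cardSg (proper_sub pN); have := cardSg (subsetIl W 'N(D)).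
have := proper_card pN; have := inv3_card sc iN; have := inv3_card sc iD.
rewrite /= oW; exact: dvdn4_mod3.
Qed.

Lemma inv_Sylow_count T : 2.-Sylow(G) T -> x \in 'N(T) -> #|G| = 60 /\ #|T| = 4.
Proof.
move=> sylT nTx; have [iT ntT maxT] := inv_Sylow_max sylT nTx.
have [maxU0 O2U0 eqt nonU0 hU] := inv_Sylow_core sylT nTx.
have s2 := inv_Sylow_inv3set2 sylT nTx.
move: 'O_3^'('N_G(T))%G maxU0 O2U0 eqt nonU0 hU => U0 maxU0 O2U0 eqt nonU0 hU.
have iU0 : inv3' G x U0 by have [] := maximal_inv3P maxU0.
set h0 := #|'O_2^'(U0)| in nonU0 hU.
pose s := [seq v <- h_values G x | v != h0].
have sub : {subset s <= h_values G x} by move=> v; rewrite mem_filter => /andP[].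
have gt6 : {in s, forall v, 6 < v} by move=> v /sub; apply: h_values_gt6.
have mod6 : {in s, forall v, v %% 6 = 1}%N by move=> v /sub; apply: h_values_mod6.
have hM : U0 \in max_non2 G x -> h0 \in h_values G x.
  by move=> MU; rewrite mem_undup map_f ?mem_enum.
have c12 : {in s, forall v, c_value G x v = 1%N \/ c_value G x v = 2}.
  move=> v; rewrite mem_filter => /andP[nev /h_valuesP[U MU hv]].
  rewrite -hv in nev *; apply: c_value12 => //; apply/eqP; apply: contraR nev => ntO.
  by rewrite (hU U MU ntO).
have co : {in s, forall v, coprime v h0}.
  move=> v; rewrite mem_filter => /andP[nev vh].
  case: nonU0 => [MU|->]; last exact: coprimen1.
  exact: (h_values_coprime sc Gt xt) vh (hM MU) nev.
have h06 : (h0 %% 6 = 1)%N.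
  by case: nonU0 => [MU|->]; [apply/h_values_mod6/hM | ].
have h0C : h0 = 1%N \/ 7 <= h0 by case: nonU0 => [MU|->]; [right; apply/h_values_gt6/hM | left].
(* [h0] is prepended even when it is 1, that is when [U0] is a 2-group; a factor 1 is harmless. *)
have [r nE [odr r3]] : exists2 r, #|G| = (3 * #|T| * \prod_(v <- h0 :: s) v * r)%N & odd r /\ r %% 3 <> 0%N.
  apply: (selfcent3_card_factor sc sylT).
  - by rewrite /= mem_filter eqxx filter_uniq ?h_values_uniq.
  - move=> v w; rewrite !inE => /predU1P[->|sv] /predU1P[->|sw]; rewrite ?eqxx //.
    + by move=> _; rewrite coprime_sym co.
    + by move=> _; rewrite co.
    exact: (h_values_coprime sc Gt xt) (sub _ sv) (sub _ sw).
  - move=> v; rewrite inE => /predU1P[->|/sub]; last exact: h_values_dvd.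
    exact: h_value_dvd.
  by move=> v; rewrite inE => /predU1P[->|/mod6].
have nE' : #|G| = (3 * (#|T| * h0) * \prod_(v <- s) v * r)%N.
  by rewrite nE big_cons !mulnA.
pose e := if T :^ t == T then 1%N else 2.
have sumE : (\sum_(U in max_non2 G x) #|'O_2(U)| * (#|'O_2^'(U)| - 1) =
    #|T| * e * (h0 - 1) + \sum_(v <- s) c_value G x v * (v - 1))%N.
  rewrite sum_h_values /s big_filter; case: nonU0 => [MU|h1].
    rewrite (bigD1_seq h0) ?h_values_uniq ?hM //=; congr (_ + _)%N.
    by rewrite (c_valueE sc Gt xt MU) O2U0 eqt.
  rewrite h1 subnn muln0 add0n -[RHS]big_filter; congr bigop; apply/esym/all_filterP/allP.
  by move=> v /h_values_gt6; case: v => [|[|v]].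
have SE := card_inv3set_sum sc Gt xt; rewrite s2 sumE in SE.
have T4 : [\/ #|T| = 4, #|T| = 16 | 64 <= #|T|]%N.
  have T1 : #|T| != 1%N by rewrite -trivg_card1 -[1]/(val 1%G) val_eqE.
  have [q1|||] := inv3_2group_card sc iT (pHall_pgroup sylT); first by rewrite q1 in T1.
  - exact: Or31.
  - exact: Or32.
  exact: Or33.
have [Tt|neT] := eqVneq (T :^ t) T.
  exfalso; rewrite /e Tt eqxx setUid muln1 in SE.
  apply: (window_Sylow1 (x := (#|T| * h0)%N) gt6 mod6 c12 _ _ nE' odr w1 w2).
    exact: mod3_4_ge16 T4 h0C.
  rewrite SE addnA -[X in (X + _ + _)%N]muln1 -mulnDr subnKC //.
  by case: h0C => [->|] //; apply: leq_trans.
pose D := (T :&: T :^ t)%G.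
have iTt := inv3_norm_t Gt xt iT.
have nDx : x \in 'N(D).
  have /and3P[_ nTtx _] := iTt; rewrite inE conjIg.
  by rewrite (normP nTx) (normP nTtx).
have iD : inv3' G x D by apply: inv3S iT (subsetIl _ _) nDx.
have oD := Lagrange (subsetIl T (T :^ t)).
have d3 := inv3_card sc iD; have q3 := inv3_card sc iT.
have i3 : (#|T : D| %% 3 = 1)%N by move: q3; rewrite -oD -modnMml d3 mul1n.
have [k kE] : {k | #|T : D| = 2 ^ k}%N.
  by apply: p_natP; apply: pnat_dvd (dvdn_indexg _ _) (pHall_pgroup sylT).
have i4 : #|T : D| = 4 \/ 16 <= #|T : D|.
  have [i1||->|i64] := pow2_mod3 kE i3; [|by left|by right|by right; apply: leq_trans i64].
  case/eqP: neT; apply/eqP; rewrite eq_sym eqEcard cardJg leqnn andbT.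
  by move/eqP: i1; rewrite indexg_eq1 subsetI => /andP[].
have T4' : #|T| = 4 \/ #|T| = 16 \/ 64 <= #|T| by case: T4; auto.
have [nq i4E] : #|G| = (15 * #|T|)%N /\ #|T : D| = 4.
  apply: (window_Sylow2 (d := #|D|) gt6 mod6 c12 h06 (esym oD) i4 T4' co _ nE' odr r3 w1 w2).
  rewrite SE /e (negPf neT) cardsU cardJg.
  have : #|D| <= #|T| by rewrite subset_leq_card ?subsetIl.
  have : 0 < h0 by case: h0C => [->|] //; apply: leq_trans.
  by move=> h1 dq; apply: double_pair_card.
have oTD : #|T| = (4 * #|D|)%N by rewrite -oD i4E mulnC.
have nDT := inv3_index4_norm iT iD (subsetIl _ _) oTD.
have nDTt : T :^ t \subset 'N(D).
  by apply: inv3_index4_norm iTt iD (subsetIr _ _) _; rewrite cardJg.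
(* [T], [T :^ t] and [x] normalize [D], so the order of ['N_G(D)] is a multiple of 3 |T| dividing 15
   |T|. The smaller value would make [T] normal there and contain [T :^ t]; so [D] is normal in [G],
   and the trivial core kills it. *)
suff D1 : D :=: 1 by rewrite nq oTD D1 cards1.
have sTG := pHall_sub sylT; have Gx : x \in G by case/and3P: sc.
have sDG : D \subset G := subset_trans (subsetIl _ _) sTG.
suff nDG : G \subset 'N(D).
  by apply/trivgP; rewrite -core1 pcore_max ?/normal ?sDG //; case/and3P: iD.
have sMG : 'N_G(D) \subset G := subsetIl _ _.
have sTM : T \subset 'N_G(D) by rewrite subsetI sTG.
have sXM : <[x]> \subset 'N_G(D) by rewrite cycle_subG inE Gx.
have ox : #|<[x]>| = 3 by rewrite -orderE; case/and3P: sc => _ /eqP.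
have nTX : <[x]> \subset 'N(T) by rewrite cycle_subG.
have oTX : #|T <*> <[x]>| = (#|T| * 3)%N.
  rewrite norm_joinEr // TI_cardMg ?ox // coprime_TIg // ox.
  by case/and3P: iT => _ _; rewrite coprime_sym; apply: p'nat_coprime; rewrite // pnat_id.
have sTXM : T <*> <[x]> \subset 'N_G(D) by rewrite join_subG sTM.
have := cardSg sTXM; have := cardSg sMG; rewrite nq oTX.
case/dvdnP=> j jE /dvdnP[m mE].
have jm : (j * m = 5)%N by apply/eqP; rewrite -(@eqn_pmul2r (#|T| * 3)) ?muln_gt0 ?cardG_gt0 // -mulnA -mE -jE mulnCA mulnC.
have [m1|m5] : m = 1%N \/ m = 5 by have /primeP[_ /(_ m)] : prime 5 by []; rewrite -jm dvdn_mull // jm => /(_ isT)/orP[]/eqP; [left|right].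
  have TXE : T <*> <[x]> = 'N_G(D).
    by apply/eqP; rewrite eqEcard sTXM oTX mE m1 mul1n leqnn.
  have nT : T <| 'N_G(D) by rewrite -TXE /normal joing_subl join_subG normG.
  have sylTM := pHall_subl sTM sMG sylT.
  have sTt : T :^ t \subset T.
    rewrite (sub_normal_Hall sylTM nT) ?pgroupJ ?(pHall_pgroup sylT) //.
    by rewrite subsetI nDTt conj_subG.
  by case/eqP: neT; apply/eqP; rewrite eqEcard sTt cardJg leqnn.
have -> : G :=: 'N_G(D).
  apply/eqP; rewrite eq_sym eqEcard sMG nq mE m5 mulnC [X in _ <= X]mulnC -mulnA.
  exact: leqnn.
exact: subsetIr.
Qed.

Definition max2_order4 := [set P : {group gT} | max_inv3' G x 2 P && (#|P| == 4)].

Section NonSylow.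

Hypothesis noSyl : forall S, 2.-Sylow(G) S -> x \notin 'N(S).

Lemma max2_order4_cases :
  [\/ max2_order4 = set0, exists Q, max2_order4 = [set Q]
    | exists Q1 Q2, [/\ max2_order4 = [set Q1; Q2], Q1 != Q2,
        Q1 \in max2_order4 & Q2 \in max2_order4]].
Proof.
have [->|[Q1 M1]] := set_0Vmem max2_order4; first exact: Or31.
have [E|] := eqVneq max2_order4 [set Q1]; first by apply: Or32; exists Q1.
rewrite eqEsubset sub1set M1 andbT => /subsetPn[Q2 M2]; rewrite inE eq_sym => ne12.
apply: Or33; exists Q1, Q2; split=> //; apply/setP=> Q3; rewrite !inE.
apply/idP/orP=> [M3|[/eqP->|/eqP->]]; last first.
- by move: M2; rewrite inE.
- by move: M1; rewrite inE.
move: M1 M2; rewrite !inE => /andP[m1 /eqP o1] /andP[m2 /eqP o2].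
case/andP: M3 => m3 /eqP o3.
case/or3P: (nonSylow_small sc Gt xt noSyl (And3 m1 m2 m3) (And3 o1 o2 o3)).
- by move/eqP=> E; case/eqP: ne12; apply: val_inj.
- by move/eqP=> E; left; apply/eqP/val_inj.
by move/eqP=> E; right; apply/eqP/val_inj.
Qed.

Definition small2 := \bigcup_(Q in max2_order4) (Q : {set gT}).

(** Two such groups meet in an invariant subgroup whose order is a proper divisor of 4 and 1 modulo
    3, so 7 = 4 + 4 - 1. *)
Lemma card_small2 : [\/ small2 = set0, #|small2| = 4 /\ 1 \in small2
  | #|small2| = 7 /\ 1 \in small2].
Proof.
rewrite /small2; have [->|[Q E]|[Q1 [Q2 [E ne M1 M2]]]] := max2_order4_cases.
- by apply: Or31; rewrite big_set0.
- apply: Or32; rewrite E big_set1 group1; split=> //.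
  by have := set11 Q; rewrite -E inE => /andP[_ /eqP].
apply: Or33; rewrite E big_setU1 ?in_set1 // big_set1 in_setU group1; split=> //.
move: M1 M2; rewrite !inE => /andP[m1 /eqP o1] /andP[m2 /eqP o2].
have [i1 p1 _] := max_inv3P m1; have [i2 p2 mx2] := max_inv3P m2.
rewrite cardsU o1 o2 -/(gval (Q1 :&: Q2)%G).
have iD : inv3' G x (Q1 :&: Q2).
  apply: (inv3S i1 (subsetIl _ _)); have /and3P[_ n1 _] := i1; have /and3P[_ n2 _] := i2.
  by rewrite inE conjIg (normP n1) (normP n2).
have := inv3_card sc iD; have : #|Q1 :&: Q2| %| 4 by rewrite -o1 cardSg ?subsetIl.
have : #|Q1 :&: Q2| < 4.
  rewrite -o1 proper_card // properEneq subsetIl andbT.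
  apply: contra ne => /eqP/setIidPl sQ; apply/eqP/val_inj/eqP.
  by rewrite eqEcard sQ o1 o2.
by rewrite /=; move: #|_| => -[|[|[|[|d]]]].
Qed.

Lemma small2_sub : small2 \subset inv3set2 G x.
Proof. by apply/bigcupsP=> Q; rewrite inE => /andP[/max_sub_inv3set2]. Qed.

(** When ['O_2(U)] is nontrivial, [t] normalizes it and hence [U], the 3'-core of its normalizer; so
    the value is not doubled. *)
Lemma nonSylow_c_value v : v \in h_values G x ->
  [\/ c_value G x v = 1%N, c_value G x v = 2
    | exists U, [/\ U \in max_non2 G x, max_inv3' G x 2 'O_2(U), 'O_2(U)%G != 1%G
                  & c_value G x v = #|'O_2(U)|]].
Proof.
case/h_valuesP=> U MU <-; have [O1|[maxO ntO]] := max_non2_pcore2 MU.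
  by have [->|->] := c_value12 MU O1; [apply: Or31|apply: Or32].
have ntO' : 'O_2(U)%G != 1%G by apply: contraNneq ntO => /(congr1 val) /= ->.
apply: Or33; exists U; split=> //; rewrite (c_valueE sc Gt xt MU).
suff -> : U :^ t == U by rewrite muln1.
have nOt := nonSylow_norm_t sc Gt xt noSyl maxO ntO'.
have [maxU iU _ _] := max_non2P sc MU; have [_ mU] := maximal_inv3P maxU.
have UE : 'O_3^'('N_G('O_2(U))) = U.
  apply: (mU 'O_3^'('N_G('O_2(U)))%G).
    exact: inv3_sub (inv3_core (max_inv3_norm sc maxO)) (subsetIl _ _).
  by apply: (max_inv3_maximal sc maxO ntO' iU); apply: pcore_sub.
by rewrite -UE -pcoreJ conjIg (conjGid Gt) -normJ (normP nOt).
Qed.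

Lemma nonSylow_card T P : 2.-Sylow(G) T -> max_inv3' G x 2 P -> P != 1%G ->
  #|P| = 4 \/ 16 <= #|P| /\ #|T| = (2 * #|P|)%N.
Proof.
move=> sylT maxP ntP; have [iP P2 _] := max_inv3P maxP.
have [E|/eqP ne4] := eqVneq #|P| 4; [by left | right].
rewrite (nonSylow_big_card sc noSyl maxP ntP _ sylT); last exact/eqP.
split=> //; have [P1|//|->//|] := inv3_2group_card sc iP P2; last exact: leq_trans.
by case/eqP: ntP; apply/val_inj/card1_trivg.
Qed.

Lemma nonSylow_count :
  [/\ #|G| = 168, exists2 P, inv3' G x P & #|P| = 4
    & exists2 U, inv3' G x U & #|U| = 7].
Proof.
have [T sylT] := Sylow_exists 2 G.
have [r nE [odr r3]] := selfcent3_card_factor sc sylT h_values_uniq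
  (h_values_coprime sc Gt xt) h_values_dvd h_values_mod6.
have SE := card_inv3set_sum sc Gt xt; rewrite sum_h_values in SE.
have [/existsP[P /and3P[maxP ntP ne4]]|] :=
    boolP [exists P, [&& max_inv3' G x 2 P, P != 1%G & #|P| != 4]].
  exfalso; have [E|[P16 TP]] := nonSylow_card sylT maxP ntP; first by rewrite E in ne4.
  rewrite TP in nE; apply: (window_big h_values_gt6 _ P16 _ SE nE odr r3 w1 w2).
    move=> v /nonSylow_c_value[->|->|[U [_ maxO ntO ->]]]; try by left.
    have [->|neO] := eqVneq #|'O_2(U)| 4; [by left|right].
    by rewrite -/(gval 'O_2(U)%G) (nonSylow_big sc Gt xt noSyl maxO maxP ntO ntP neO ne4).
  have -> : inv3set2 G x = P :|: small2.
    apply/eqP; rewrite eqEsubset subUset small2_sub (max_sub_inv3set2 maxP) !andbT.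
    apply/subsetP=> a Sa; have [->|nta] := eqVneq a 1; first by rewrite inE group1.
    have [Q [maxQ ntQ Qa]] := inv3set2P Sa nta; rewrite inE.
    have [oQ|neQ] := eqVneq #|Q| 4.
      by apply/orP; right; apply/bigcupP; exists Q; rewrite // inE maxQ oQ.
    by rewrite -(nonSylow_big sc Gt xt noSyl maxQ maxP ntQ ntP neQ ne4) Qa.
  rewrite subset_leq_card ?subsetUl //= cardsU.
  have [->|[-> s1]|[-> s1]] := card_small2; first by rewrite setI0 cards0 addn0 subn0 leq_addr.
    have : 0 < #|P :&: small2| by apply/card_gt0P; exists 1; rewrite inE group1.
    by move: #|_ :&: _| #|P| => a b; clear; lia.
  have : 0 < #|P :&: small2| by apply/card_gt0P; exists 1; rewrite inE group1.
  by move: #|_ :&: _| #|P| => a b; clear; lia.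
move/existsPn=> small.
have all4 P : max_inv3' G x 2 P -> P != 1%G -> #|P| = 4.
  by move=> maxP ntP; have := small P; rewrite maxP ntP /= negbK => /eqP.
have [W iW [W2 ntW]] := exists_inv3_2group.
have [P maxP sWP] := max_inv3_exists iW W2.
have ntP : P != 1%G.
  apply: contra ntW => /eqP P1; rewrite P1 in sWP.
  by apply/eqP/val_inj/trivgP.
have oP := all4 P maxP ntP; have [iP P2 _] := max_inv3P maxP.
have s2 : inv3set2 G x = small2.
  apply/eqP; rewrite eqEsubset small2_sub andbT.
  have P1 : 1 \in small2 by apply/bigcupP; exists P; rewrite ?inE ?maxP ?oP.
  apply/subsetP=> a Sa; have [->|nta] := eqVneq a 1; first by [].
  have [Q [maxQ ntQ Qa]] := inv3set2P Sa nta.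
  by apply/bigcupP; exists Q; rewrite // inE maxQ all4.
have s47 : #|inv3set2 G x| = 4 \/ #|inv3set2 G x| = 7.
  rewrite s2; have [E|[-> _]|[-> _]] := card_small2; [|by left|by right].
  by have := inv3set2_1; rewrite s2 E inE.
(* [P] of order 4 is not Sylow, so 8 divides the order of a Sylow 2-subgroup. *)
have [k nE8] : exists k, #|G| = (24 * \prod_(v <- h_values G x) v * k)%N.
  have sPG : P \subset G by case/and3P: iP.
  have [S sylS sPS] := Sylow_superset sPG P2.
  have pPS : P \proper S.
    rewrite properEneq sPS andbT; apply/eqP=> PS.
    by have := noSyl sylS; rewrite -PS; case/and3P: iP => _ ->.
  have [e oS] := p_natP (pHall_pgroup sylS).
  have e3 : 2 < e by have := proper_card pPS; rewrite oP oS -[4]/(2 ^ 2)%N ltn_exp2l.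
  have oTS : #|T| = #|S| by rewrite (card_Hall sylT) (card_Hall sylS).
  exists (2 ^ (e - 3) * r)%N; rewrite nE oTS oS -{1}(subnKC e3) expnD.
  rewrite -[(2 ^ 3)%N]/8; move: (2 ^ (e - 3))%N (\prod_(v <- _) v)%N => a b.
  by clear; lia.
have cv v : v \in h_values G x ->
    [\/ c_value G x v = 1%N, c_value G x v = 2 | c_value G x v = 4].
  case/nonSylow_c_value=> [->|->|[U [_ maxO ntO ->]]]; [exact: Or31|exact: Or32|].
  by apply: Or33; apply: all4 maxO ntO.
have [n168 s7 hE c7] := window_small h_values_gt6 cv s47 SE nE8 w1 w2.
split=> //; first by exists P.
have /h_valuesP[U MU hU] : 7 \in h_values G x by rewrite hE mem_head.
have [_ iU _ _] := max_non2P sc MU.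
by exists 'O_2^'(U)%G => //; apply: inv3_char iU (pcore_char _ _).
Qed.

End NonSylow.

End FinalCount.

Theorem core1_classify (gT : finGroupType) (G : {group gT}) x :
    selfcent3 G x -> 'O_3^'(G) = 1 ->
  [\/ #|G| \in [:: 3; 6],
      #|G| = 60 /\ exists2 T : {group gT}, inv3' G x T & #|T| = 4
    | [/\ #|G| = 168, exists2 P : {group gT}, inv3' G x P & #|P| = 4
        & exists2 U : {group gT}, inv3' G x U & #|U| = 7]].
Proof.
move=> sc core1; have [|[w1 w2 [t [Gt t2 xt _]] _]] := core1_cases sc core1.
  exact: Or31.
have [/existsP[T /andP[sylT nTx]]|] :=
    boolP [exists T : {group gT}, 2.-Sylow(G) T && (x \in 'N(T))].
  have [n60 T4] := inv_Sylow_count sc Gt t2 xt core1 w1 w2 sylT nTx.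
  apply: Or32; split=> //; exists T => //.
  by have [] := inv_Sylow_max Gt t2 sylT nTx.
move/existsPn=> noSyl; apply: Or33.
apply: (nonSylow_count sc Gt t2 xt w1 w2) => S sylS.
by have := noSyl S; rewrite sylS.
Qed.

(** * Recognition of PSL(2,7) *)

(** The action is transported to [I] along [e]; the default values in [h] and [F] matter only
    outside [G]. *)
Lemma perm_rep (gT : finGroupType) (G : {group gT}) (T I : finType)
    (to : {action gT &-> T}) (e : I -> T) :
    injective e -> (forall i g, g \in G -> to (e i) g \in codom e) ->
  exists f : {morphism G >-> {perm I}}, forall g i, g \in G -> e (f g i) = to (e i) g.
Proof.
move=> inj_e stab.
pose h g : {ffun I -> I} := [ffun i => odflt i [pick j | e j == to (e i) g]].
pose F g : {perm I} := @insubd _ _ {perm I} (1 : {perm I}) (h g).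
have hE g i : g \in G -> e (h g i) = to (e i) g.
  move=> Gg; rewrite ffunE; case: pickP => [j /eqP//|none].
  by have /codomP[j E] := stab i g Gg; have := none j; rewrite E eqxx.
have FE g i : g \in G -> e (F g i) = to (e i) g.
  move=> Gg; rewrite -hE // -pvalE val_insubd; case: ifP => // /injectiveP[]//.
  move=> a b /(congr1 e); rewrite !hE //.
  by move/(congr1 (to^~ g^-1)); rewrite !actK => /inj_e.
have FM : {in G &, {morph F : g g' / g * g'}}.
  move=> g g' Gg Gg'; apply/permP=> i; apply: inj_e.
  by rewrite permM !FE ?groupM // actM.
by exists (Morphism FM).
Qed.

Definition trans7 (i : option 'F_7) := omap (fun z => z + 1)%R i.
Definition dil7 (i : option 'F_7) := omap (fun z => z *+ 2)%R i.
Definition inv7 (i : option 'F_7) :=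
  if i is Some z then if (z == 0)%R then None else Some (- z^-1)%R else Some 0%R.

Lemma F7_cases (z : 'F_7) (P : 'F_7 -> Prop) :
  P 0%R -> P 1%R -> P 2%:R%R -> P 3%:R%R -> P 4%:R%R -> P 5%:R%R -> P 6%:R%R -> P z.
Proof.
move=> P0 P1 P2 P3 P4 P5 P6.
by case: z => [[|[|[|[|[|[|[|z]]]]]]] lt] //;
   [move: P0|move: P1|move: P2|move: P3|move: P4|move: P5|move: P6];
   congr P; apply: val_inj.
Qed.

Ltac solve_inv7 step s0 sN cE c2 c4 i1 i2 i4 :=
  let go h := (by apply: (step _ _ _ _ _ h); vm_compute) in
  first [go s0 | go sN | go cE | go c2 | go c4 | go i1 | go i2 | go i4].

(* A fixed-point-free involution exchanging None and Some 0 and inverting dil7 is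
   z |-> c / z with - c in {1, 2, 4}, and these are the multipliers of the powers
   of dil7. *)
Lemma inv7_unique (s : option 'F_7 -> option 'F_7) :
    s None = Some 0%R -> (forall i, dil7 (s (dil7 i)) = s i) -> involutive s ->
    (forall i, s i <> i) ->
  exists k, (fun i => iter k dil7 (s i)) =1 inv7.
Proof.
move=> sN sD sI sF; have s0 : s (Some 0%R) = None by rewrite -sN sI.
have dilK i : dil7 (dil7 (dil7 i)) = i.
  by case: i => // z; elim/F7_cases: z; apply/eqP; vm_compute.
have sD' i : s (dil7 i) = dil7 (dil7 (s i)) by rewrite -[s i]sD dilK.
have [c cE] : exists c, s (Some 1%R) = Some c.
  by case E: (s _) => [c|]; [exists c | have := sI (Some 1%R); rewrite E sN].
have c2 : s (Some 2%:R%R) = dil7 (dil7 (Some c)) by rewrite -cE -sD'; congr (s _); apply/eqP.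
have c4 : s (Some 4%:R%R) = dil7 (Some c).
  rewrite -(dilK (dil7 _)) -c2 -[dil7 (dil7 (s _))]sD'; congr (s _); apply/eqP; by vm_compute.
have i1 := sI (Some 1%R); have i2 := sI (Some 2%:R%R); have i4 := sI (Some 4%:R%R).
have f1 := sF (Some 1%R); have f2 := sF (Some 2%:R%R); have f4 := sF (Some 4%:R%R).
rewrite cE in i1 f1; rewrite c2 in i2 f2; rewrite c4 in i4 f4.
have step k a b a' b' : s a = b -> a' == a -> iter k dil7 b == b' -> iter k dil7 (s a') = b'.
  by move=> <- /eqP-> /eqP.
(* The squares [c] = 1, 2, 4 give the fixed points 1, 4, 2. For [c] = 3, 5, 6, doubling 1, 2, 0
   times leads to -1. *)
elim/F7_cases: c cE c2 c4 i1 i2 i4 f1 f2 f4 => cE c2 c4 i1 i2 i4 f1 f2 f4.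
- by rewrite s0 in i1.
- by case: f1.
- by case: f4; apply/eqP; vm_compute.
- by exists 1%N => -[z|]; [elim/F7_cases: z|]; solve_inv7 step s0 sN cE c2 c4 i1 i2 i4.
- by case: f2; apply/eqP; vm_compute.
- by exists 2 => -[z|]; [elim/F7_cases: z|]; solve_inv7 step s0 sN cE c2 c4 i1 i2 i4.
by exists 0%N => -[z|]; [elim/F7_cases: z|]; solve_inv7 step s0 sN cE c2 c4 i1 i2 i4.
Qed.

Section Order168.

Variables (gT : finGroupType) (G : {group gT}) (u x : gT).
Hypotheses (oG : #|G| = 168) (Gu : u \in G) (ou : #[u] = 7) (Gx : x \in G) (ox : #[x] = 3).
Hypothesis ux : u ^ x = u ^+ 2.

Local Notation U := <[u]>.

Lemma order168_Sylow (H : {group gT}) : H \subset G -> u \in H -> 7.-Sylow(H) U.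
Proof.
move=> sHG Hu; apply: (pHall_subl _ sHG); first by rewrite cycle_subG.
rewrite pHallE cycle_subG Gu -orderE ou oG.
by rewrite p_part; have -> : logn 7 168 = 1%N by [].
Qed.

(** The normalizer contains [u] and [x], so 21 divides its order; its index in [H] divides 8, is 1
    modulo 7, and is not 1 because of [t]. Taking for [H] the group generated by the three elements
    shows that they generate [G]. *)
Lemma order168_norm (t : gT) (H : {group gT}) : t \in G -> t \notin 'N(U) ->
    H \subset G -> u \in H -> x \in H -> t \in H ->
  #|'N_H(U)| = 21 /\ #|H| = 168.
Proof.
move=> Gt nUt sHG Hu Hx Ht; have sylU := order168_Sylow sHG Hu.
have NU : U \subset 'N_H(U) by rewrite subsetI normG cycle_subG Hu.
have Nx : x \in 'N_H(U) by rewrite inE Hx -cycle_subG norms_cycle ux mem_cycle.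
have d21 : 21 %| #|'N_H(U)|.
  by rewrite (@Gauss_dvd 3 7) // -{1}ox -ou order_dvdG //= orderE cardSg.
have := card_Syl_mod H (isT : prime 7); rewrite (card_Syl sylU).
have := Lagrange (subsetIl H 'N(U)); have := cardSg sHG; rewrite oG.
have i1 : #|H : 'N_H(U)| != 1%N.
  by rewrite indexg_eq1 subsetI subxx; apply: contra nUt => /subsetP->.
case/dvdnP: d21 => a -> /dvdnP[k kE] oH i7; rewrite -oH in kE *.
have aik : (k * (a * #|H : 'N_H(U)|) = 8)%N.
  apply/eqP; rewrite -(@eqn_pmul2r 21) // [(8 * 21)%N]kE; apply/eqP.
  by rewrite -!mulnA; congr (_ * (_ * _))%N; rewrite mulnC.
move: #|_ : _| i1 i7 aik {oH kE} => i i1 i7 aik.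
have : i %| 8 by rewrite -aik mulnA dvdn_mull.
case: i i1 i7 aik => [|[|[|[|[|[|[|[|[|i]]]]]]]]] // _ _ aik _.
have : (k * a == 1)%N by rewrite -(@eqn_pmul2r 8) // -mulnA aik.
by rewrite muln_eq1 => /andP[_ /eqP->].
Qed.

Variable t : gT.
Hypotheses (Gt : t \in G) (ot : #[t] = 2) (xt : x ^ t = x^-1) (nUt : t \notin 'N(U)).

Lemma order168_gen : <<[set u; x; t]>> = G.
Proof.
have sHG : <<[set u; x; t]>> \subset G.
  by rewrite gen_subG; apply/subsetP=> y; rewrite !inE -orbA => /or3P[] /eqP->.
have [|||_ oH] := order168_norm Gt nUt sHG; try by apply: mem_gen; rewrite !inE eqxx ?orbT.
by apply/eqP; rewrite eqEcard sHG oG oH.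
Qed.

Lemma order168_normG : #|'N_G(U)| = 21.
Proof. by have [] := order168_norm Gt nUt (subxx _) Gu Gx Gt. Qed.

(* The points of the projective line over 'F_7: None is infinity, fixed by u. *)
Definition line7 (i : option 'F_7) : {group gT} :=
  if i is Some z then ((U :^ t) :^ (u ^+ (z : nat)))%G else <[u]>%G.

Lemma line7_conj i : exists2 g, g \in G & line7 i = U :^ g :> {set gT}.
Proof.
case: i => [z|] /=; last by exists 1; rewrite ?conjsg1.
by exists (t * u ^+ z); rewrite ?groupM ?groupX // conjsgM.
Qed.

Lemma Sylow7_norm_eq (P Q : {group gT}) : 7.-Sylow(G) P -> 7.-Sylow(G) Q ->
  P \subset 'N(Q) -> P = Q :> {set gT}.
Proof.
move=> sP sQ nQP; have sQG := pHall_sub sQ.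
have sQN : 7.-Sylow('N_G(Q)) Q.
  by apply: (pHall_subl _ (subsetIl _ _) sQ); rewrite subsetI sQG normG.
apply/eqP; rewrite eqEcard (card_Hall sP) (card_Hall sQ) leqnn andbT.
rewrite (sub_normal_Hall sQN) ?(pHall_pgroup sP) //; last by rewrite subsetI (pHall_sub sP).
by rewrite /normal subsetI sQG normG subsetIr.
Qed.

Lemma line7_Sylow i : 7.-Sylow(G) (line7 i).
Proof.
by have [g Gg ->] := line7_conj i; rewrite pHallJ // order168_Sylow.
Qed.

Lemma order7_norm_conj (v : gT) : v \in U -> v \in 'N(U :^ t) -> v = 1.
Proof.
move=> Uv nv; apply/eqP; apply: contraR nUt => ntv.
have vU : <[v]> = U.
  apply/eqP; rewrite eqEcard cycle_subG Uv -!orderE ou /=.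
  have : #[v] %| 7 by rewrite -ou orderE cardSg ?cycle_subG.
  have : #[v] != 1%N by rewrite order_eq1.
  by move: #[v] => -[|[|[|[|[|[|[|n]]]]]]].
have sU := order168_Sylow (subxx G) Gu.
have sUt : 7.-Sylow(G) (U :^ t)%G by rewrite pHallJ.
have E : U = U :^ t.
  by apply: (Sylow7_norm_eq sU sUt); rewrite /= -{1}vU cycle_subG.
by rewrite inE -E.
Qed.

Lemma line7_inj : injective line7.
Proof.
have key (z w : 'F_7) : (U :^ t) :^ (u ^+ z) = (U :^ t) :^ (u ^+ w) -> z = w.
  move=> E; have nv : u ^+ z * u ^- w \in 'N(U :^ t).
    by apply/normP; rewrite conjsgM E -conjsgM mulgV conjsg1.
  have Uv : u ^+ z * u ^- w \in U by rewrite groupM ?groupV ?mem_cycle.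
  have /eqP := order7_norm_conj Uv nv; rewrite -eq_mulgV1 eq_expg_mod_order ou.
  by rewrite !modn_small ?(ltn_ord z) ?(ltn_ord w) // => /eqP/val_inj.
have none z : U <> (U :^ t) :^ (u ^+ z).
  move/(congr1 (fun A : {set gT} => A :^ u ^- z)); rewrite conjsgK.
  by rewrite conjGid ?groupV ?mem_cycle // => E; case/negP: nUt; rewrite inE -E.
case=> [z|] [w|] //= /(congr1 val) /= E; first by rewrite (key z w).
  by case: (none z).
by case: (none w).
Qed.

Lemma line7_stab i g : g \in G -> 'JG%act (line7 i) g \in codom line7.
Proof.
move=> Gg; suff -> : codom line7 =i 'Syl_7(G) by rewrite inE pHallJ ?line7_Sylow.
have sub : [set line7 i | i in predT] \subset 'Syl_7(G).
  by apply/subsetP=> _ /imsetP[j _ ->]; rewrite inE line7_Sylow.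
have c8 : #|'Syl_7(G)| = 8.
  have := Lagrange (subsetIl G 'N(U)); rewrite order168_normG oG.
  by rewrite -(card_Syl (order168_Sylow (subxx G) Gu)) => E; apply/eqP; rewrite -(@eqn_pmul2l 21) // E.
have <- : [set line7 i | i in predT] = 'Syl_7(G).
  by apply/eqP; rewrite eqEcard sub c8 card_imset ?card_option ?card_Fp //; apply: line7_inj.
by move=> P; apply/codomP/imsetP => [[j ->]|[j _ ->]]; exists j.
Qed.

Lemma line7_u z : line7 (Some z) :^ u = line7 (Some (z + 1)%R).
Proof.
rewrite /= -conjsgM -expgSr; congr (_ :^ _); apply/eqP.
by rewrite eq_expg_mod_order ou /= -addn1 modnDmr modn_mod.
Qed.

Lemma line7_x z : line7 (Some z) :^ x = line7 (Some (z *+ 2)%R).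
Proof.
rewrite /= -conjsgM conjgC conjXg ux -expgM conjsgM -[(U :^ t) :^ x]conjsgM.
have -> : t * x = x^-1 * t by rewrite [RHS]conjgC conjVg xt invgK.
have nUx : U :^ x^-1 = U.
  by apply/normP; rewrite groupV -cycle_subG norms_cycle ux mem_cycle.
rewrite [U :^ (_ * t)]conjsgM nUx.
congr (_ :^ _); apply/eqP; rewrite eq_expg_mod_order ou /=.
by rewrite modn_mod mul2n addnn.
Qed.

Lemma order168_fixfree i : line7 i :^ t <> line7 i.
Proof.
move=> E; have [g Gg ig] := line7_conj i.
have Nt : t ^ g^-1 \in 'N_G(U).
  rewrite inE groupJ ?groupV //= -mem_conjg -normJ -ig; exact/normP.
have := order_dvdG Nt; rewrite orderJ ot order168_normG; by [].
Qed.

(** The order of the kernel divides 21, since the kernel fixes infinity, and 8, since 21 divides the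
    order of the image. The element [s = t * x ^+ k] normalizes the unknown multiplier of [t]. *)
Lemma order168_rep : exists2 f : {morphism G >-> {perm option 'F_7}}, 'injm f &
  exists2 s, s \in G & [/\ f u =1 trans7, f x =1 dil7, f s =1 inv7 & <<[set u; x; s]>> = G].
Proof.
have [f fE] := perm_rep line7_inj line7_stab.
have fE' g i j : g \in G -> line7 i :^ g = line7 j -> f g i = j.
  by move=> Gg E; apply: line7_inj; rewrite fE //; apply: val_inj.
have nUx : x \in 'N(U) by rewrite -cycle_subG norms_cycle ux mem_cycle.
have fu : f u =1 trans7.
  case=> [z|]; apply: fE' => //; first exact: line7_u.
  by rewrite /= conjGid ?cycle_id.
have fx : f x =1 dil7.
  case=> [z|]; apply: fE' => //; first exact: line7_x.
  by rewrite /= (normP nUx).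
have tt : t * t = 1 by rewrite -[t * t]/(t ^+ 2) -ot expg_order.
have txt : x * t * x = t.
  by rewrite -mulgA [t * x](_ : _ = x^-1 * t) ?mulKVg // [RHS]conjgC conjVg xt invgK.
have [k kE] : exists k, (fun i => iter k dil7 (f t i)) =1 inv7.
  apply: inv7_unique => [|i|i|i].
  - by apply: fE' => //=; rewrite expg0 conjsg1.
  - by rewrite -!fx -!permM -!morphM ?groupM // mulgA txt.
  - by rewrite -permM -morphM // tt morph1 perm1.
  by move=> E; apply: (@order168_fixfree i); rewrite -{2}E fE.
have fK : 'ker f = 1.
  have cG : (#|'ker f| * #|f @* G| = 168)%N.
    by rewrite -oG card_morphim setIid Lagrange ?subsetIl.
  have dK : #|'ker f| %| 21.
    rewrite -order168_normG cardSg // subsetI subsetIl; apply/subsetP=> g Kg.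
    have Gg := dom_ker Kg; have := fE g None Gg; rewrite (mker Kg) perm1 => /(congr1 val) /= E.
    by rewrite inE -E.
  have du : 7 %| #|f @* G|.
    have : #[f u] %| 7 by have := morph_order f Gu; rewrite ou.
    have : #[f u] != 1%N.
      by rewrite order_eq1; apply/eqP=> /permP/(_ (Some 0%R)); rewrite fu perm1.
    have := order_dvdG (mem_morphim f Gu Gu).
    by move: #[f u] => -[|[|[|[|[|[|[|[|n]]]]]]]].
  have dx : 3 %| #|f @* G|.
    have : #[f x] %| 3 by have := morph_order f Gx; rewrite ox.
    have : #[f x] != 1%N.
      by rewrite order_eq1; apply/eqP=> /permP/(_ (Some 1%R)); rewrite fx perm1.
    have := order_dvdG (mem_morphim f Gx Gx).
    by move: #[f x] => -[|[|[|[|n]]]].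
  have d21 : 21 %| #|f @* G| by rewrite (@Gauss_dvd 3 7) // dx.
  have d8 : #|'ker f| %| 8.
    case/dvdnP: d21 cG => m ->; rewrite mulnA => /eqP; rewrite (@eqn_pmul2r 21 _ 8) // => /eqP <-.
    exact: dvdn_mulr.
  by apply/card1_trivg/eqP; rewrite -dvdn1 -[1%N]/(gcdn 21 8) dvdn_gcd dK.
exists f; first by apply/trivgP.
have Gs : t * x ^+ k \in G by rewrite groupM ?groupX.
exists (t * x ^+ k) => //; split=> //.
  move=> i; rewrite morphM ?groupX // permM morphX // -kE.
  by elim: (k) => [|n IHn]; rewrite ?perm1 // expgSr permM IHn fx.
apply/eqP; rewrite eqEsubset gen_subG; apply/andP; split.
  by apply/subsetP=> y; rewrite !inE -orbA => /or3P[] /eqP->.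
rewrite -{1}order168_gen gen_subG; apply/subsetP=> y; rewrite !inE -orbA.
have [Hu Hx Hs] : [/\ u \in <<[set u; x; t * x ^+ k]>>, x \in <<[set u; x; t * x ^+ k]>>
     & t * x ^+ k \in <<[set u; x; t * x ^+ k]>>].
  by split; apply: mem_gen; rewrite !inE eqxx ?orbT.
case/or3P=> /eqP-> //; rewrite -[X in X \in _](mulgK (x ^+ k) t) groupM ?groupV ?groupX //.
Qed.

End Order168.

(** Both groups have generators acting on the projective line by the same three permutations, so
    their faithful images coincide. *)
Theorem order168_isog (gT rT : finGroupType) (G : {group gT}) (H : {group rT}) u x t u' x' t' :
    #|G| = 168 -> #|H| = 168 ->
    [/\ u \in G, x \in G & t \in G] -> [/\ u' \in H, x' \in H & t' \in H] ->
    [/\ #[u] = 7, #[x] = 3, #[t] = 2, u ^ x = u ^+ 2 & x ^ t = x^-1] ->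
    [/\ #[u'] = 7, #[x'] = 3, #[t'] = 2, u' ^ x' = u' ^+ 2 & x' ^ t' = x'^-1] ->
    t \notin 'N(<[u]>) -> t' \notin 'N(<[u']>) ->
  G \isog H.
Proof.
move=> oG oH [Gu Gx Gt] [Hu Hx Ht] [ou ox ot ux xt] [ou' ox' ot' ux' xt'] nt nt'.
have [f injf [s Gs [fu fx fs gG]]] := order168_rep oG Gu ou Gx ox ux Gt ot xt nt.
have [h injh [s' Hs [hu hx hs gH]]] := order168_rep oH Hu ou' Hx ox' ux' Ht ot' xt' nt'.
have im (aT bT : finGroupType) (K : {group aT}) (g : {morphism K >-> bT}) a b c :
    a \in K -> b \in K -> c \in K -> <<[set a; b; c]>> = K ->
    g @* K = <<[set g a; g b; g c]>>.
  move=> Ka Kb Kc gK; have sK : [set a; b; c] \subset K.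
    by apply/subsetP=> y; rewrite !inE -orbA => /or3P[] /eqP->.
  rewrite -{3}gK morphim_gen //; congr <<_>>.
  by rewrite !morphimU !morphim_set1.
have E : f @* G = h @* H.
  rewrite (im _ _ _ f u x s) // (im _ _ _ h u' x' s') //.
  have -> : f u = h u' by apply/permP=> i; rewrite fu hu.
  have -> : f x = h x' by apply/permP=> i; rewrite fx hx.
  by have -> : f s = h s' by apply/permP=> i; rewrite fs hs.
have iG := sub_isog (subxx G) injf; rewrite E in iG.
by apply: isog_trans iG _; rewrite isog_sym; apply: sub_isog.
Qed.

(** * Recognition of the alternating group of degree five *)

Section Order60.

Variables (gT : finGroupType) (G T : {group gT}) (x : gT).
Hypotheses (oG : #|G| = 60) (sTG : T \subset G) (oT : #|T| = 4).
Hypotheses (Gx : x \in G) (ox : #[x] = 3) (fx : fpf3 T x) (nT : ~~ (G \subset 'N(T))).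

Lemma order60_norm : #|'N_G(T)| = 12 /\ #|G : 'N_G(T)| = 5.
Proof.
have nTx : x \in 'N(T) by case/and3P: fx.
have d12 : 12 %| #|'N_G(T)|.
  have Nx : x \in 'N_G(T) by rewrite inE Gx.
  have sTN : T \subset 'N_G(T) by rewrite subsetI sTG normG.
  have := order_dvdG Nx; have := cardSg sTN; rewrite ox oT (@Gauss_dvd 3 4) //.
  by move=> d4 d3; apply/andP; split.
have := Lagrange (subsetIl G 'N(T)); rewrite oG.
have : #|G : 'N_G(T)| != 1%N by rewrite indexg_eq1 subsetI subxx.
case/dvdnP: d12 => a ->; move: #|_ : _| => i i1 E.
have ai : (a * i = 5)%N by apply/eqP; rewrite -(@eqn_pmul2r 12) // mulnAC E.
have : i %| 5 by rewrite -ai dvdn_mull.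
by case: i i1 ai {E} => [|[|[|[|[|[|i]]]]]] // _; case: a => [|[|a]].
Qed.

Lemma order60_inv_sub (L : {group gT}) : L <| G -> L :&: T != 1 -> T \subset L.
Proof.
move=> nLG nt; have /and3P[nTx _ _] := fx.
have fL : fpf3 (L :&: T) x.
  apply: fpf3S fx (subsetIr _ _) _; rewrite inE conjIg (normP nTx) (normP _) //.
  exact: subsetP (normal_norm nLG) x Gx.
have := fpf3_card fL; have : #|L :&: T| %| 4 by rewrite -oT cardSg ?subsetIr.
have := nt; rewrite trivg_card1; move=> n1 d4 m3.
suff E : #|L :&: T| = 4.
  by apply/setIidPr/eqP; rewrite eqEcard subsetIr oT E.
by move: #|_| n1 d4 m3 => -[|[|[|[|[|n]]]]].
Qed.

(** If [K] meets [T] nontrivially it contains [T], which is then its normal Sylow 2-subgroup and so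
    normal in [G]. Otherwise 4 |K| divides 12, and a [K] of order 3 would be [<[x]>] and centralize
    [T]. *)
Lemma order60_core (K : {group gT}) : K <| G -> K \subset 'N(T) -> K :=: 1.
Proof.
move=> nKG nTK; have sKG := normal_sub nKG.
have sKM : K \subset 'N_G(T) by rewrite subsetI sKG.
have sTM : T \subset 'N_G(T) by rewrite subsetI sTG normG.
have oM : #|'N_G(T)| = 12 by case: order60_norm.
have [KT1|ntKT] := eqVneq (K :&: T) 1; last first.
  have sTK := order60_inv_sub nKG ntKT.
  have hT : 2.-Hall(K) T.
    have sylT : 2.-Sylow(G) T by rewrite pHallE sTG oT oG p_part; have -> : logn 2 60 = 2 by [].
    exact: pHall_subl sTK sKG sylT.
  have nTK' : T <| K by rewrite /normal sTK.
  case/negP: nT; rewrite -(normal_Hall_pcore hT nTK').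
  exact: normal_norm (gFnormal_trans _ nKG).
have oKT : #|K <*> T| = (#|K| * 4)%N.
  rewrite norm_joinEr ?TI_cardMg ?oT //.
  exact: subset_trans sTG (normal_norm nKG).
have : #|K <*> T| %| #|'N_G(T)| by rewrite cardSg // join_subG sKM.
rewrite oKT oM (@dvdn_pmul2r 4 _ 3) // => d3.
have [K1|K3] : #|K| = 1%N \/ #|K| = 3.
- by move: #|K| d3 => -[|[|[|[|n]]]]; auto.
- exact/card1_trivg.
have cKT : K \subset 'C(T).
  rewrite (sameP commG1P trivgP) -KT1 subsetI commg_subl commg_subr nTK.
  by rewrite (subset_trans sTG (normal_norm nKG)).
have syl (Q : {group gT}) : Q \subset G -> #|Q| = 3 -> 3.-Sylow(G) Q.
  by move=> sQG oQ; rewrite pHallE sQG oQ oG p_part; have -> : logn 3 60 = 1%N by [].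
have sXG : <[x]> \subset G by rewrite cycle_subG.
have [g Gg /= E] := Sylow_trans (syl _ sKG K3) (syl <[x]>%G sXG ox).
have Kx : x \in K.
  by rewrite -(normP (subsetP (normal_norm nKG) g Gg)) -E cycle_id.
have /and3P[_ _ /eqP CT] := fx.
have : T \subset 'C_T[x] by rewrite subsetI subxx sub_cent1 (subsetP cKT).
by rewrite CT => /subset_leq_card; rewrite oT cards1.
Qed.

Lemma order60_index2 (L : {group gT}) : L <| G -> #|L| != 30.
Proof.
move=> nLG; apply/eqP=> oL.
have [LT1|ntLT] := eqVneq (L :&: T) 1; last first.
  by have := cardSg (order60_inv_sub nLG ntLT); rewrite oT oL.
have : #|L <*> T| <= 60 by rewrite -oG subset_leq_card // join_subG normal_sub.
rewrite norm_joinEr ?TI_cardMg ?oT ?oL //.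
exact: subset_trans sTG (normal_norm nLG).
Qed.

(** [G] acts on the five cosets of ['N_G(T)], faithfully by [order60_core]. The image meets the
    alternating group in index at most two, and [order60_index2] excludes two. *)
Theorem order60_Alt5 : G \isog 'Alt_('I_5).
Proof.
have [oM i5] := order60_norm; set M := 'N_G(T) in oM i5.
pose R := rcosets M G; have oR : #|R| = 5 by [].
pose e (i : 'I_5) : {set gT} := nth set0 (enum R) i.
have lt_e (i : 'I_5) : i < size (enum R) by rewrite -cardE oR.
have inj_e : injective e.
  move=> i j /eqP; rewrite nth_uniq ?enum_uniq // => /eqP; exact: val_inj.
have eR A : A \in R -> A \in codom e.
  rewrite -mem_enum => /(nthP set0)[i lti <-]; rewrite -cardE oR in lti.
  by apply/codomP; exists (Ordinal lti).
have Re i : e i \in R by rewrite -mem_enum mem_nth.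
have stab i g : g \in G -> 'Rs%act (e i) g \in codom e.
  move=> Gg; apply: eR; have /rcosetsP[h Gh ->] := Re i.
  by rewrite /= rcosetE -rcosetM; apply/rcosetsP; exists (h * g); rewrite ?groupM.
have [f fE] := perm_rep inj_e stab.
have kM : 'ker f \subset M.
  apply/subsetP=> g Kg; have Gg := dom_ker Kg.
  have /codomP[i iE] : M :* 1 \in codom e by apply: eR; apply/rcosetsP; exists 1.
  have := fE g i Gg; rewrite (mker Kg) perm1 -iE /= rcosetE -rcosetM mul1g mulg1 => E.
  by rewrite E rcoset_refl.
have injf : 'injm f.
  have := order60_core (ker_normal f) (subset_trans kM (subsetIr _ _)).
  by move=> /= ->.
have oF : #|f @* G| = 60 by rewrite card_injm.
have oA : #|'Alt_('I_5)| = 60.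
  have := card_Alt (_ : 1 < #|'I_5|); rewrite card_ord => /(_ isT).
  by move/eqP; rewrite (@eqn_pmul2l 2 _ 60) // => /eqP.
suff E : f @* G = 'Alt_('I_5) by rewrite -E; apply: sub_isog.
have nA : f @* G \subset 'N('Alt_('I_5)).
  exact: subset_trans (subsetT _) (normal_norm (Alt_normal _)).
have := mul_cardG (f @* G) 'Alt_('I_5); rewrite oF oA.
have : #|f @* G * 'Alt_('I_5)| <= 120.
  have <- : #|'Sym_('I_5)| = 120 by rewrite card_Sym card_ord.
  exact: subset_leq_card (subsetT _).
have : #|f @* G :&: 'Alt_('I_5)| %| 60 by rewrite -oF cardSg ?subsetIl.
have : #|f @* G :&: 'Alt_('I_5)| != 30.
  have n30 : f @*^-1 'Alt_('I_5) <| G.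
    rewrite /normal subsetIl; apply: subset_trans (morphpre_norms f nA).
    by rewrite -sub_morphim_pre.
  have := order60_index2 (n30 : [group of f @*^-1 'Alt_('I_5)] <| G).
  by rewrite /= -morphpreIim -(card_injm injf) ?subsetIl // morphpreK ?subsetIl.
move=> n30 d60 le120 E; apply/eqP; rewrite eqEcard oF oA leqnn andbT.
have ge30 : 30 <= #|f @* G :&: 'Alt_('I_5)|.
  by rewrite -(@leq_pmul2l 120) // -[(120 * 30)%N]/(60 * 60)%N E leq_mul2r le120 orbT.
have i60 : #|f @* G :&: 'Alt_('I_5)| = 60.
  case/dvdnP: d60 ge30 n30 => k; move: #|_| => m.
  case: k => [|[|[|k]]] // kE; [by rewrite mul1n in kE | |].
    by move=> _ /eqP[]; apply/eqP; rewrite -(@eqn_pmul2l 2) // -kE.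
  by move=> m30 _; have := leq_mul (isT : 2 < k.+3) m30; rewrite -kE.
by apply/setIidPl/eqP; rewrite eqEcard subsetIl i60 oF.
Qed.

End Order60.

(** * Two-by-two matrices *)

Section SL2.

Import GRing.Theory.

Variable F : finFieldType.
Implicit Types a b c d : F.
Local Open Scope ring_scope.

Definition mx2 a b c d : 'M[F]_2 :=
  \matrix_(i, j) (if i == 0 then if j == 0 then a else b else if j == 0 then c else d).

Lemma mx2_eq (A B : 'M[F]_2) : A 0 0 = B 0 0 -> A 0 1 = B 0 1 -> A 1 0 = B 1 0 ->
  A 1 1 = B 1 1 -> A = B.
Proof.
move=> e00 e01 e10 e11; apply/matrixP=> i j.
have c2 (k : 'I_2) : k = 0 \/ k = 1.
  by case: k => -[|[|k]] lt //; [left|right]; apply: val_inj.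
by case: (c2 i) => ->; case: (c2 j) => ->.
Qed.

Lemma mx2M a b c d a' b' c' d' : mx2 a b c d *m mx2 a' b' c' d' =
  mx2 (a * a' + b * c') (a * b' + b * d') (c * a' + d * c') (c * b' + d * d').
Proof. by apply: mx2_eq; rewrite !mxE !big_ord_recl big_ord0 !mxE /= addr0. Qed.

Lemma det_mx2 a b c d : \det (mx2 a b c d) = a * d - b * c.
Proof.
rewrite (expand_det_row _ 0) !big_ord_recl big_ord0 /cofactor !det_mx11 !mxE /=.
by rewrite expr0 expr1; ring.
Qed.

Lemma mx2_entries (A : 'M[F]_2) : A = mx2 (A 0 0) (A 0 1) (A 1 0) (A 1 1).
Proof. by apply: mx2_eq; rewrite mxE. Qed.

Lemma mx2_1 : mx2 1 0 0 1 = 1%:M.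
Proof. by apply: mx2_eq; rewrite !mxE. Qed.

(* gl2 a b c d is the identity when the determinant vanishes. *)
Definition gl2 a b c d : {'GL_2[F]} := insubd (1%g : {'GL_2[F]}) (mx2 a b c d : 'M_(2.-1.+1)).

Lemma gl2E a b c d : a * d - b * c != 0 -> GLval (gl2 a b c d) = mx2 a b c d.
Proof.
move=> nz; rewrite -[GLval _]/(val _) val_insubd unitmxE det_mx2.
by rewrite unitfE nz.
Qed.

Lemma gl2_SL a b c d : a * d - b * c = 1 -> gl2 a b c d \in SLgroup 2 F.
Proof. by move=> e; rewrite inE gl2E ?e ?oner_neq0 // det_mx2 e. Qed.

Lemma SL_gl2 (A : {'GL_2[F]}) : A \in SLgroup 2 F ->
  exists a b c d, a * d - b * c = 1 /\ A = gl2 a b c d.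
Proof.
rewrite inE => /eqP dA; pose M : 'M[F]_2 := GLval A.
have eM : M = mx2 (M 0 0) (M 0 1) (M 1 0) (M 1 1) := mx2_entries M.
have dM : M 0 0 * M 1 1 - M 0 1 * M 1 0 = 1 by rewrite -det_mx2 -eM.
exists (M 0 0), (M 0 1), (M 1 0), (M 1 1); split=> //; apply: val_inj.
by rewrite /= -[RHS]/(GLval _) gl2E ?dM ?oner_neq0 // -eM.
Qed.

Lemma gl2_inj a b c d a' b' c' d' : a * d - b * c != 0 -> a' * d' - b' * c' != 0 ->
  gl2 a b c d = gl2 a' b' c' d' -> [/\ a = a', b = b', c = c' & d = d'].
Proof.
move=> nz nz' /(congr1 (@GLval 2 F)); rewrite !gl2E // => /matrixP E.
by split; [move: (E 0 0)|move: (E 0 1)|move: (E 1 0)|move: (E 1 1)]; rewrite !mxE.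
Qed.

Lemma gl2M a b c d a' b' c' d' : a * d - b * c = 1 -> a' * d' - b' * c' = 1 ->
  (gl2 a b c d * gl2 a' b' c' d')%g =
  gl2 (a * a' + b * c') (a * b' + b * d') (c * a' + d * c') (c * b' + d * d').
Proof.
move=> e e'; apply: val_inj; rewrite /= -[RHS]/(GLval _) !gl2E -?mx2M.
- by rewrite -!gl2E ?e ?e' ?oner_neq0.
set D := (_ - _); have -> : D = (a * d - b * c) * (a' * d' - b' * c') by rewrite /D; ring.
by rewrite e e' mulr1 oner_neq0.
Qed.

Lemma gl2_1 : gl2 1 0 0 1 = 1%g.
Proof. by apply: val_inj; rewrite /= -[LHS]/(GLval _) gl2E ?mx2_1 ?mulr1 ?mulr0 ?subr0 ?oner_neq0. Qed.

Fact GL2_det_unit (A : {'GL_2[F]}) : \det (GLval A) \is a GRing.unit.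
Proof. by rewrite unitfE GL_det. Qed.

Definition GL2_det (A : {'GL_2[F]}) : {unit F} := FinRing.Unit (GL2_det_unit A).

Fact GL2_detM : {in 'GL_2[F]%g &, {morph GL2_det : A B / (A * B)%g}}.
Proof. by move=> A B _ _; apply: val_inj; rewrite /= det_mulmx. Qed.

Canonical GL2_det_morphism := Morphism GL2_detM.

Lemma card_SL2 : (#|SLgroup 2 F| = #|F| * (#|F|.-1 * #|F|.+1))%N.
Proof.
have kerD : ('ker GL2_det = SLgroup 2 F)%g.
  apply/setP=> A; rewrite !inE /=; apply/eqP/eqP=> [/(congr1 val)//|E].
  exact: val_inj.
have imD : (GL2_det @* 'GL_2[F] = [set: {unit F}])%g.
  apply/setP=> u; rewrite inE; apply/morphimP.
  have nz : val u * 1 - 0 * 0 != 0.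
    by rewrite mulr1 mulr0 subr0 -unitfE (valP u).
  exists (gl2 (val u) 0 0 1); rewrite ?inE //; apply: val_inj.
  by rewrite /= gl2E // det_mx2 mulr1 mulr0 subr0.
have q1 : (0 < #|F|.-1)%N by have := finRing_gt1 F; case: #|_| => [|[]].
have := Lagrange (subsetIl _ _ : ('ker GL2_det \subset 'GL_2[F])%g).
have := card_morphim GL2_det 'GL_2[F]%G; rewrite setIid imD => /= <-.
rewrite kerD card_finField_unit card_GL_2 => E.
apply/eqP; rewrite -(eqn_pmul2r q1) E; by rewrite -mulnn !mulnA mulnAC.
Qed.

Definition diag2 a := gl2 a 0 0 a^-1.
Definition upper2 a := gl2 1 a 0 1.
Definition weyl2 := gl2 0 1 (-1) 0.

Lemma diag2_det a : a != 0 -> a * a^-1 - 0 * 0 = 1.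
Proof. by move=> nz; rewrite divff // mulr0 subr0. Qed.
Lemma upper2_det a : 1 * 1 - a * 0 = 1 :> F.
Proof. by rewrite mulr1 mulr0 subr0. Qed.
Lemma weyl2_det : 0 * 0 - 1 * (-1) = 1 :> F.
Proof. by rewrite mulr0 mul1r sub0r opprK. Qed.

Lemma diag2_SL a : a != 0 -> diag2 a \in SLgroup 2 F.
Proof. by move=> nz; apply/gl2_SL/diag2_det. Qed.
Lemma upper2_SL a : upper2 a \in SLgroup 2 F.
Proof. exact/gl2_SL/upper2_det. Qed.
Lemma weyl2_SL : weyl2 \in SLgroup 2 F.
Proof. exact/gl2_SL/weyl2_det. Qed.

Lemma upper2D a b : (upper2 a * upper2 b = upper2 (a + b)%R)%g.
Proof. by rewrite /upper2 gl2M ?upper2_det //; congr gl2; ring. Qed.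

Lemma upper2_inj : injective upper2.
Proof. by move=> a b /gl2_inj; rewrite !upper2_det oner_neq0 => /(_ isT isT)[]. Qed.

Lemma diag2M a b : a != 0 -> b != 0 -> (diag2 a * diag2 b = diag2 (a * b)%R)%g.
Proof.
move=> nza nzb; rewrite /diag2 gl2M ?diag2_det // invfM.
by congr gl2; rewrite ?mulr0 ?mul0r ?addr0 ?add0r.
Qed.

Lemma upper2_diag2 a b : a != 0 -> (upper2 b ^ diag2 a = upper2 (b / a ^+ 2)%R)%g.
Proof.
move=> nz; have e := diag2_det nz; have nz' := invr_neq0 nz.
apply/eqP; rewrite eq_sym -(inj_eq (mulgI (diag2 a))) -conjgC; apply/eqP.
rewrite /diag2 /upper2 !gl2M ?upper2_det //.
by congr gl2; rewrite ?mulr0 ?mul0r ?addr0 ?add0r ?mulr1 ?mul1r //; field.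
Qed.

Lemma diag2_weyl2 a : a != 0 -> (diag2 a ^ weyl2 = diag2 a^-1%R)%g.
Proof.
move=> nz; have nz' := invr_neq0 nz.
apply/eqP; rewrite eq_sym -(inj_eq (mulgI weyl2)) -conjgC; apply/eqP.
rewrite /diag2 /weyl2 !gl2M ?weyl2_det ?diag2_det //.
by congr gl2; rewrite ?mulr0 ?mul0r ?addr0 ?add0r ?mulr1 ?mul1r ?invrK ?mulrN1 ?mulN1r.
Qed.

Lemma upper2_weyl2 a : (upper2 a ^ weyl2)%g = gl2 1 0 (- a) 1.
Proof.
apply/eqP; rewrite eq_sym -(inj_eq (mulgI weyl2)) -conjgC; apply/eqP.
rewrite /upper2 /weyl2 !gl2M ?weyl2_det ?upper2_det ?mulr1 ?mul0r ?subr0 //.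
by congr gl2; ring.
Qed.

Lemma diag2X a n : a != 0 -> (diag2 a ^+ n = diag2 (a ^+ n)%R)%g.
Proof.
move=> nz; elim: n => [|n IHn]; first by rewrite expg0 expr0 /diag2 invr1 gl2_1.
by rewrite expgS IHn diag2M ?expf_neq0 // exprS.
Qed.

Lemma upper2X a n : (upper2 a ^+ n = upper2 (a *+ n)%R)%g.
Proof.
elim: n => [|n IHn]; first by rewrite expg0 mulr0n /upper2 gl2_1.
by rewrite expgS IHn upper2D mulrS.
Qed.

Lemma weyl2_sqr : (weyl2 * weyl2)%g = gl2 (-1) 0 0 (-1).
Proof. by rewrite /weyl2 gl2M ?weyl2_det //; congr gl2; ring. Qed.

Lemma upper2_comm a b c d : a * d - b * c = 1 ->
  commute (gl2 a b c d) (upper2 1%R) -> c = 0 /\ a = d.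
Proof.
move=> e; rewrite /commute /upper2 !gl2M ?upper2_det // => /gl2_inj.
have -> : (a * 1 + b * 0) * (c * 1 + d * 1) - (a * 1 + b * 1) * (c * 1 + d * 0) = 1.
  by rewrite -[RHS]e; ring.
have -> : (1 * a + 1 * c) * (0 * b + 1 * d) - (1 * b + 1 * d) * (0 * a + 1 * c) = 1.
  by rewrite -[RHS]e; ring.
rewrite oner_neq0 => /(_ isT isT)[e1 e2 _ _].
rewrite !mulr1 !mulr0 !mul1r addr0 in e1 e2; split.
  by apply: (addrI a); rewrite -e1 addr0.
by move: e2; rewrite addrC => /addrI.
Qed.

Lemma weyl2_comm a b c d : a * d - b * c = 1 ->
  commute (gl2 a b c d) weyl2 -> b = - c /\ a = d.
Proof.
move=> e; rewrite /commute /weyl2 !gl2M ?weyl2_det // => /gl2_inj.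
have -> : (a * 0 + b * -1) * (c * 1 + d * 0) - (a * 1 + b * 0) * (c * 0 + d * -1) = 1.
  by rewrite -[RHS]e; ring.
have -> : (0 * a + 1 * c) * (-1 * b + 0 * d) - (0 * b + 1 * d) * (-1 * a + 0 * c) = 1.
  by rewrite -[RHS]e; ring.
rewrite oner_neq0 => /(_ isT isT)[e1 e2 _ _]; split.
  by apply: oppr_inj; rewrite opprK; move: e1; rewrite mulr0 mul0r !add0r mulrN1 mul1r.
by move: e2; rewrite mulr0 mul0r addr0 add0r mulr1 mul1r.
Qed.

Lemma center_SL2 : 'Z(SLgroup 2 F)%g = [set gl2 a 0 0 a | a in F & a ^+ 2 == 1].
Proof.
apply/setP=> A; apply/centerP/imsetP=> [[SA cA]|[a Pa ->]].
  have [a [b [c [d [e E]]]]] := SL_gl2 SA; rewrite E in cA.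
  have [c0 ad] := upper2_comm e (cA _ (upper2_SL 1)).
  have [b0 _] := weyl2_comm e (cA _ weyl2_SL).
  rewrite c0 oppr0 in b0; rewrite b0 c0 -ad mul0r subr0 in e E.
  by exists a; rewrite // !inE expr2 e eqxx.
have aa : a * a - 0 * 0 = 1 by move: Pa; rewrite !inE mulr0 subr0 -expr2 => /andP[_ /eqP].
split=> [|B /SL_gl2[a' [b' [c' [d' [e' ->]]]]]]; first exact: gl2_SL.
by rewrite /commute !gl2M //; congr gl2; ring.
Qed.

(** Modulo the centre, [weyl2] does not normalize the group generated by the image of [upper2 1]:
    the condition on the third generator in the recognition theorem. *)
Lemma upper2_weyl2_coset a b k : a ^+ 2 = 1 ->
  (upper2 1%R ^ weyl2)%g <> (gl2 a 0%R 0%R a * upper2 b ^+ k)%g.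
Proof.
move=> a2; have aa : a * a - 0 * 0 = 1 by rewrite mulr0 subr0 -expr2.
rewrite upper2_weyl2 upper2X /upper2 gl2M ?upper2_det // => /gl2_inj E.
have [||_ _ /eqP] := E.
- by rewrite mulr1 mul0r subr0 oner_neq0.
- by rewrite !(mulr0, mul0r, mulr1, addr0, add0r, subr0) -expr2 a2 oner_neq0.
by rewrite mul0r mulr0 addr0 oppr_eq0 oner_eq0.
Qed.

End SL2.

(** * A standard generating triple of PSL(2,7) *)

Section PSL27.

Import GRing.Theory.

(** The relations are checked upstairs; [t'] is asked to be an involution only modulo [Z], because
    [weyl2] squares to the scalar -1. *)
Lemma order168_quotient (gT aT : finGroupType) (G : {group gT}) (S Z : {group aT}) u x t u' x' t' :
    #|G| = 168 -> [/\ u \in G, x \in G & t \in G] ->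
    [/\ #[u] = 7, #[x] = 3, #[t] = 2, u ^ x = u ^+ 2 & x ^ t = x^-1] ->
    t \notin 'N(<[u]>) ->
    Z <| S -> #|S / Z| = 168 -> [/\ u' \in S, x' \in S & t' \in S] ->
    [/\ u' ^+ 7 = 1, x' ^+ 3 = 1, t' ^+ 2 \in Z, u' ^ x' = u' ^+ 2 & x' ^ t' = x'^-1] ->
    [/\ u' \notin Z, x' \notin Z & t' \notin Z] ->
    (forall k, u' ^ t' \notin Z :* (u' ^+ k)) ->
  G \isog S / Z.
Proof.
move=> oG Gm rel nt nZ oQ [Su Sx St] [u7 x3 t2 ux xt] [uZ xZ tZ] nut.
have sN := normal_norm nZ; have nS y : y \in S -> y \in 'N(Z) := subsetP sN y.
have notZ y : y \in S -> y \notin Z -> coset Z y != 1.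
  by move=> Sy; apply: contra => /eqP cy; apply: coset_idr cy; apply: nS.
have Qm y : y \in S -> coset Z y \in S / Z by apply: mem_quotient.
have [Qu [Qx Qt]] := (Qm _ Su, (Qm _ Sx, Qm _ St)).
have rel' : [/\ #[coset Z u'] = 7, #[coset Z x'] = 3, #[coset Z t'] = 2,
    coset Z u' ^ coset Z x' = coset Z u' ^+ 2 & coset Z x' ^ coset Z t' = (coset Z x')^-1].
  split.
  - by apply: nt_prime_order; rewrite ?notZ // -morphX ?nS // u7 morph1.
  - by apply: nt_prime_order; rewrite ?notZ // -morphX ?nS // x3 morph1.
  - by apply: nt_prime_order; rewrite ?notZ // -morphX ?nS //; apply: coset_id.
  - by rewrite -morphJ ?nS // -morphX ?nS // ux.
  by rewrite -morphJ ?nS // -morphV ?nS // xt.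
apply: (order168_isog oG _ Gm (And3 Qu Qx Qt) rel rel' nt) => //.
apply/negP; rewrite -cycle_subG norms_cycle => /cycleP[k].
rewrite -morphJ ?nS // -morphX ?nS // => /eqP; rewrite -val_eqE /=.
rewrite !val_coset ?groupJ ?groupX ?nS // => /eqP E; case/negP: (nut k).
by rewrite -E rcoset_refl.
Qed.

Local Open Scope ring_scope.

Lemma PSL27_isog (gT : finGroupType) (G : {group gT}) (u x t : gT) :
    #|G| = 168 -> [/\ u \in G, x \in G & t \in G] ->
    [/\ #[u]%g = 7, #[x]%g = 3, #[t]%g = 2, (u ^ x = u ^+ 2)%g & (x ^ t = x^-1)%g] ->
    t \notin 'N(<[u]>)%g ->
  G \isog PSLgroup 2 'F_7.
Proof.
move=> oG Gm rel nt.
have oF : #|'F_7| = 7 by rewrite card_Fp.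
have oS : #|SLgroup 2 'F_7| = 336 by rewrite card_SL2 oF.
have nzd (a : 'F_7) : a ^+ 2 = 1 -> a * a - 0 * 0 != 0.
  by rewrite mulr0 subr0 -expr2 => ->; rewrite oner_neq0.
have oZ : #|'Z(SLgroup 2 'F_7)%g| = 2.
  rewrite center_SL2 card_in_imset => [|a b].
    have -> : [set a in 'F_7 | a ^+ 2 == 1] = [set 1; -1].
      by apply/setP=> a; rewrite !inE sqrf_eq1.
    by rewrite cards2.
  rewrite !inE => /= /eqP za /eqP zb /gl2_inj E.
  by case: (E (nzd _ za) (nzd _ zb)).
have oQ : #|SLgroup 2 'F_7 / 'Z(SLgroup 2 'F_7)|%g = 168.
  have := card_quotient (normal_norm (center_normal (SLgroup_group 2 'F_7))).
  by rewrite -divgS ?center_sub //= oS oZ.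
have nz2 : (2%:R : 'F_7) != 0 by [].
have Zdiag y : y \in 'Z(SLgroup 2 'F_7)%g -> exists2 a : 'F_7, a ^+ 2 = 1 & y = gl2 a 0 0 a.
  by rewrite center_SL2 => /imsetP[a Pa ->]; exists a => //; move: Pa; rewrite !inE => /eqP.
have uZ : upper2 (1 : 'F_7) \notin 'Z(SLgroup 2 'F_7)%g.
  apply/negP=> /Zdiag[a /nzd nza /gl2_inj E].
  have [|_ /eqP] := E _ nza; first by rewrite upper2_det oner_neq0.
  by rewrite oner_eq0.
have xZ : diag2 (2%:R : 'F_7) \notin 'Z(SLgroup 2 'F_7)%g.
  apply/negP=> /Zdiag[a /nzd nza /gl2_inj E].
  have [|<- _ _ /eqP] := E _ nza; first by rewrite diag2_det ?oner_neq0.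
  by [].
have tZ : weyl2 'F_7 \notin 'Z(SLgroup 2 'F_7)%g.
  apply/negP=> /Zdiag[a /nzd nza /gl2_inj E].
  have [|_ /eqP] := E _ nza; first by rewrite weyl2_det oner_neq0.
  by rewrite oner_eq0.
apply: (order168_quotient oG Gm rel nt (center_normal (SLgroup_group 2 'F_7)) oQ
   (And3 (upper2_SL (1 : 'F_7)) (diag2_SL nz2) (weyl2_SL 'F_7)) _ (And3 uZ xZ tZ)).
  split.
  - rewrite upper2X [_ *+ _](_ : _ = 0); last by apply/eqP.
    exact: gl2_1.
  - rewrite diag2X // [2%:R ^+ 3](_ : _ = 1); last by apply/eqP.
    by rewrite /diag2 invr1 gl2_1.
  - rewrite -[(weyl2 'F_7 ^+ 2)%g]/(weyl2 'F_7 * weyl2 'F_7)%g weyl2_sqr.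
    by rewrite /= center_SL2; apply/imsetP; exists (-1); rewrite // !inE sqrrN expr1n.
  (* Modulo 7 the inverse of 4 is 2, so conjugation by [diag2 2] squares [upper2 1]. *)
  - by rewrite upper2_diag2 // upper2X; congr upper2; apply/eqP.
  rewrite diag2_weyl2 //; apply/eqP; rewrite eq_sym eq_invg_mul diag2M ?divff //.
  by rewrite /diag2 invr1 gl2_1.
move=> k; apply/negP=> /rcosetP[z /Zdiag[a a2 ->]].
exact: upper2_weyl2_coset.
Qed.

End PSL27.

(** * SL(2,4) *)

Section Field4.

Import GRing.Theory.

Variable F : finFieldType.
Hypotheses (charF : 2 \in [pchar F]%R) (oF : #|F| = 4).
Local Open Scope ring_scope.

(** A primitive cube root of unity, its minimal polynomial written for characteristic two. *)
Definition omega4 (w : F) := [&& w != 0, w != 1 & w ^+ 2 == w + 1].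

Lemma F4_omega : exists w, omega4 w.
Proof.
have : [set 0; 1 : F] != setT.
  by apply/eqP=> /(congr1 (fun A : {set F} => #|A|)); rewrite cards2 cardsT oF eq_sym oner_eq0.
rewrite -subTset => /subsetPn[w _]; rewrite !inE negb_or => /andP[w0 w1].
exists w; rewrite /omega4 w0 w1 /=.
have w3 : w ^+ 4 = w by rewrite -oF expf_card.
have : (w * (w - 1)) * (w ^+ 2 + w + 1) == 0.
  have -> : w * (w - 1) * (w ^+ 2 + w + 1) = w ^+ 4 - w by ring.
  by rewrite w3 subrr.
rewrite !mulf_eq0 (negPf w0) subr_eq0 (negPf w1) /= -addrA addr_eq0.
by rewrite oppr_pchar2.
Qed.

Lemma F4_cases w a (P : F -> Prop) : omega4 w -> P 0 -> P 1 -> P w -> P (w + 1) -> P a.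
Proof.
case/and3P=> w0 w1 /eqP w2 P0 P1 Pw Pw1.
have u4 : uniq [:: 0; 1; w; w + 1].
  have e1 : 0 != 1 :> F by rewrite eq_sym oner_eq0.
  have e3 : 0 != w + 1 by rewrite eq_sym -w2 expf_eq0.
  have e5 : 1 != w + 1 by rewrite eq_sym -subr_eq0 addrK.
  have e6 : w != w + 1 by rewrite eq_sym -subr_eq0 addrAC subrr add0r oner_eq0.
  by rewrite /= !inE !negb_or e1 e3 e5 e6 ![_ == w]eq_sym w0 w1.
have : a \in [:: 0; 1; w; w + 1].
  suff E : [set z in [:: 0; 1; w; w + 1]] = [set: F].
    by have := in_setT a; rewrite -E inE.
  by apply/eqP; rewrite eqEcard subsetT cardsT oF cardsE (card_uniqP u4).
by rewrite !inE => /or4P[] /eqP->.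
Qed.

Lemma omega4_sqr_neq1 w : omega4 w -> w ^+ 2 != 1.
Proof. by case/and3P=> w0 _ /eqP->; rewrite -subr_eq0 addrK. Qed.

Lemma omega4_cube w : omega4 w -> w ^+ 3 = 1.
Proof.
case/and3P=> w0 w1 /eqP w2; rewrite exprS w2 mulrDr mulr1 -expr2 w2.
by rewrite addrAC addrr_pchar2 // add0r.
Qed.

Lemma omega4V w : omega4 w -> w^-1 = w + 1.
Proof.
move=> ww; have [w0 _ /eqP <-] := and3P ww.
by apply: (mulfI w0); rewrite divff // -exprS omega4_cube.
Qed.

Fact upper2_group_set : group_set [set upper2 a | a : F].
Proof.
apply/group_setP; split=> [|_ _ /imsetP[a _ ->] /imsetP[b _ ->]].
  by apply/imsetP; exists 0; rewrite // -gl2_1.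
by rewrite upper2D; apply/imsetP; exists (a + b).
Qed.
Definition upper2_group := Group upper2_group_set.

Lemma card_upper2_group : #|upper2_group| = 4.
Proof. by rewrite card_imset ?cardsT //; apply: upper2_inj. Qed.

Lemma order_diag2_omega w : omega4 w -> #[diag2 w]%g = 3.
Proof.
move=> ww; have /and3P[w0 w1 _] := ww.
apply: nt_prime_order => //; first by rewrite diag2X // omega4_cube // /diag2 invr1 gl2_1.
rewrite -gl2_1; apply: contraNneq w1 => /gl2_inj; rewrite diag2_det // mulr1 mulr0 subr0.
by rewrite oner_neq0 => /(_ isT isT)[->].
Qed.

Lemma upper2_group_norm w : w != 0 -> diag2 w \in 'N(upper2_group)%g.
Proof.
move=> w0; rewrite inE; apply/subsetP=> _ /imsetP[_ /imsetP[a _ ->] ->].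
by rewrite upper2_diag2 //; apply/imsetP; exists (a / w ^+ 2).
Qed.

Lemma upper2_group_fpf w : omega4 w -> fpf3 upper2_group (diag2 w).
Proof.
move=> ww; have /and3P[w0 w1 _] := ww.
have x3 : (diag2 w ^+ 3 = 1)%g by rewrite diag2X // omega4_cube // /diag2 invr1 gl2_1.
rewrite /fpf3 upper2_group_norm // x3 eqxx !andTb.
apply/eqP/trivgP/subsetP=> y /setIP[/imsetP[a _ ->] /cent1P c]; rewrite inE.
have : (upper2 a ^ diag2 w)%g = upper2 a by rewrite conjgE c mulKg.
have wn := omega4_sqr_neq1 ww; have w2 : w ^+ 2 != 0 by rewrite expf_neq0.
rewrite upper2_diag2 // => /upper2_inj E.
have : a * (w ^+ 2 - 1) == 0 by rewrite mulrBr mulr1 -{1}E divfK // subrr.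
by rewrite mulf_eq0 subr_eq0 (negPf wn) orbF => /eqP->; rewrite /upper2 gl2_1.
Qed.

Lemma card_SL24 : #|SLgroup 2 F| = 60.
Proof. by rewrite card_SL2 oF. Qed.

Lemma weyl2_notin_norm : weyl2 F \notin 'N(upper2_group)%g.
Proof.
apply/negP; rewrite inE => /subsetP/(_ (upper2 1%R ^ weyl2 F)%g).
rewrite memJ_conjg => /(_ (imset_f _ isT)) /imsetP[a _]; rewrite upper2_weyl2 => /gl2_inj.
rewrite upper2_det !mulr1 mul0r subr0 oner_neq0 => /(_ isT isT)[_ _ /eqP].
by rewrite oppr_eq0 oner_eq0.
Qed.

Lemma SL24_Alt5 : (SLgroup 2 F \isog 'Alt_('I_5))%g.
Proof.
have [w ww] := F4_omega; have /and3P[w0 _ _] := ww.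
apply: (@order60_Alt5 _ (SLgroup_group 2 F) upper2_group (diag2 w)).
- exact: card_SL24.
- by apply/subsetP=> _ /imsetP[a _ ->]; apply: upper2_SL.
- exact: card_upper2_group.
- exact: diag2_SL.
- exact: order_diag2_omega.
- exact: upper2_group_fpf.
apply: contra weyl2_notin_norm => /subsetP; apply; exact: weyl2_SL.
Qed.

(** The generated group contains the Borel subgroup of order 12, whose index 5 is prime, and also
    [weyl2], which lies outside it. *)
Lemma SL24_gen w : omega4 w -> <<[set diag2 w; upper2 1%R; weyl2 F]>>%g = SLgroup 2 F.
Proof.
move=> ww; have /and3P[w0 _ _] := ww; set A := [set _; _; _]%g.
have sAS : <<A>>%g \subset SLgroup 2 F.
  rewrite gen_subG; apply/subsetP=> y /setUP[/set2P[]|/set1P] ->.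
  - exact: diag2_SL.
  - exact: upper2_SL.
  exact: weyl2_SL.
have [Ax Av At] : [/\ diag2 w \in <<A>>%g, upper2 1%R \in <<A>>%g & weyl2 F \in <<A>>%g].
  by split; apply: mem_gen; rewrite !inE eqxx ?orbT.
have sUA : upper2_group \subset <<A>>%g.
  have w2V : (w ^+ 2)^-1 = w.
    have nz : w ^+ 2 != 0 by rewrite expf_neq0.
    by apply: (mulfI nz); rewrite divff // -exprSr omega4_cube.
  have Aw a : upper2 a \in <<A>>%g -> upper2 (a * w)%R \in <<A>>%g.
    by move=> Aa; have := groupJ Aa Ax; rewrite upper2_diag2 // w2V.
  have Aw1 : upper2 w \in <<A>>%g by rewrite -[w]mul1r Aw.
  apply/subsetP=> _ /imsetP[a _ ->]; apply: (@F4_cases w a (fun a => upper2 a \in <<A>>%g) ww) => //.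
  - by rewrite /upper2 gl2_1 group1.
  by case/and3P: (ww) => _ _ /eqP<-; rewrite expr2 Aw.
have oX : #|upper2_group <*> <[diag2 w]>|%g = 12.
  rewrite norm_joinEr ?cycle_subG ?upper2_group_norm // coprime_cardMg.
    by rewrite card_upper2_group -orderE order_diag2_omega.
  by rewrite card_upper2_group -orderE order_diag2_omega.
have sXA : (upper2_group <*> <[diag2 w]>)%g \subset <<A>>%g.
  by rewrite join_subG sUA cycle_subG.
have := cardSg sXA; have := cardSg sAS; rewrite card_SL24 oX.
case/dvdnP=> k kE /dvdnP[m mE].
have km : (m * k = 5)%N by apply/eqP; rewrite -(@eqn_pmul2r 12) // mulnAC -mE mulnC -kE.
apply/eqP; rewrite eqEcard sAS card_SL24 mE.
have [m5|m1] : m = 5 \/ m = 1%N.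
  have : (m %| 5)%N by rewrite -km dvdn_mulr.
  by case: (m) => [|[|[|[|[|[|n]]]]]] //; auto.
  by rewrite m5.
case/negP: weyl2_notin_norm.
have -> : weyl2 F \in 'N(upper2_group)%g.
  have E : (upper2_group <*> <[diag2 w]>)%g = <<A>>%g.
    by apply/eqP; rewrite eqEcard sXA oX mE m1.
  rewrite -E in At; apply: subsetP At.
  by rewrite join_subG normG cycle_subG upper2_group_norm.
by [].
Qed.

End Field4.

(** * Decomposition into natural modules *)

Section Braid.

Import GRing.Theory.
Variable F : finFieldType.
Local Open Scope ring_scope.

(** It expresses the Weyl element through unipotent ones, so the action of [t] on [N] is controlled
    by [v] and [v ^ t]. *)
Lemma weyl2_braid : weyl2 F = (upper2 1%R ^ weyl2 F * upper2 1%R * upper2 1%R ^ weyl2 F)%g.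
Proof.
have e : 1 * 1 - 0 * -1 = 1 :> F by ring.
have e' : 1 * 0 - 1 * -1 = 1 :> F by ring.
rewrite upper2_weyl2 /upper2 /weyl2 gl2M ?upper2_det //.
rewrite [gl2 (_ + _) _ _ _](_ : _ = gl2 1 1 (-1) 0); last by congr gl2; ring.
by rewrite gl2M //; congr gl2; ring.
Qed.

Lemma upper2_lower2_cube :
  ((upper2 1%R * upper2 1%R ^ weyl2 F) ^+ 3)%g = gl2 (-1 : F) 0 0 (-1).
Proof.
have e : 1 * 1 - 0 * -1 = 1 :> F by ring.
have e0 : 0 * 1 - 1 * -1 = 1 :> F by ring.
have e1 : -1 * 0 - 1 * -1 = 1 :> F by ring.
rewrite upper2_weyl2 /upper2 gl2M ?upper2_det //.
rewrite [gl2 (_ + _) _ _ _](_ : _ = gl2 0 1 (-1) 1); last by congr gl2; ring.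
rewrite expgSr -[(_ ^+ 2)%g]/(_ * _)%g gl2M //.
rewrite [gl2 (_ + _) _ _ _](_ : _ = gl2 (-1) 1 (-1) 0); last by congr gl2; ring.
by rewrite gl2M //; congr gl2; ring.
Qed.

Lemma upper2_lower2_neq1 : (upper2 1%R * upper2 1%R ^ weyl2 F)%g != 1%g.
Proof.
have e : 1 * 1 - 0 * -1 = 1 :> F by ring.
rewrite -gl2_1 upper2_weyl2 /upper2 gl2M ?upper2_det //; apply/eqP=> /gl2_inj E.
have [||/eqP] := E.
- rewrite [X in X != 0](_ : _ = 1) ?oner_neq0 //; ring.
- by rewrite upper2_det oner_neq0.
by rewrite !mul1r addrN eq_sym oner_eq0.
Qed.

End Braid.

Section NaturalModule.

Import GRing.Theory.

Variables (gT : finGroupType) (N H : {group gT}) (F : finFieldType).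
Variable f : {morphism H >-> {'GL_2[F]}}.
Hypotheses (charF : 2 \in [pchar F]%R) (oF : #|F| = 4).
Hypotheses (nNH : H \subset 'N(N)) (cNN : abelian N) (N2 : forall a, a \in N -> a * a = 1).
Hypothesis fpfN : forall y, y \in H -> #[y] = 3 -> fpf3 N y.
Hypothesis isof : isom H (SLgroup 2 F) f.
(** Quadratic action of the unitriangular group on [N]; it will come from the class-two bound for
    their product, and makes ['C_N[v]] invariant under [x]. *)
Hypothesis cQ : forall a y z, a \in N -> y \in H -> z \in H ->
  f y \in upper2_group F -> f z \in upper2_group F -> commute [~ a, y] z.

Section Generators.

Variables (w : F) (x v t : gT).
Hypotheses (ww : omega4 w) (Hx : x \in H) (Hv : v \in H) (Ht : t \in H).
Hypotheses (fx : f x = diag2 w) (fv : f v = upper2 1%R) (ft : f t = weyl2 F).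

Lemma iso_inj y z : y \in H -> z \in H -> f y = f z -> y = z.
Proof. by have [/injmP inj _] := isomP isof; apply: inj. Qed.

Let w0 : (w != 0)%R. Proof. by case/and3P: ww. Qed.
Let v' := v ^ t.
Let Hv' : v' \in H. Proof. exact: groupJ. Qed.
Let Nm1 : (-1 = 1 :> F)%R. Proof. by rewrite oppr_pchar2. Qed.

Lemma module_vv : v * v = 1.
Proof.
by apply: iso_inj; rewrite ?groupM // morph1 morphM // fv upper2D addrr_pchar2 // /upper2 gl2_1.
Qed.

Lemma module_tt : t * t = 1.
Proof. by apply: iso_inj; rewrite ?groupM // morph1 morphM // ft weyl2_sqr Nm1 gl2_1. Qed.

Lemma module_xt : x ^ t = x^-1.
Proof.
apply: iso_inj; rewrite ?groupJ ?groupV // morphJ // morphV // fx ft diag2_weyl2 //.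
by apply/eqP; rewrite eq_sym eq_invg_mul diag2M ?invr_neq0 // divff // /diag2 invr1 gl2_1.
Qed.

Lemma module_ox : #[x] = 3.
Proof.
have [inj _] := isomP isof.
by rewrite -(order_injm inj Hx) fx order_diag2_omega.
Qed.

Lemma module_braid : t = v' * v * v'.
Proof.
have Hvv := groupM Hv' Hv.
apply: iso_inj; rewrite ?(groupM Hvv) // morphM // morphM // morphJ // fv ft.
exact: weyl2_braid.
Qed.

Lemma module_ovv' : #[v * v'] = 3.
Proof.
have [inj _] := isomP isof; have Hvv : v * v' \in H by rewrite groupM.
rewrite -(order_injm inj Hvv) morphM // morphJ // fv ft.
apply: nt_prime_order => //; last exact: upper2_lower2_neq1.
by rewrite upper2_lower2_cube Nm1 gl2_1.
Qed.

Let NJ a y : a \in N -> y \in H -> a ^ y \in N.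
Proof. by move=> Na Hy; rewrite memJ_norm // (subsetP nNH). Qed.

Let NV a : a \in N -> a^-1 = a.
Proof. by move=> Na; apply/eqP; rewrite eq_invg_mul N2. Qed.

Let NC a b : a \in N -> b \in N -> a * b = b * a.
Proof. by move=> Na Nb; apply: (centsP cNN). Qed.

Let NCA a b c : a \in N -> b \in N -> a * (b * c) = b * (a * c).
Proof. by move=> Na Nb; rewrite mulgA (NC Na Nb) mulgA. Qed.

Let Nvv : fpf3 N (v * v'). Proof. by apply: fpfN; [rewrite groupM | exact: module_ovv']. Qed.

Lemma module_TI a : a \in 'C_N[v] -> a \in 'C_N[v'] -> a = 1.
Proof.
case/setIP=> Na /cent1P cv /setIP[_ /cent1P cv'].
have /and3P[_ _ /eqP C1] := Nvv.
have : a \in 'C_N[v * v'] by rewrite inE Na; apply/cent1P/commuteM.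
by rewrite C1 => /set1P.
Qed.

Lemma module_comm y a : y \in H -> y * y = 1 -> a \in N -> [~ a, y] \in 'C_N[y].
Proof.
move=> Hy yy Na; have Ny := NJ Na Hy; rewrite inE commgEl groupM ?groupV //=.
apply/cent1P; apply/commgP/conjg_fixP; rewrite conjMg conjVg -conjgM yy conjg1.
by rewrite (NV Ny) (NV Na) NC.
Qed.

Let v'v' : v' * v' = 1. Proof. by rewrite -conjMg module_vv conj1g. Qed.

(* v * v' has order three, so a = b^-1 * b ^ (v * v') for some b. *)
Lemma module_dec a : a \in N ->
  exists b c, [/\ b \in N, c \in N & a = [~ b, v] * [~ c, v']].
Proof.
move=> Na; have [b Nb ->] := fpf3_surj Nvv Na.
exists b, (b ^ v); rewrite NJ //; split=> //.
by rewrite !commgEl conjgM -mulgA mulKVg.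
Qed.

(** In the decomposition of [a] by [module_dec], the commutator with [v'] is centralized by both [v]
    and [v'], hence trivial. *)
Lemma module_centE a : a \in 'C_N[v] -> exists2 b, b \in N & a = [~ b, v].
Proof.
move=> Ca; have Na : a \in N by case/setIP: Ca.
have [b [c [Nb Nc E]]] := module_dec Na; exists b => //.
have Cb := module_comm Hv module_vv Nb; have Cc := module_comm Hv' v'v' Nc.
have c1 : [~ c, v'] = 1.
  apply: module_TI => //; rewrite -[[~ c, v']](mulKg [~ b, v]) -E.
  by rewrite groupM ?groupV.
by rewrite E c1 mulg1.
Qed.

(** An element of ['C_N[v]] is some [[~ b, v]], which by [cQ] commutes with the unitriangular
    element [v ^ x]; equality of orders does the rest. *)
Lemma module_xnorm : x \in 'N('C_N[v]).
Proof.
have Nx : x \in 'N(N) by rewrite (subsetP nNH).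
have E : 'C_N[v] :^ x = 'C_N[v ^ x] by rewrite conjIg (normP Nx) -normJ conjg_set1.
apply/normP; rewrite E; apply/eqP; rewrite eq_sym eqEcard; apply/andP; split; last first.
  by rewrite -E cardJg.
apply/subsetP=> a Ca; have Na : a \in N by case/setIP: Ca.
have [b Nb ->] := module_centE Ca; rewrite inE.
rewrite (subsetP (subsetIl N 'C[v])) ?module_comm ?module_vv //=.
apply/cent1P; apply: cQ; rewrite ?groupJ //; first by rewrite fv; apply/imsetP; exists 1%R.
by rewrite morphJ // fv fx upper2_diag2 //; apply/imsetP; exists (1 / w ^+ 2)%R.
Qed.

(** By the braid relation [b ^ t = b ^ (v * v')], and from this the quotient of the two sides is
    seen to lie in both ['C_N[v]] and ['C_N[v']]. It makes [v] act as a transvection on the blocks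
    below. *)
Lemma module_weyl_v b : b \in 'C_N[v'] -> [~ b, v] = b ^ t.
Proof.
move=> Cb; have [Nb /cent1P cbv'] := setIP Cb.
have bv' : b ^ v' = b by apply/conjg_fixP/commgP.
have Nbt := NJ Nb Ht; have Nbv := NJ Nb Hv.
have E : b ^ t = (b ^ v) ^ v' by rewrite -{2}bv' -!conjgM mulgA -module_braid.
have v't : v' ^ t = v by rewrite -conjgM module_tt conjg1.
have Cbt : b ^ t \in 'C_N[v].
  rewrite inE Nbt; apply/cent1P/commgP; rewrite -v't -conjRg; apply/eqP.
  by rewrite (_ : [~ b, v'] = 1) ?conj1g //; apply/eqP/commgP.
have Cc := module_comm Hv module_vv Nb.
have Cct : [~ b, v] ^ t \in 'C_N[v'].
  have := module_comm Hv' v'v' Nbt; by rewrite -conjRg.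
have E2 : b * [~ b, v] = b ^ t * [~ b, v] ^ t.
  rewrite conjRg -/v' commgEl mulgA mulgV mul1g.
  by rewrite commgEl mulKVg E -conjgM v'v' conjg1.
apply/eqP; rewrite eq_mulgV1; apply/eqP/module_TI; first by rewrite groupM ?groupV.
have Nc : [~ b, v] \in N by case/setIP: Cc.
have -> : [~ b, v] * (b ^ t)^-1 = b^-1 * [~ b, v] ^ t.
  have Nct : [~ b, v] ^ t \in N by case/setIP: Cct.
  by apply: (mulgI b); rewrite mulKVg mulgA E2 (NC Nbt Nct) mulgK.
by rewrite groupM ?groupV.
Qed.

Section Block.

Variable b : gT.
Hypotheses (Cb : b \in 'C_N[v']) (nt_b : b != 1).

Let c := b ^ x.

(* The GF(4)-line through b, the scalar w acting as conjugation by x. *)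
Definition F4_map (a : F) : gT :=
  if a == 0%R then 1 else if a == 1%R then b else if a == w then c else b * c.

Let Nb : b \in N. Proof. by case/setIP: Cb. Qed.
Let Nc : c \in N. Proof. exact: NJ. Qed.
Let Cc : c \in 'C_N[v'].
Proof.
have nx : x \in 'N('C_N[v]) := module_xnorm.
have nt : t \in 'N(N) by rewrite (subsetP nNH).
have E : 'C_N[v'] = 'C_N[v] :^ t by rewrite conjIg (normP nt) -normJ conjg_set1.
rewrite E mem_conjg /c; have -> : (b ^ x) ^ t^-1 = (b ^ t^-1) ^ x^-1.
  rewrite -!conjgM; congr (_ ^ _); rewrite -module_xt.
  have tV : t^-1 = t by apply/eqP; rewrite eq_invg_mul module_tt.
  by rewrite conjgE tV !mulgA module_tt mul1g.
by rewrite memJ_norm ?groupV // -mem_conjg -E.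
Qed.

Let bb : b * b = 1. Proof. exact: N2. Qed.
Let cc : c * c = 1. Proof. exact: N2. Qed.
Let cb : c * b = b * c. Proof. exact: NC. Qed.

Let F4_neq : [/\ (1 != 0 :> F)%R, (w != 0)%R, (w != 1)%R &
  [/\ (w + 1 != 0)%R, (w + 1 != 1)%R & (w + 1 != w)%R]].
Proof.
have /and3P[_ w1 /eqP w2] := ww; split; [by rewrite oner_eq0|by []|by []|split].
- by rewrite -w2 expf_eq0.
- by rewrite -subr_eq0 addrK.
by rewrite -subr_eq0 addrAC subrr add0r oner_eq0.
Qed.

Let F4_mapE : [/\ F4_map 0%R = 1, F4_map 1%R = b, F4_map w = c & F4_map (w + 1)%R = b * c].
Proof.
have [n1 nw nw1 [nv nv1 nvw]] := F4_neq.
by rewrite /F4_map !eqxx !(negPf n1) (negPf nw) (negPf nw1) (negPf nv) (negPf nv1) (negPf nvw).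
Qed.

Lemma F4_mapD : {morph F4_map : a a' / (a + a')%R >-> a * a'}.
Proof.
have [s0 s1 sw sv] := F4_mapE; have d (a : F) : (a + a = 0)%R by rewrite addrr_pchar2.
have k1 : b * (b * c) = c by rewrite mulgA bb mul1g.
have k2 : c * (b * c) = b by rewrite mulgA cb -mulgA cc mulg1.
have k3 : (b * c) * b = c by rewrite -mulgA cb k1.
have k4 : (b * c) * c = b by rewrite -mulgA cc mulg1.
have k5 : (b * c) * (b * c) = 1 by rewrite -mulgA k2 bb.
have e1 : (1 + w = w + 1)%R by rewrite addrC.
have e2 : (1 + (w + 1) = w)%R by rewrite addrCA d addr0.
have e3 : (w + (w + 1) = 1)%R by rewrite addrA d add0r.
have e4 : ((w + 1) + 1 = w)%R by rewrite -addrA d addr0.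
have e5 : ((w + 1) + w = 1)%R by rewrite addrAC d add0r.
move=> a a'; apply: (@F4_cases F oF w a (fun z => F4_map (z + a')%R = F4_map z * F4_map a') ww).
- by rewrite add0r s0 mul1g.
- apply: (@F4_cases F oF w a' (fun z => F4_map (1 + z)%R = F4_map 1%R * F4_map z) ww);
    by rewrite ?e1 ?e2 ?d ?addr0 ?s0 ?s1 ?sw ?sv ?mulg1.
- apply: (@F4_cases F oF w a' (fun z => F4_map (w + z)%R = F4_map w * F4_map z) ww);
    by rewrite ?e3 ?d ?addr0 ?s0 ?s1 ?sw ?sv ?mulg1.
apply: (@F4_cases F oF w a' (fun z => F4_map (w + 1 + z)%R = F4_map (w + 1)%R * F4_map z) ww);
  by rewrite ?e4 ?e5 ?d ?addr0 ?s0 ?s1 ?sw ?sv ?mulg1.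
Qed.

Lemma F4_map_in a : F4_map a \in 'C_N[v'].
Proof.
rewrite /F4_map; case: ifP => _; first exact: group1.
by case: ifP => _ //; case: ifP => _ //; apply: groupM.
Qed.

(** [b * b ^ x * b ^ (x ^+ 2) = 1] plays the part of [1 + w + w ^+ 2 = 0]. *)
Lemma F4_map_x a : F4_map (w * a)%R = F4_map a ^ x.
Proof.
have [s0 s1 sw sv] := F4_mapE; have /and3P[_ _ /eqP w2] := ww.
have px := fpf3_prod (fpfN Hx module_ox) Nb.
have cx : c ^ x = b * c.
  rewrite -conjgM -[x * x]/(x ^+ 2); apply: (mulgI (b * c)); rewrite px.
  by rewrite -mulgA [c * _]mulgA cb -mulgA cc mulg1 bb.
apply: (@F4_cases F oF w a (fun a => F4_map (w * a)%R = F4_map a ^ x) ww).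
- by rewrite mulr0 s0 conj1g.
- by rewrite mulr1 s1.
- by rewrite -expr2 w2 sw cx sv.
have -> : (w * (w + 1) = 1)%R by rewrite -w2 -exprS omega4_cube.
by rewrite sv s1 conjMg cx -/c mulgA cb -mulgA cc mulg1.
Qed.

Lemma F4_map_inj a : F4_map a = 1 -> a = 0%R.
Proof.
have [s0 s1 sw sv] := F4_mapE.
have ntc : c != 1 by rewrite -(conj1g x) (inj_eq (conjg_inj x)).
apply: (@F4_cases F oF w a (fun a => F4_map a = 1 -> a = 0%R) ww) => //.
- by rewrite s1 => E; case/eqP: nt_b.
- by rewrite sw => E; rewrite E eqxx in ntc.
rewrite sv => /(congr1 (mulg b)); rewrite mulgA bb mul1g mulg1 => E.
have /and3P[_ _ /eqP C1] := fpfN Hx module_ox.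
have : b \in 'C_N[x] by rewrite inE Nb; apply/cent1P/commgP/conjg_fixP.
by rewrite C1 => /set1P E1; case/eqP: nt_b.
Qed.

(* Row vectors (r0, r1) with r0 in the line through b and r1 in its t-conjugate. *)
Definition block_map (r : 'rV[F]_2) : gT := F4_map (r 0%R 0%R) * F4_map (r 0%R 1%R) ^ t.

Let sN a : F4_map a \in N. Proof. by case/setIP: (F4_map_in a). Qed.
Let stN a : F4_map a ^ t \in N. Proof. exact: NJ. Qed.

Fact block_mapM : {in [set: 'rV[F]_2] &, {morph block_map : r s / r * s}}.
Proof.
move=> r s _ _; rewrite /block_map !mxE !F4_mapD [(_ * _) ^ t]conjMg.
rewrite -[LHS]mulgA -[RHS]mulgA; congr (_ * _); exact: NCA.
Qed.
Canonical block_morphism := Morphism block_mapM.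

Lemma block_map_in r : block_map r \in N.
Proof. by rewrite groupM. Qed.

Lemma F4_map_tv a : F4_map a ^ t \in 'C_N[v].
Proof. by rewrite -module_weyl_v ?F4_map_in // module_comm // module_vv. Qed.

Lemma block_map_inj : 'injm block_map.
Proof.
apply/subsetP=> r /morphpreP[_ /set1P/= E].
have s01 : F4_map (r 0%R 0%R) = F4_map (r 0%R 1%R) ^ t.
  by apply/eqP; rewrite eq_mulgV1 (NV (stN _)) -[X in X == _]/(block_map r) E.
have s0 : F4_map (r 0%R 0%R) = 1.
  by apply: module_TI; rewrite ?F4_map_in // s01 F4_map_tv.
have s1 : F4_map (r 0%R 1%R) = 1 by apply: (conjg_inj t); rewrite -s01 s0 conj1g.
apply/set1P/matrixP=> i j; rewrite !mxE ord1.
have [->|->] : j = 0%R \/ j = 1%R.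
  by case: j => -[|[|j]] lt //; [left|right]; apply: val_inj.
- exact: F4_map_inj.
exact: F4_map_inj.
Qed.

Lemma rV2_mx2 (r : 'rV[F]_2) a1 a2 a3 a4 : ((r *m mx2 a1 a2 a3 a4) 0 0 = r 0 0 * a1 + r 0 1 * a3 /\
  (r *m mx2 a1 a2 a3 a4) 0 1 = r 0 0 * a2 + r 0 1 * a4)%R.
Proof.
rewrite !mxE !big_ord_recl !big_ord0 !mxE /= !addr0.
by have -> : lift ord0 ord0 = 1%R :> 'I_2 by apply: val_inj.
Qed.

Definition block_equivariant h := forall r, block_map (r *m GLval (f h))%R = block_map r ^ h.

Lemma block_x : block_equivariant x.
Proof.
move=> r; rewrite fx gl2E ?diag2_det ?oner_neq0 // /block_map.
have [-> ->] := rV2_mx2 r w 0%R 0%R w^-1%R.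
rewrite !mulr0 addr0 add0r conjMg mulrC F4_map_x; congr (_ * _).
have tx : t * x = x^-1 * t by rewrite [RHS]conjgC conjVg module_xt invgK.
rewrite -[RHS]conjgM tx [RHS]conjgM; congr (_ ^ _); apply: (canRL (conjgK x)).
by rewrite -F4_map_x mulrCA divff ?mulr1.
Qed.

Lemma block_t : block_equivariant t.
Proof.
move=> r; rewrite ft gl2E ?weyl2_det ?oner_neq0 // /block_map.
have [-> ->] := rV2_mx2 r 0%R 1%R (-1)%R 0%R.
rewrite !mulr0 addr0 add0r mulr1 Nm1 mulr1 conjMg -conjgM module_tt conjg1.
exact: NC.
Qed.

Lemma block_v : block_equivariant v.
Proof.
move=> r; rewrite fv gl2E ?upper2_det ?oner_neq0 // /block_map.
have [-> ->] := rV2_mx2 r 1%R 1%R 0%R 1%R.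
rewrite !mulr0 addr0 !mulr1 F4_mapD [(_ * _) ^ t]conjMg [RHS]conjMg mulgA.
have -> : (F4_map (r 0%R 1%R) ^ t) ^ v = F4_map (r 0%R 1%R) ^ t.
  by apply/conjg_fixP/commgP/cent1P; case/setIP: (F4_map_tv (r 0%R 1%R)).
by congr (_ * _); rewrite -[_ ^ t]module_weyl_v ?F4_map_in // commgEl mulKVg.
Qed.

Lemma module_gen : <<[set x; v; t]>> = H.
Proof.
have [injf imf] := isomP isof.
have sAH : [set x; v; t] \subset H.
  by apply/subsetP=> y; rewrite !inE -orbA => /or3P[] /eqP->.
have sgH : <<[set x; v; t]>> \subset H by rewrite gen_subG.
apply: (injm_morphim_inj injf sgH (subxx H)).
rewrite morphim_gen // imf; apply: etrans (SL24_gen charF oF ww); congr <<_>>.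
by rewrite !morphimU !morphim_set1 // fx fv ft.
Qed.

Lemma block_H h : h \in H -> block_equivariant h.
Proof.
pose K := [set h in H | [forall r, block_map (r *m GLval (f h))%R == block_map r ^ h]].
have gK : group_set K.
  apply/group_setP; split=> [|y z].
    by rewrite inE group1; apply/forallP=> r; rewrite morph1 mulmx1 conjg1.
  rewrite !inE => /andP[Hy /forallP Ey] /andP[Hz /forallP Ez]; rewrite groupM //.
  apply/forallP=> r; rewrite morphM // GL_MxE mulmxA (eqP (Ez _)) (eqP (Ey _)).
  by rewrite conjgM.
have sHK : H \subset Group gK.
  rewrite -{1}module_gen gen_subG; apply/subsetP=> y; rewrite !inE -orbA.
  case/or3P=> /eqP->; rewrite ?Hx ?Hv ?Ht; apply/forallP=> r; apply/eqP.
  - exact: block_x.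
  - exact: block_v.
  exact: block_t.
by move/(subsetP sHK); rewrite inE => /andP[_ /forallP E] r; apply/eqP.
Qed.

Definition block := (block_map @* [set: 'rV[F]_2])%G.

Lemma block_natural : H \subset 'N(block) /\
  exists g : {morphism block >-> 'rV[F]_2},
    isom block [set: 'rV[F]_2] g /\
    (forall y h, y \in block -> h \in H -> g (y ^ h) = (g y *m GLval (f h))%R).
Proof.
split.
  apply/subsetP=> h Hh; rewrite inE; apply/subsetP=> _ /imsetP[_ /morphimP[r _ _ ->] ->].
  by rewrite /= -block_H //; apply: mem_morphim; rewrite inE.
exists [morphism of invm block_map_inj]; split.
  by apply/isomP; rewrite injm_invm /= im_invm.
move=> _ h /morphimP[r _ _ ->] Hh; rewrite /= -block_H //.
by rewrite !invmE ?inE.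
Qed.

Lemma block_sub : block \subset N.
Proof. by apply/subsetP=> _ /morphimP[r _ _ ->]; apply: block_map_in. Qed.

Lemma block_b : b \in block.
Proof.
have [s0 s1 _ _] := F4_mapE.
have -> : b = block_map (\row_j (if j == 0%R then 1%R else 0%R)).
  by rewrite /block_map !mxE /= s1 s0 conj1g mulg1.
by apply: mem_morphim; rewrite inE.
Qed.

(** Irreducibility by hand: the commutator with [v] isolates the first coordinate of an element of
    [C], after which the second remains. A nonzero coordinate would put [b] into [C] after scaling
    by powers of [x]. *)
Lemma block_TI (C : {group gT}) : H \subset 'N(C) -> b \notin C -> block :&: C = 1.
Proof.
move=> nCH nCb; have CJ y h : h \in H -> y \in C -> y ^ h \in C.
  by move=> Hh Cy; rewrite memJ_norm // (subsetP nCH).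
have [s0 s1 _ _] := F4_mapE.
have key a : F4_map a \in C -> a = 0%R.
  have sx z : F4_map (w * z)%R \in C -> F4_map z \in C.
    by rewrite F4_map_x memJ_norm // (subsetP nCH).
  move=> Ca; apply: contraNeq nCb => nza; have Cwa := sx (w^-1 * a)%R.
  rewrite mulVKf // in Cwa; have {}Cwa := Cwa Ca.
  have Cwwa := sx (w^-1 * (w^-1 * a))%R.
  rewrite mulVKf // in Cwwa; have {}Cwwa := Cwwa Cwa.
  move: Ca Cwa Cwwa nza; rewrite (omega4V charF ww); have /and3P[_ _ /eqP w2] := ww.
  have ww1 : ((w + 1) * w = 1)%R by rewrite mulrC -w2 -exprS omega4_cube.
  apply: (@F4_cases F oF w a (fun a => F4_map a \in C -> F4_map ((w + 1) * a)%R \in C ->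
    F4_map ((w + 1) * ((w + 1) * a))%R \in C -> (a != 0)%R -> b \in C) ww); rewrite ?eqxx //.
  - by rewrite s1.
  - by rewrite ww1 s1.
  move=> _ _; rewrite -[X in (X * (X * X))%R](omega4V charF ww).
  by rewrite -expr2 -exprS exprVn omega4_cube // invr1 s1.
apply/trivgP/subsetP=> _ /setIP[/morphimP[r _ _ ->] Cr]; apply/set1P => /=.
have r0 : r 0%R 0%R = 0%R.
  apply: key; have Cv : block_map r ^ v * (block_map r)^-1 \in C.
    by rewrite groupM ?groupV ?CJ.
  have E : block_map r ^ v * (block_map r)^-1 = F4_map (r 0%R 0%R) ^ t.
    apply: (canLR (mulgK _)); rewrite -block_v /block_map fv gl2E ?upper2_det ?oner_neq0 //.
    have [-> ->] := rV2_mx2 r 1%R 1%R 0%R 1%R.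
    rewrite !mulr0 addr0 !mulr1 F4_mapD [(_ * _) ^ t]conjMg; exact: NCA.
  by rewrite E in Cv; have := CJ _ _ Ht Cv; rewrite -conjgM module_tt conjg1.
have r1 : r 0%R 1%R = 0%R.
  apply: key; move: Cr; rewrite /= /block_map r0 s0 mul1g => /(CJ _ _ Ht).
  by rewrite -conjgM module_tt conjg1.
by rewrite /block_map r0 r1 s0 conj1g mulg1.
Qed.

End Block.

(** [n] serves as fuel: as long as [C] is not [N], a block meeting it trivially is added. Used with
    [#|N|.+1], where the size bound is impossible. *)
Lemma natural_decomposition_step n : exists (k : nat) (V : 'I_k -> {group gT}) (C : {group gT}),
  [/\ \big[dprod/1]_(i < k) V i = C, C \subset N, H \subset 'N(C),
      forall i, H \subset 'N(V i) /\
        exists g : {morphism V i >-> 'rV[F]_2},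
          isom (V i) [set: 'rV[F]_2] g /\
          (forall y h, y \in V i -> h \in H -> g (y ^ h) = (g y *m GLval (f h))%R)
    & C = N \/ n <= #|C|].
Proof.
elim: n => [|n [k [V [C [VC sCN nCH natV CN]]]]].
  exists 0, (fun _ => 1%G), 1%G; split; rewrite ?big_ord0 ?sub1G ?norm1 ?subsetT //.
    by case.
  by right.
case: CN => [CN|ltC]; first by exists k, V, C; split=> //; left.
have [sNC|nsNC] := boolP (N \subset C).
  by exists k, V, C; split=> //; left; apply/val_inj/eqP; rewrite eqEsubset sCN.
have CJ y h : h \in H -> y \in C -> y ^ h \in C.
  by move=> Hh Cy; rewrite memJ_norm // (subsetP nCH).
(* Commutators with [v] and [v'] generate [N], and [t] exchanges the two fixed-point groups; an
   invariant [C] above one of them is therefore all of [N]. *)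
have nsW : ~~ ('C_N[v'] \subset C).
  apply: contra nsNC => sWC; apply/subsetP=> a /module_dec[b [c [Nb Nc ->]]].
  have Cc := module_comm Hv' v'v' Nc.
  rewrite groupM ?(subsetP sWC _ Cc) //.
  have Cb : [~ b, v] ^ t \in 'C_N[v'].
    have := module_comm Hv module_vv Nb; case/setIP=> Nbv /cent1P cbv.
    rewrite inE NJ //; apply/cent1P/commgP; rewrite -conjRg.
    by rewrite (_ : [~ _, v] = 1) ?conj1g //; apply/eqP/commgP.
  by have := CJ _ _ Ht (subsetP sWC _ Cb); rewrite -conjgM module_tt conjg1.
have [b Cb nCb] := subsetPn nsW.
have ntb : b != 1 by apply: contraNneq nCb => ->.
have TI := block_TI Cb nCH nCb.
have sBN := block_sub Cb; have [nBH natB] := block_natural Cb ntb.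
have cBC : C \subset 'C(block Cb) := subset_trans sCN (subset_trans cNN (centS sBN)).
exists k.+1, (fun i => if unlift ord0 i is Some j then V j else block Cb), (block Cb <*> C)%G.
split.
- rewrite big_ord_recl unlift_none; under eq_bigr do rewrite liftK.
  by rewrite VC dprodEY.
- by rewrite join_subG sBN.
- by rewrite normsY.
- by move=> i; case: (unlift ord0 i).
right; have -> : #|(block Cb <*> C)%G| = (#|block Cb| * #|C|)%N.
  by rewrite -(dprod_card (dprodEY cBC TI)).
apply: leq_ltn_trans ltC _; rewrite ltn_Pmull ?cardG_gt0 // cardG_gt1.
by apply/trivgPn; exists b; rewrite ?block_b.
Qed.

End Generators.

Theorem natural_decomposition : exists (k : nat) (V : 'I_k -> {group gT}),
  \big[dprod/1]_(i < k) V i = N /\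
  forall i, H \subset 'N(V i) /\
    exists g : {morphism V i >-> 'rV[F]_2},
      isom (V i) [set: 'rV[F]_2] g /\
      (forall y h, y \in V i -> h \in H -> g (y ^ h) = (g y *m GLval (f h))%R).
Proof.
have [injf imf] := isomP isof; have [w ww] := F4_omega charF oF.
have w0 : (w != 0)%R by case/and3P: ww.
have pre A : A \in SLgroup 2 F -> exists2 y, y \in H & f y = A.
  by rewrite -imf => /morphimP[y Hy _ ->]; exists y.
have [x Hx fx] := pre _ (diag2_SL w0); have [v Hv fv] := pre _ (upper2_SL 1%R).
have [t Ht ft] := pre _ (weyl2_SL F).
have [k [V [C [VC sCN _ natV [CN|]]]]] := natural_decomposition_step ww Hx Hv Ht fx fv ft #|N|.+1.
  by exists k, V; rewrite VC CN.
by rewrite ltnNge subset_leq_card.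
Qed.

End NaturalModule.

(** * Lifting from the quotient by the 3'-core *)

Lemma order6_dihedral (gT : finGroupType) (H : {group gT}) a b :
    #|H| = 6 -> a \in H -> b \in H -> #[a] = 2 -> #[b] = 2 -> a != b ->
  H \isog [set: 'D_6].
Proof.
move=> oH Ha Hb oa ob neab; pose L := <<[set a; b]>>.
have sLH : L \subset H by rewrite gen_subG; apply/subsetP=> y /set2P[]->.
have La : a \in L by rewrite mem_gen ?set21.
have Lb : b \in L by rewrite mem_gen ?set22.
have nt y : #[y] = 2 -> y != 1 by move=> oy; rewrite -order_gt1 oy.
have oL : #|L| = 6.
  have L3 : 2 < #|L|.
    have sub : [set 1; a; b] \subset L by apply/subsetP=> y; rewrite !inE -orbA => /or3P[]/eqP->.
    apply: leq_trans (subset_leq_card sub).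
    by rewrite -setUA cardsU1 !inE negb_or cards2 neab ![1 == _]eq_sym !nt.
  have := cardSg sLH; rewrite oH; have := order_dvdG La; rewrite oa.
  by move: #|L| L3 => -[|[|[|[|[|[|[|n]]]]]]].
have <- : L = H by apply/eqP; rewrite eqEcard sLH oL oH.
by have := involutions_gen_dihedral oa ob neab; rewrite -/L oL.
Qed.

Lemma Sym3_dihedral : 'Sym_('I_3) \isog [set: 'D_6].
Proof.
have oS : #|'Sym_('I_3)| = 6 by rewrite card_Sym card_ord.
pose o0 : 'I_3 := inord 0; pose o1 : 'I_3 := inord 1; pose o2 : 'I_3 := inord 2.
have e01 : o0 != o1 by rewrite -val_eqE /= !inordK.
have e12 : o1 != o2 by rewrite -val_eqE /= !inordK.
have e02 : o0 != o2 by rewrite -val_eqE /= !inordK.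
have ot (i j : 'I_3) : i != j -> #[tperm i j] = 2.
  move=> ne; apply: nt_prime_order => //; first exact: tperm2.
  by apply: contra ne => /eqP/permP/(_ i); rewrite tpermL perm1 => ->.
have e10 : o1 != o0 by rewrite eq_sym.
have e20 : o2 != o0 by rewrite eq_sym.
apply: (order6_dihedral oS _ _ (ot _ _ e01) (ot _ _ e12)); rewrite ?inE //.
apply: contra e01 => /eqP/permP/(_ o0).
by rewrite tpermL (tpermD e10 e20) => ->.
Qed.

Lemma order6_Sym3 (gT : finGroupType) (H : {group gT}) x t :
    #|H| = 6 -> x \in H -> t \in H -> #[x] = 3 -> #[t] = 2 -> x ^ t = x^-1 ->
  H \isog 'Sym_('I_3).
Proof.
move=> oH Hx Ht ox ot xt.
have tt : t * t = 1 by rewrite -[t * t]/(t ^+ 2) -ot expg_order.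
have ntx : x != 1 by rewrite -order_gt1 ox.
have otx : #[t * x] = 2.
  apply: nt_prime_order => //.
    rewrite -[(t * x) ^+ 2]/(t * x * (t * x)) -mulgA [x * (t * x)](_ : _ = t) //.
    by rewrite mulgA [x * t]conjgC xt mulgKV.
  apply/eqP=> E; have xE : x = t^-1 by apply: (mulgI t); rewrite E mulgV.
  by move: ox; rewrite xE orderV ot.
apply: isog_trans (order6_dihedral oH Ht _ ot otx _) _.
- exact: groupM.
- by rewrite -{1}[t]mulg1 (inj_eq (mulgI t)) eq_sym.
by rewrite isog_sym; apply: Sym3_dihedral.
Qed.

Section Lifting.

Variables (gT : finGroupType) (G : {group gT}) (x : gT).
Hypothesis sc : selfcent3 G x.
Local Notation K := 'O_3^'(G).
Implicit Types (W V : {group gT}).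

Lemma selfcent3_order3 y : y \in G -> #[y] = 3 -> selfcent3 G y.
Proof.
move=> Gy oy; have [g Gg E] := selfcent3_conj sc Gy oy.
have /and3P[Gx _ /eqP CX] := sc.
by rewrite /selfcent3 Gy oy eqxx /= -cent_cycle E cycleJ centJ -{1}(conjGid Gg) -conjIg cent_cycle CX.
Qed.

Lemma order3_fpf_core y : y \in G -> #[y] = 3 -> fpf3 K y.
Proof.
move=> Gy oy; have scy := selfcent3_order3 Gy oy.
exact: inv3_fpf scy (inv3_core scy).
Qed.

Lemma order3_fixed_point_free y : y \in G -> #[y] = 3 ->
  fixed_point_free_aut 'O_3^'(G)%G (conj_aut 'O_3^'(G)%G y).
Proof.
move=> Gy oy; have /and3P[Ny _ /eqP C1] := order3_fpf_core Gy oy.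
split=> [|a Ka]; first exact: Aut_aut.
rewrite norm_conj_autE // => E.
have : a \in 'C_K[y] by rewrite inE Ka; apply/cent1P/commgP/conjg_fixP.
by rewrite C1 => /set1P.
Qed.

Lemma core_card_mod3 : #|'O_3^'(G)%G| = 1 %[mod 3].
Proof. exact: inv3_card sc (inv3_core sc). Qed.

(** For index 6 the complement is ['N_G(<[x]>)], whose intersection with the core commutes with [x]
    and is trivial. A self-normalizing [<[x]>] is ruled out by the Frattini argument in [K <*>
    <[x]>]. *)
Lemma index3_6_sdprod : #|G / K| \in [:: 3; 6] ->
  exists C : {group gT}, K ><| C = G /\ (C \isog [set: 'Z_3] \/ C \isog 'Sym_('I_3)).
Proof.
have nKG := pcore_normal 3^' G; have [sKG nGK] := andP nKG.
have K3 : 3^'.-group K := pcore_pgroup _ _.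
have /and3P[Gx /eqP ox /eqP CX] := sc.
rewrite card_quotient // !inE => iK.
have sXG : <[x]> \subset G by rewrite cycle_subG.
have tiKX : K :&: <[x]> = 1.
  by apply: coprime_TIg; rewrite -orderE ox coprime_sym; apply: p'nat_coprime K3.
have oG := Lagrange sKG.
have nXK : <[x]> \subset 'N(K) := subset_trans sXG nGK.
have oKX : #|K <*> <[x]>| = (#|K| * 3)%N.
  by rewrite norm_joinEr // TI_cardMg // -orderE ox.
have sKX : K <*> <[x]> \subset G by rewrite join_subG sKG.
case/orP: iK => /eqP iK; rewrite iK in oG.
  exists <[x]>%G; split.
    rewrite sdprodE //; apply/eqP; rewrite -norm_joinEr // eqEcard sKX oKX oG leqnn //.
  left; have cZ : cyclic [set: 'Z_3] by apply/cyclicP; exists Zp1; apply: Zp_cycle.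
  by rewrite (isog_cyclic_card [set: 'Z_3]) ?cycle_cyclic // cZ cardsT card_ord -orderE ox.
have [NX|[t [Gt ot xt oN]]] := selfcent3_norm sc; last first.
  exists 'N_G(<[x]>)%G; split; last first.
    right; apply: (@order6_Sym3 _ _ x t) => //.
      by rewrite inE Gx -cycle_subG normG.
    by rewrite inE Gt -cycle_subG norms_cycle xt groupV cycle_id.
  have sNG : 'N_G(<[x]>) \subset G := subsetIl _ _.
  have tiKN : K :&: 'N_G(<[x]>) = 1.
    apply/trivgP; rewrite -tiKX subsetI subsetIl /=.
    have -> : K :&: 'N_G(<[x]>) \subset <[x]>.
      have sN : K :&: 'N_G(<[x]>) \subset 'N(<[x]>) by rewrite setIA subsetIr.
      suff : K :&: 'N_G(<[x]>) \subset 'C_G[x] by rewrite CX.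
      rewrite subsetI -cent_cycle (subset_trans (subsetIl _ _) sKG) /=.
      rewrite (sameP commG1P trivgP) -tiKX subsetI.
      rewrite (subset_trans (commSg _ (subsetIl _ _))) ?commg_subl //.
      by rewrite (subset_trans (commSg _ sN)) // commg_subr.
    by [].
  rewrite sdprodE ?(subset_trans sNG) //; apply/eqP; rewrite eqEcard mul_subG //=.
  by rewrite TI_cardMg // oN oG.
exfalso; have nKX : K <*> <[x]> <| G.
  apply: index2_normal => //; rewrite -divgS // oKX -oG.
  by rewrite divnMl ?cardG_gt0.
have sylX : 3.-Sylow(K <*> <[x]>) <[x]> := pHall_subl (joing_subr _ _) sKX (selfcent3_Sylow sc).
have := Frattini_arg nKX sylX; rewrite NX /= norm_joinEr // -mulgA mulGid => E.
by have := oKX; move/eqP; rewrite norm_joinEr // E -oG eqn_pmul2l ?cardG_gt0.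
Qed.

Lemma fpf3_order4_abelem (aT : finGroupType) (T : {group aT}) y :
  fpf3 T y -> #|T| = 4 -> 2.-abelem T.
Proof.
move=> fT oT; have T2 : 2.-group T by rewrite /pgroup oT.
rewrite -trivg_Phi //; have /and3P[nTy _ _] := fT.
have fP : fpf3 'Phi(T) y.
  apply: fpf3S fT (Phi_sub T) _.
  by apply: subsetP (char_norms (Phi_char T)) y nTy.
have pT : 'Phi(T) \proper T.
  rewrite Phi_proper //; apply/eqP=> T1; by rewrite T1 cards1 in oT.
have := fpf3_card fP; have := proper_card pT; have := cardSg (Phi_sub T).
rewrite oT /= trivg_card1; by move: #|_| => -[|[|[|[|[|n]]]]].
Qed.

Lemma core_cent_sub (A : {set gT}) : A \subset K -> G \subset 'N(A) -> ~~ ('C_G(A) \subset K) ->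
  A \subset [1].
Proof.
move=> sAK nAG; apply: contraR => nA1; rewrite -cent_gen.
have sAK' : <<A>> \subset K by rewrite gen_subG.
apply: (cent_sub_core sc).
- by rewrite /normal (subset_trans sAK') ?pcore_sub //= norms_gen.
- by apply: contra nA1 => /eqP <-; apply: subset_gen.
exact: pgroupS sAK' (pcore_pgroup _ _).
Qed.

(* W, the preimage of T, has class at most two, so it centralizes the derived group
   of K and the squares of K; a normal subgroup of G not inside K contains x, which
   centralizes nothing in K. *)
Lemma core_abelem_of_V4 (T : {group coset_of K}) :
    inv3' (G / K) (coset K x) T -> #|T| = 4 ->
  abelian K /\ (forall a, a \in K -> a * a = 1).
Proof.
move=> iT oT; have Gx : x \in G by case/and3P: sc.
have [W [iW sKW TE _]] := inv3_lift (pcore_normal _ _) Gx (pcore_pgroup _ _) iT.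
have fW := inv3_fpf sc iW; have sWG : W \subset G by case/and3P: iW.
have dW := fpf3_der1_center fW.
have nKG := pcore_normal 3^' G; have [sKG nGK] := andP nKG.
have nsWK : ~~ (W \subset K).
  by apply: contraL (isT : 1 < 4) => sWK; rewrite -oT TE (quotientS1 sWK) cards1.
have cK : abelian K.
  suff : K^`(1) \subset [1] by rewrite derg1 abelianE => /trivgP/commG1P.
  apply: core_cent_sub; first exact: der_sub.
  - exact: subset_trans nGK (char_norms (der_char 1 _)).
  apply: contra nsWK; apply: subset_trans; rewrite subsetI sWG centsC.
  by apply: subset_trans (dergS 1 sKW) (subset_trans dW (subsetIr _ _)).
split=> //.
have scQ := selfcent3_quotient sc nKG (pcore_pgroup _ _).
have E2 : 2.-abelem T := fpf3_order4_abelem (inv3_fpf scQ iT) oT.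
pose A := [set a * a | a in K].
have sAK : A \subset K by apply/subsetP=> _ /imsetP[a Ka ->]; apply: groupM.
have nAG : G \subset 'N(A).
  apply/subsetP=> g Gg; rewrite inE; apply/subsetP=> _ /imsetP[_ /imsetP[a Ka ->] ->].
  rewrite conjMg; apply: imset_f; by rewrite memJ_norm // (subsetP nGK).
suff sA1 : A \subset [1] by move=> a Ka; apply/set1P/(subsetP sA1)/imset_f.
apply: core_cent_sub sAK nAG _; apply: contra nsWK; apply: subset_trans.
rewrite subsetI sWG; apply/centsP=> z Wz _ /imsetP[a Ka ->].
have Wa := subsetP sKW a Ka.
have c_in : [~ a, z] \in W^`(1) by apply: mem_commg.
have cz : commute [~ a, z] z.
  by have /centerP[_ c] := subsetP dW _ c_in; apply: c.
have Nz : z \in 'N(K) by rewrite (subsetP nGK) ?(subsetP sWG).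
have zz : z * z \in K.
  apply: coset_idr; rewrite ?groupM // morphM //; have /abelemP[//|_ E] := E2.
  by apply: E; rewrite TE mem_quotient.
have az : a ^ z = a * [~ a, z] by rewrite commgEl mulKVg.
(* [z * z] lies in the abelian [K], and [[~ a, z]] is central in [W], so conjugating [a] twice by
   [z] multiplies it by the square of the commutator. Then [z] fixes [a * a]. *)
have cc : [~ a, z] * [~ a, z] = 1.
  have : a ^ (z * z) = a by apply/conjg_fixP/commgP; apply: (centsP cK).
  rewrite conjgM az conjMg az [[~ a, z] ^ z](_ : _ = [~ a, z]); last first.
    by apply/conjg_fixP/commgP.
  by rewrite -mulgA => /(canRL (mulKg a)); rewrite mulVg.
have ca : commute a [~ a, z].
  apply: commute_sym; have /centerP[_ c] := subsetP dW _ c_in; exact: c.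
apply/commute_sym/commgP/conjg_fixP; rewrite conjMg az.
move: {az cz c_in} [~ a, z] cc ca => c cc ca.
by rewrite -mulgA (mulgA c) -ca -mulgA cc mulg1.
Qed.

End Lifting.

Lemma GF4_char : 2 \in [pchar GF4]%R.
Proof. exact: s2valP (pPrimePowerField (isT : prime 2) (isT : 0 < 2)). Qed.

Lemma card_GF4 : #|GF4| = 4.
Proof. exact: s2valP' (pPrimePowerField (isT : prime 2) (isT : 0 < 2)). Qed.

(** * The core when the quotient has order 60 or 168 *)

Section Lifting.

Variables (gT : finGroupType) (G : {group gT}) (x : gT).
Hypothesis sc : selfcent3 G x.
Local Notation K := 'O_3^'(G).
Implicit Types (W V : {group gT}).

(** The bound excludes a self-normalizing [<[x]>]. If [t] were in [K], so would be [[~ x, t] = x ^-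
    2 = x]. *)
Lemma inverting_involution : #|K| * 3 < #|G| ->
  exists t, [/\ t \in G, #[t] = 2, x ^ t = x^-1 & t \notin K].
Proof.
move=> ltG; have [NX|[t [Gt ot xt _]]] := selfcent3_norm sc.
  by have := selfnorm3_card_le sc NX; rewrite leqNgt ltG.
exists t; split=> //; apply/negP=> Kt.
have /and3P[Gx /eqP ox _] := sc; have [_ nKG] := andP (pcore_normal 3^' G).
have Kc : [~ x, t] \in K.
  by rewrite -groupV invg_comm commgEl groupM ?groupV // memJ_norm // (subsetP nKG).
have x3 : x ^+ 3 = 1 by rewrite -ox expg_order.
have Kx : x \in K.
  have -> : x = [~ x, t]; last by [].
  by rewrite commgEl xt; apply: (mulgI x); rewrite mulKVg; apply: (mulIg x); rewrite mulVg -x3 !expgS mulg1 mulgA.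
by have := mem_p_elt (pcore_pgroup _ _) Kx; rewrite /p_elt ox.
Qed.

Section Order60Quotient.

Variable T : {group coset_of K}.
Hypotheses (oGK : #|G / K| = 60) (iT : inv3' (G / K) (coset K x) T) (oT : #|T| = 4).

Lemma core_2group : 2.-group K.
Proof.
have [cK K2] := core_abelem_of_V4 sc iT oT.
apply: (@abelem_pgroup _ 2); apply/abelemP => //; split.
Qed.

Lemma card_G60 : #|G| = (#|K| * 60)%N.
Proof.
by rewrite -(Lagrange (pcore_sub 3^' G)) -card_quotient ?normal_norm ?pcore_normal // oGK.
Qed.

Lemma quotient60_Alt5 : G / K \isog 'Alt_('I_5).
Proof.
have Gx : x \in G by case/and3P: sc.
have scQ := selfcent3_quotient sc (pcore_normal _ _) (pcore_pgroup _ _).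
have /and3P[GQx /eqP oxQ _] := scQ; have /and3P[sTG _ T3] := iT.
apply: (order60_Alt5 oGK sTG oT GQx oxQ (inv3_fpf scQ iT)).
apply/negP=> nTG; have : T \subset 'O_3^'(G / K) by apply: pcore_max; rewrite // /normal sTG.
by rewrite trivg_pcore_quotient => /subset_leq_card; rewrite oT cards1.
Qed.

(** Gaschutz' theorem asks for a complement of [K] in the Sylow 2-subgroup [V], the preimage of [T].
    It is generated by [a] and [a ^ x], for [a] in [V] conjugate to an inverting involution outside
    [K]: an invariant four-group, whose proper subgroup [K :&: Q] has order 1 modulo 3. *)
Lemma order60_split : exists H : {group gT}, K ><| H = G.
Proof.
have nKG := pcore_normal 3^' G; have [sKG nGK] := andP nKG.
have Gx : x \in G by case/and3P: sc.
have [cK _] := core_abelem_of_V4 sc iT oT.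
have [V [iV sKV _ oV]] := inv3_lift nKG Gx (pcore_pgroup _ _) iT.
rewrite oT in oV; have fV := inv3_fpf sc iV; have /and3P[sVG nVx _] := iV.
have K2 := core_2group; have oG := card_G60.
have V2 : 2.-group V by rewrite /pgroup oV pnatM -/(pgroup _ _) K2.
have iGV : #|G : V| = 15.
  by rewrite -divgS // oV oG divnMl ?cardG_gt0.
have sylV : 2.-Sylow(G) V by rewrite /pHall sVG V2 iGV.
have ltG : #|K| * 3 < #|G| by rewrite oG ltn_pmul2l ?cardG_gt0.
have [t [Gt ot _ nKt]] := inverting_involution ltG.
have t2 : 2.-group <[t]> by rewrite /pgroup -orderE ot.
have sTG : <[t]> \subset G by rewrite cycle_subG.
have [g Gg sgV] := Sylow_Jsub sylV sTG t2.
pose a := t ^ g; have Va : a \in V by rewrite -cycle_subG cycleJ.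
have oa : #[a] = 2 by rewrite orderJ.
have nKa : a \notin K by rewrite memJ_norm // (subsetP nGK).
have nta : a != 1 by rewrite -order_gt1 oa.
pose c := a ^ x; have oc : #[c] = 2 by rewrite orderJ.
have cac : commute a c by have := fpf3_commJ fV Va (group1 V); rewrite conjg1.
have neac : a != c.
  apply: contra nta => /eqP E; have /and3P[_ _ /eqP C1] := fV.
  have : a \in 'C_V[x] by rewrite inE Va; apply/cent1P/commgP/conjg_fixP.
  by rewrite C1 => /set1P->.
have cAC : <[c]> \subset 'C(<[a]>) by rewrite cent_cycle cycle_subG; apply/cent1P.
pose Q := (<[a]> <*> <[c]>)%G.
have oQ : #|Q| = 4.
  rewrite /= cent_joinEr // TI_cardMg -?orderE ?oa ?oc //.
  have nca : a \notin <[c]> by rewrite (cycle2g oc) !inE negb_or nta.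
  by apply: prime_TIg; rewrite -?orderE ?oa //= cycle_subG.
have Qa : a \in Q by rewrite mem_gen // inE cycle_id.
have Qc : c \in Q by rewrite mem_gen // inE cycle_id orbT.
have nQx : x \in 'N(Q).
  rewrite inE -genJ gen_subG conjUg subUset -!cycleJ !cycle_subG Qc.
  have := fpf3_prod fV Va; rewrite expgS expg1 conjgM -/c => E.
  have -> : c ^ x = (a * c)^-1 by apply/eqP; rewrite eq_sym eq_invg_mul E.
  by rewrite groupV groupM.
have sQV : Q \subset V.
  by rewrite join_subG !cycle_subG Va memJ_norm.
have tiKQ : K :&: Q = 1.
  have fKQ : fpf3 (K :&: Q) x.
    apply: fpf3S fV (subset_trans (subsetIr _ _) sQV) _.
    by rewrite inE conjIg (normP nQx) (normP (subsetP nGK x Gx)).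
  have := fpf3_card fKQ; have : #|K :&: Q| %| 4 by rewrite -oQ cardSg ?subsetIr.
  have : #|K :&: Q| != 4.
    apply: contra nKa => /eqP o4; have QK : K :&: Q = Q.
      by apply/eqP; rewrite eqEcard subsetIr oQ o4.
    by move: Qa; rewrite -[_ \in Q]/(a \in gval Q) -QK => /setIP[].
  move=> n4 d4 m3; apply/card1_trivg; move: n4 d4 m3 => /=.
  by move: #|_| => -[|[|[|[|[|n]]]]].
have defV : K * Q = V.
  apply/eqP; rewrite eqEcard mul_subG //= TI_cardMg // oQ oV leqnn.
  by [].
have spV : [splits V, over K] by apply/splitsP; exists Q; apply/complP.
have co : coprime #|K| #|G : V|.
  by rewrite iGV; apply: (pnat_coprime K2).
have : [splits G, over K] by rewrite (Gaschutz_split nKG sKV sVG cK co).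
case/splitsP=> H /complP[tiKH defG]; exists H.
by rewrite sdprodE // (subset_trans _ nGK) // -defG mulG_subr.
Qed.

Lemma order60_natural (H : {group gT}) : K ><| H = G ->
  H \isog 'Alt_('I_5) /\ direct_product_of_natural_modules 'O_3^'(G)%G H.
Proof.
move=> defG; have [_ _ nKH tiKH] := sdprodP defG; have [nKG sHG _ _ _] := sdprod_context defG.
have isoH : H \isog 'Alt_('I_5) := isog_trans (sdprod_isog defG) quotient60_Alt5.
split=> //; have [cK K2] := core_abelem_of_V4 sc iT oT.
have isoS : H \isog SLgroup 2 GF4.
  by apply: isog_trans isoH _; rewrite isog_sym; apply: SL24_Alt5 GF4_char card_GF4.
have [f injf imf] := isogP isoS.
have isof : isom H (SLgroup 2 GF4) f by apply/isomP.
exists f; split=> //.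
apply: (natural_decomposition GF4_char card_GF4 nKH cK K2 _ isof).
  by move=> y Hy oy; apply: (order3_fpf_core sc); rewrite ?(subsetP sHG).
(* Quadratic action: with [Q] the preimage of the unitriangular group, [K <*> Q] is an invariant
   3'-group for the element [x1] above [diag2 w], so its derived group is central. *)
move=> a y z Ka Hy Hz Uy Uz.
have [w ww] := F4_omega GF4_char card_GF4; have w0 : (w != 0)%R by case/and3P: ww.
have [x1 Hx1 fx1] : exists2 x1, x1 \in H & f x1 = diag2 w.
  have : diag2 w \in f @* H by rewrite imf; apply: diag2_SL.
  by case/morphimP=> x1 Hx1 _ ->; exists x1.
have ox1 : #[x1] = 3 by rewrite -(order_injm injf Hx1) fx1 order_diag2_omega ?GF4_char.
have scx1 := selfcent3_order3 sc (subsetP sHG _ Hx1) ox1.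
pose U := upper2_group GF4; pose Q := (f @*^-1 U)%G.
have sUS : U \subset f @* H.
  by rewrite imf; apply/subsetP=> _ /imsetP[b _ ->]; apply: upper2_SL.
have sQH : Q \subset H := subsetIl _ _.
have oQ : #|Q| = 4.
  by rewrite -(card_injm injf sQH) morphpreK // card_upper2_group ?card_GF4.
have nQx : x1 \in 'N(Q).
  apply: (subsetP (morphpre_norm f U)); apply/morphpreP; split=> //.
  by rewrite fx1 upper2_group_norm.
have nKQ : Q \subset 'N(K) := subset_trans sQH nKH.
have iW : inv3' G x1 (K <*> Q).
  apply/and3P; split.
  - by rewrite join_subG normal_sub //= (subset_trans sQH).
  - have nKx : x1 \in 'N(K) := subsetP nKH _ Hx1.
    by rewrite inE -genJ gen_subG conjUg (normP nKx) (normP nQx) subset_gen.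
  have E : K <*> Q = K * Q := norm_joinEr nKQ.
  by rewrite /pgroup /= E -/(pgroup _ (K * Q)) pgroupM pcore_pgroup /pgroup oQ.
have dW := fpf3_der1_center (inv3_fpf scx1 iW).
have [Qy Qz] : y \in Q /\ z \in Q by split; apply/morphpreP.
have Wc : [~ a, y] \in (K <*> Q)^`(1).
  by apply: mem_commg; rewrite mem_gen // inE ?Ka ?Qy ?orbT.
have /centerP[_] := subsetP dW _ Wc; apply.
by rewrite mem_gen // inE Qz orbT.
Qed.

End Order60Quotient.
Lemma core_trivial_of_order7 (T U : {group coset_of K}) :
    inv3' (G / K) (coset K x) T -> #|T| = 4 ->
    inv3' (G / K) (coset K x) U -> #|U| = 7 ->
  K = 1.
Proof.
move=> iT oT iU oU; have K2 := core_2group iT oT.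
have nKG := pcore_normal 3^' G; have [sKG nGK] := andP nKG.
have Gx : x \in G by case/and3P: sc.
have [W [iW sKW _ oW]] := inv3_lift nKG Gx (pcore_pgroup _ _) iU; rewrite oU in oW.
have [nilW _] := fpf3_class2 (inv3_fpf sc iW).
have sWG : W \subset G by case/and3P: iW.
have /dprodP[_ _ cO _] := nilpotent_pcoreC 7 nilW.
have sKO : K \subset 'O_7^'(W).
  rewrite (sub_Hall_pcore (nilpotent_pcore_Hall _ nilW)) //.
  exact: pi_pnat K2 _.
apply/trivgP; apply: (core_cent_sub sc (subxx _) nGK); apply/negP=> sCK.
have sOK : 'O_7(W) \subset K.
  apply: subset_trans sCK; rewrite subsetI (subset_trans (pcore_sub _ _)) //.
  by rewrite centsC (subset_trans sKO).
have d7 : 7 %| #|W| by rewrite oW dvdn_mull.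
have [y Wy oy] := Cauchy (isT : prime 7) d7.
have Oy : y \in 'O_7(W).
  rewrite -cycle_subG (sub_Hall_pcore (nilpotent_pcore_Hall _ nilW)) ?cycle_subG //.
  by rewrite /pgroup -orderE oy.
by have := mem_p_elt K2 (subsetP sOK y Oy); rewrite /p_elt oy.
Qed.

End Lifting.

Lemma order168_PSL (gT : finGroupType) (G U : {group gT}) x :
    selfcent3 G x -> 'O_3^'(G) = 1 -> #|G| = 168 -> inv3' G x U -> #|U| = 7 ->
  G \isog PSLgroup 2 'F_7.
Proof.
move=> sc O1 oG iU oU; have fU := inv3_fpf sc iU.
have /and3P[sUG nUx U3] := iU; have /and3P[Gx /eqP ox _] := sc.
have [t [Gt ot xt _]] : exists t, [/\ t \in G, #[t] = 2, x ^ t = x^-1 & t \notin 'O_3^'(G)].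
  by apply: (inverting_involution sc); rewrite O1 cards1 oG.
have /cyclicP[u UE] : cyclic U by apply: prime_cyclic; rewrite oU.
have ou : #[u] = 7 by rewrite orderE -UE.
have Gu : u \in G by rewrite (subsetP sUG) // UE cycle_id.
have nUG : ~~ (G \subset 'N(U)).
  apply/negP=> nUG; have : U \subset 'O_3^'(G) by apply: pcore_max; rewrite // /normal sUG.
  by rewrite O1 => /subset_leq_card; rewrite oU cards1.
have nt : t \notin 'N(<[u]>).
  apply/negP; rewrite -UE => Nt; case/negP: nUG.
  have sylU : 7.-Sylow(G) U by rewrite pHallE sUG oU oG p_part; have -> : logn 7 168 = 1%N by [].
  have d3 : 3 %| #|'N_G(U)| by rewrite -ox order_dvdG // inE Gx.
  have d2 : 2 %| #|'N_G(U)| by rewrite -ot order_dvdG // inE Gt.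
  have d7 : 7 %| #|'N_G(U)| by rewrite -oU cardSg // subsetI sUG normG.
  (* The index of the normalizer then divides 4 and is 1 modulo 7, so [U] would be normal in [G]. *)
  have d42 : 42 %| #|'N_G(U)| by rewrite (@Gauss_dvd 6 7) // (@Gauss_dvd 2 3) // d2 d3.
  have := card_Syl_mod G (isT : prime 7); rewrite (card_Syl sylU).
  have := Lagrange (subsetIl G 'N(U)); rewrite oG; case/dvdnP: d42 => a ->.
  rewrite [(a * 42)%N]mulnC -mulnA => /eqP; rewrite -[168]/(42 * 4)%N eqn_pmul2l // => /eqP ai i7.
  have i1 : #|G : 'N_G(U)| = 1%N.
    have : #|G : 'N_G(U)| %| 4 by rewrite -ai dvdn_mull.
    by move: i7; move: #|_ : _| => -[|[|[|[|[|n]]]]].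
  by move/eqP: i1; rewrite indexg_eq1 subsetI subxx.
have x3 : x ^+ 3 = 1 by rewrite -ox expg_order.
have xtV : (x^-1) ^ t = x^-1^-1 by rewrite conjVg xt.
have oxV : #[x^-1] = 3 by rewrite orderV.
(* [x] acts by an exponent whose cube is 1 modulo 7, that is 1, 2 or 4. It fixes no nontrivial
   element, which excludes 1, and 4 becomes 2 on passing to [x^-1]. *)
have [ux|ux] : u ^ x = u ^+ 2 \/ u ^ x^-1 = u ^+ 2.
- have : u ^ x \in <[u]> by rewrite -UE memJ_norm // UE cycle_id.
  case/cyclePmin=> k; rewrite ou => k7 ux.
  have e2 : (u ^ x) ^ x = u ^+ (k * k) by rewrite {1}ux conjXg ux -expgM.
  have e3 : ((u ^ x) ^ x) ^ x = u ^+ (k * (k * k)) by rewrite e2 conjXg ux -expgM.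
  have : u ^+ (k * (k * k)) == u ^+ 1.
    by rewrite -e3 -!conjgM -[x * (x * x)]/(x ^+ 3) x3 conjg1.
  rewrite eq_expg_mod_order ou; case: k k7 ux {e2 e3} => [|[|[|[|[|[|[|k]]]]]]] // _ ux _.
  + have /and3P[_ _ /eqP C1] := fU.
    have : u \in 'C_U[x] by rewrite inE UE cycle_id; apply/cent1P/commgP/conjg_fixP.
    by rewrite C1 => /set1P u1; move: ou; rewrite u1 order1.
  + by left.
  right; apply: (canLR (conjgK x)); rewrite conjXg ux -expgM.
  by apply/eqP; rewrite -{1}[u]expg1 eq_expg_mod_order ou.
- by apply: (PSL27_isog oG (And3 Gu Gx Gt)).
by apply: (PSL27_isog oG (And3 Gu (groupVr Gx) Gt)).
Qed.

Lemma isolated_edge_selfcent3 (gT : finGroupType) (G : {group gT}) v w :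
  'Z(G) = 1 -> isolated_edge (commuting_graph G) v w -> selfcent3 G v.
Proof.
move=> Z1 [/and4P[]]; rewrite Z1 => /setD1P[ntv Gv] /setD1P[ntw Gw] nevw /eqP cvw conn.
have sC : 'C_G[v] = [set 1; v; w].
  apply/eqP; rewrite eqEsubset; apply/andP; split; apply/subsetP=> z; last first.
    case/setUP=> [/set2P[]|/set1P] ->; first exact: group1.
      by rewrite inE Gv cent1id.
    by rewrite inE Gw; apply/cent1P.
  case/setIP=> Gz /cent1P cz; rewrite -setUA in_setU1 orbC; apply/orP.
  have [->|ntz] := eqVneq z 1; [by right | left].
  rewrite -conn inE; have [->|nez] := eqVneq z v; first exact: connect0.
  apply: connect1; rewrite /commuting_graph /= Z1 !inE ntv Gv ntz Gz eq_sym nez /=.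
  exact/eqP.
have C3 : #|'C_G[v]| = 3.
  rewrite sC -setUA cardsU1 cards2 !inE negb_or nevw ![1 == _]eq_sym ntv ntw; by [].
have sVC : <[v]> \subset 'C_G[v] by rewrite cycle_subG inE Gv cent1id.
have ov : #[v] = 3.
  have := cardSg sVC; rewrite C3 -orderE; have := order_gt1 v; rewrite ntv.
  by move: #[v] => -[|[|[|[|n]]]].
rewrite /selfcent3 Gv ov eqxx /= eq_sym eqEcard sVC C3 -orderE ov; by [].
Qed.

Theorem lemma3p14 (gT : finGroupType) (G : {group gT}) :
  'Z(G) = 1 ->
  (exists v w : gT, isolated_edge (commuting_graph G) v w) ->
  [\/ exists N K : {group gT},
        [/\ N ><| K = G,
            K \isog [set: 'Z_3] \/ K \isog 'Sym_('I_3),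
            nilpotent N /\ (nil_class N <= 2)%N,
            #|N| = 1 %[mod 3]
          & forall x, x \in G -> #[x] = 3%N ->
              fixed_point_free_aut N (conj_aut N x)],
      exists N H : {group gT},
        [/\ N ><| H = G,
            H \isog 'Alt_('I_5)
          & direct_product_of_natural_modules N H]
    | G \isog PSLgroup 2 'F_7].
Proof.
move=> Z1 [x [w /(isolated_edge_selfcent3 Z1) sc]].
have nKG := pcore_normal 3^' G; have K3 := pcore_pgroup 3^' G.
have Gx : x \in G by case/and3P: sc.
have scQ := selfcent3_quotient sc nKG K3.
have [i36|[o60 [T iT oT]]|[o168 [T iT oT] [U iU oU]]] :=
    core1_classify scQ (trivg_pcore_quotient _ _).
- apply: Or31; have [C [defG isoC]] := index3_6_sdprod sc i36.
  exists 'O_3^'(G)%G, C; split=> //.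
  + exact: fpf3_class2 (inv3_fpf sc (inv3_core sc)).
  + exact: core_card_mod3 sc.
  exact: order3_fixed_point_free sc.
- apply: Or32; have [H defG] := order60_split sc o60 iT oT.
  exists 'O_3^'(G)%G, H; split=> //; by have [] := order60_natural sc o60 iT oT defG.
apply: Or33; have K1 := core_trivial_of_order7 sc iT oT iU oU.
have [W [iW _ _ oW]] := inv3_lift nKG Gx K3 iU.
have oK : #|'O_3^'(G)%G| = 1%N by rewrite /= K1 cards1.
apply: (order168_PSL sc K1 _ iW); last by rewrite oW oK oU.
by rewrite -(Lagrange (normal_sub nKG)) -card_quotient ?normal_norm // oK mul1n; apply: o168.
Qed.
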